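(* Let $k\ge 0$, let $\lambda,\mu$ be $k$-strict partitions forming a compatible pair, choose $n\ge1$ with $w_\lambda\in W_n$, and let $w:=w_\lambda w_\mu^{-1}$. Then \[ \mathfrak{C}_w(Z;X,Y)=\sum_U 2^{n(U)}(xyz)^U, \] summed over all $k$-tritableaux $U$ of shape $\lambda/\mu$.
   Context: $W_n$: signed permutations of $\{1,\ldots,n\}$, $w=(w_1,\ldots,w_n)$, $\overline a:=-a$, generated by $s_0$ (sign change of the first entry) and $s_i=(i,i+1)$; $\ell$ is length; $S_n$ is generated by $s_1,\ldots,s_{n-1}$. A product $u_1\cdots u_r=w$ is a reduced factorization if $\sum\ell(u_i)=\ell(w)$. NilCoxeter algebra $\mathbb{W}_n$: generated by $\xi_0,\ldots,\xi_{n-1}$ with $\xi_i^2=0$, $\xi_i\xi_j=\xi_j\xi_i$ ($|i-j|\ge2$), $\xi_i\xi_{i+1}\xi_i=\xi_{i+1}\xi_i\xi_{i+1}$ ($i>0$), $\xi_0\xi_1\xi_0\xi_1=\xi_1\xi_0\xi_1\xi_0$; $\xi_w:=\xi_{a_1}\cdots\xi_{a_r}$ for a reduced word of $w$; $\langle\alpha,w\rangle$ is the coefficient of $\xi_w$. Set $A_i(t):=(1+t\xi_{n-1})\cdots(1+t\xi_i)$, $\tilde A_i(t):=(1-t\xi_i)\cdots(1-t\xi_{n-1})$, $C(t):=(1+t\xi_{n-1})\cdots(1+t\xi_1)(1+t\xi_0)(1+t\xi_0)(1+t\xi_1)\cdots(1+t\xi_{n-1})$, $C(Z):=C(z_1)C(z_2)\cdots$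 for variables $Z=(z_1,z_2,\ldots)$, $X$, $Y$ as well. Then $\mathfrak{C}_w(Z;X,Y):=\langle\tilde A_{n-1}(y_{n-1})\cdots\tilde A_1(y_1)C(Z)A_1(x_1)\cdots A_{n-1}(x_{n-1}),w\rangle$. $k$-Grassmannian: $0<w_1<\cdots<w_k$, $w_{k+1}<w_{k+2}<\cdots$. $k$-strict partition: no part $>k$ repeated; $\ell_k(\lambda)$ = number of parts $>k$. With $\gamma_1\le\cdots\le\gamma_k$ the sorted lengths of the first $k$ columns of $\lambda$: $w_\lambda(j)=\gamma_j+j-\#\{p\in[1,\ell_k(\lambda)]:\lambda_p+p>\gamma_j+j+k\}$ ($1\le j\le k$), $w_\lambda(k+i)=k-\lambda_i$ ($1\le i\le\ell_k(\lambda)$), remaining entries the other positive integers in increasing order. $(\lambda,\mu)$ is a compatible pair if $\ell(w_\lambda)=\ell(w_\lambda w_\mu^{-1})+\ell(w_\mu)$. Boxes $[r,c]$; diagrams include all row-zero boxes. Rim of $\lambda$: boxes $[r,c]\in\lambda$ with $[r+1,c+1]\notin\lambda$. $k'$-related: $|c-k-\frac12|+r=|c'-k-\frac12|+r'$. Left box: $c\le k$; right box: $c>k$. For $k$-strict $\mu\subset\lambda$, $R$ (resp. $\mathbb{A}$) is the set of right boxes $[r,c]$ of $\mu$ (including row zero) with $[r+1,c]\notin\lambda$ that are (resp. are not) $k'$-related to a left box of $\lambda/\mu$. $\lambda/\mu$ is a $k$-horizontal strip if (i) $\lambda/\mu$ lies in the rim of $\lambda$ and its right boxes form a horizontal strip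 (no two in one column); (ii) no two boxes of $R$ are $k'$-related; (iii) two boxes of $\lambda/\mu$ in the same column are $k'$-related to exactly two boxes of $R$, lying in the same row. Two boxes of $\mathbb{A}$ are connected if they share an edge or vertex; $n(\lambda/\mu)$ is the number of connected components of $\mathbb{A}$ with no box in column $k+1$. An element of $S_n$ is decreasing down to 1 (resp. increasing up from 1) if it has a reduced word $a_1>\cdots>a_r\ge1$ (resp. $1\le a_1<\cdots<a_r$); a $k$-horizontal strip $\lambda/\mu$ is an $x$-strip (resp. $y$-strip) if $w_\lambda w_\mu^{-1}\in S_n$ is decreasing down to 1 (resp. increasing up from 1). Let $\mathbf{Q}$ be the ordered alphabet $(n-1)'<\cdots<1'<1<2<3<\cdots<1''<2''<\cdots<(n-1)''$; primed and double-primed symbols are marked, positive integers unmarked. For a filling $U$ of $\lambda/\mu$ and $a\in\mathbf Q$, let $U_{\le a}$ (resp. $U_{<a}$) be the union of $\mu$ with the boxes whose entry is $\le a$ (resp. $<a$). A $k$-tritableau of shape $\lambda/\mu$ is a filling $U$ of $\lambda/\mu$ by elements of $\mathbf Q$, weakly increasing along rows and down columns, such that (i) for each $a\in\mathbf Q$, $U_{<a}\subset U_{\le a}$ are $k$-strict partitions and $U_{\le a}/U_{<a}$ is a $k$-horizontal strip, which is an $x$-strip if $a\in[(n-1)',1']$ and a $y$-strip if $a\in[1'',(n-1)'']$; (ii) for $1\le i\le\ell_k(\mu)$ the entries in row $i$ are $\ge(\mu_i-k)'$, for $1\le i\le\ell_k(\lambda)$ the entries in row $i$ are $\le(\lambda_i-k-1)''$,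 and for $1\le j\le k$ the entries in column $k+1-j$ lie in $[(w_\mu(j))',(w_\lambda(j)-1)'']$. Set $n(U):=\sum_{a\ge1\text{ unmarked}}n(U_{\le a}/U_{<a})$ and $(xyz)^U:=\prod_i z_i^{m_i}\prod_i x_i^{n_i'}\prod_i(-y_i)^{n_i''}$, where $m_i,n_i',n_i''$ are the numbers of entries equal to $i$, $i'$, $i''$ respectively. *)

(* Defs.v *)
From HB Require Import structures.
From mathcomp Require Import all_boot all_order all_algebra.
From mathcomp Require Import finmap.
From mathcomp Require Import boolp classical_sets functions cardinality fsbigop.
From mathcomp Require Import monalg zify.

Set Implicit Arguments.
Unset Strict Implicit.
Unset Printing Implicit Defensive.

Import GRing.Theory Num.Theory.

Local Open Scope classical_set_scope.
Local Open Scope ring_scope.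

(* The union of all the W_n: signed permutations are odd bijections of int
   moving finitely many integers, and w_i is the value w i at i > 0. *)
Record signed_perm := SignedPerm {
  sp_fun :> int -> int;
  sp_inv_fun : int -> int;
  sp_funK : cancel sp_fun sp_inv_fun;
  sp_inv_funK : cancel sp_inv_fun sp_fun;
  sp_odd : forall a : int, sp_fun (- a) = - sp_fun a;
  sp_finite : exists n : nat, forall a : int, (n < `|a|)%N -> sp_fun a = a }.

HB.instance Definition _ := gen_eqMixin signed_perm.
HB.instance Definition _ := gen_choiceMixin signed_perm.

Lemma signed_permP (u v : signed_perm) : u =1 v -> u = v.
Proof.
case: u v => [f f' fK f'K fo ff] [g g' gK g'K go gf] /= /funext E.
move: gK g'K go gf; rewrite -{}E => gK g'K go gf.
have E : f' = g' by apply/funext => x; apply: (can_inj fK); rewrite f'K g'K.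
move: gK g'K; rewrite -{}E => gK g'K.
by congr SignedPerm; apply: Prop_irrelevance.
Qed.

Definition sp_one : signed_perm.
Proof.
exists id id => //.
by exists 0%N.
Defined.

Definition sp_mul (u v : signed_perm) : signed_perm.
Proof.
exists (sp_fun u \o sp_fun v) (sp_inv_fun v \o sp_inv_fun u).
- by move=> x /=; rewrite !sp_funK.
- by move=> x /=; rewrite !sp_inv_funK.
- by move=> x /=; rewrite !sp_odd.
case: (sp_finite u) (sp_finite v) => [m hm] [n hn]; exists (maxn m n) => a.
by rewrite gtn_max => /andP[ma na] /=; rewrite hn // hm.
Defined.

Definition sp_inv (u : signed_perm) : signed_perm.
Proof.
exists (sp_inv_fun u) (sp_fun u).
- exact: sp_inv_funK.
- exact: sp_funK.
- by move=> a; apply: (can_inj (sp_funK u)); rewrite sp_odd !sp_inv_funK.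
case: (sp_finite u) => [n hn]; exists n => a na.
by apply: (can_inj (sp_funK u)); rewrite sp_inv_funK hn.
Defined.

Lemma sp_mulA : associative sp_mul.
Proof. by move=> u v w; apply: signed_permP. Qed.

Lemma sp_mul1 : left_id sp_one sp_mul.
Proof. by move=> u; apply: signed_permP. Qed.

Lemma sp_mulr1 : right_id sp_one sp_mul.
Proof. by move=> u; apply: signed_permP. Qed.

Lemma sp_mulV : left_inverse sp_one sp_inv sp_mul.
Proof. by move=> u; apply: signed_permP => x /=; rewrite sp_funK. Qed.

Lemma sp_mulrV : right_inverse sp_one sp_inv sp_mul.
Proof. by move=> u; apply: signed_permP => x /=; rewrite sp_inv_funK. Qed.

HB.instance Definition _ :=
  isGroup.Build signed_perm sp_mulA sp_mul1 sp_mulr1 sp_mulV sp_mulrV.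

Definition W (n : nat) : set signed_perm :=
  [set w : signed_perm | forall a : int, (n < `|a|)%N -> w a = a].

Definition simple_fun (i : nat) (a : int) : int :=
  if i is 0 then (if (`|a| == 1)%N then - a else a)
  else if a == i%:Z then i.+1%:Z
  else if a == i.+1%:Z then i%:Z
  else if a == - i%:Z then - i.+1%:Z
  else if a == - i.+1%:Z then - i%:Z
  else a.

Lemma simple_fun_cases (i : nat) (a b : int) : simple_fun i.+1 a = b ->
  [\/ a = i.+1%:Z /\ b = i.+2%:Z, a = i.+2%:Z /\ b = i.+1%:Z,
      a = - i.+1%:Z /\ b = - i.+2%:Z | a = - i.+2%:Z /\ b = - i.+1%:Z] \/
  [/\ b = a, `|a|%N <> i.+1 & `|a|%N <> i.+2].
Proof.
rewrite /simple_fun => <-.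
case: eqP => [->|?]; first by left; constructor 1.
case: eqP => [->|?]; first by left; constructor 2.
case: eqP => [->|?]; first by left; constructor 3.
case: eqP => [->|?]; first by left; constructor 4.
by right; split => //; lia.
Qed.

Lemma simple_funK (i : nat) : involutive (simple_fun i).
Proof.
case: i => [|i] a.
  by rewrite /simple_fun; case h: (`|a| == 1)%N; rewrite ?abszN h ?opprK.
case: (simple_fun_cases (erefl (simple_fun i.+1 a))) => [[]|] [];
case: (simple_fun_cases (erefl (simple_fun i.+1 (simple_fun i.+1 a)))) => [[]|] [];
lia.
Qed.

Lemma simple_fun_odd (i : nat) (a : int) : simple_fun i (- a) = - simple_fun i a.
Proof.
case: i => [|i]; first by rewrite /simple_fun abszN; case: ifP.
case: (simple_fun_cases (erefl (simple_fun i.+1 a))) => [[]|] [];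
case: (simple_fun_cases (erefl (simple_fun i.+1 (- a)))) => [[]|] []; lia.
Qed.

Lemma simple_fun_finite (i : nat) :
  exists n : nat, forall a : int, (n < `|a|)%N -> simple_fun i a = a.
Proof.
exists i.+1 => a; case: i => [|i] ?.
  by rewrite /simple_fun; case: ifPn => //; lia.
case: (simple_fun_cases (erefl (simple_fun i.+1 a))) => [[]|] []; lia.
Qed.

Definition simple (i : nat) : signed_perm :=
  SignedPerm (@simple_funK i) (@simple_funK i) (@simple_fun_odd i)
    (simple_fun_finite i).

Definition word_prod (a : seq nat) : signed_perm :=
  (\prod_(i <- a) simple i)%g.

Definition sp_length (w : signed_perm) : nat :=
  xget 0%N [set m | (exists2 a, word_prod a = w & size a = m) /\
                    forall a, word_prod a = w -> (m <= size a)%N].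

Definition reduced_word (a : seq nat) (w : signed_perm) : Prop :=
  word_prod a = w /\ size a = sp_length w.

Definition decreasing_down_to_1 (n : nat) (w : signed_perm) : Prop :=
  exists a : seq nat,
    [/\ reduced_word a w, sorted gtn a & all (fun i => 1 <= i < n)%N a].

Definition increasing_up_from_1 (n : nat) (w : signed_perm) : Prop :=
  exists a : seq nat,
    [/\ reduced_word a w, sorted ltn a & all (fun i => 1 <= i < n)%N a].

(* The nilCoxeter algebra is the quotient of the free algebra on xi_0, ...,
   xi_{n-1} (the monoid algebra of words) by the ideal [nilcox_ideal]; its
   elements are handled through representatives in the free algebra. *)
Section NilCoxeter.

Variables (n : nat) (R : comNzRingType).

Local Notation free_alg := {malg R[{fmonom 'I_n}]}.

Definition xi (i : 'I_n) : free_alg := << fmu i >>.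

Inductive nilcox_relator : free_alg -> Prop :=
| Rel_square (i : 'I_n) : nilcox_relator (xi i * xi i)
| Rel_commute (i j : 'I_n) : (i.+2 <= j)%N ->
    nilcox_relator (xi i * xi j - xi j * xi i)
| Rel_braid3 (i j : 'I_n) : (0 < i)%N -> j = i.+1 :> nat ->
    nilcox_relator (xi i * xi j * xi i - xi j * xi i * xi j)
| Rel_braid4 (i j : 'I_n) : i = 0%N :> nat -> j = 1%N :> nat ->
    nilcox_relator (xi i * xi j * xi i * xi j - xi j * xi i * xi j * xi i).

Inductive nilcox_ideal : free_alg -> Prop :=
| Ideal_zero : nilcox_ideal 0
| Ideal_gen p r q : nilcox_relator r -> nilcox_ideal (p * r * q)
| Ideal_add p q : nilcox_ideal p -> nilcox_ideal q -> nilcox_ideal (p + q).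

Definition xi_perm (w : signed_perm) : free_alg :=
  \prod_(i <- xget [::] [set a : seq 'I_n | reduced_word (map val a) w]) xi i.

(* alpha = sum of the c_v xi_v in the quotient, and the coefficient is c_w. *)
Definition nilcox_coef (alpha : free_alg) (w : signed_perm) : R :=
  xget 0 [set x | exists2 c : signed_perm -> R,
    nilcox_ideal (alpha - \sum_(v \in W n) c v *: xi_perm v) & x = c w].

Definition A_prod (i : nat) (t : R) : free_alg :=
  \prod_(j <- rev (enum 'I_n) | (i <= j)%N) (1 + t *: xi j).

Definition Atilde_prod (i : nat) (t : R) : free_alg :=
  \prod_(j <- enum 'I_n | (i <= j)%N) (1 - t *: xi j).

Definition C_prod (t : R) : free_alg :=
  (\prod_(j <- rev (enum 'I_n)) (1 + t *: xi j)) *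
  (\prod_(j <- enum 'I_n) (1 + t *: xi j)).

End NilCoxeter.

(* [Primed i], [Plain i], [DPrimed i] are the symbols i', i, i''. They also
   index the variables x_i, z_i, y_i respectively. *)
Inductive letter : Type := Primed of nat | Plain of nat | DPrimed of nat.

Definition letter_code (a : letter) : nat + nat + nat :=
  match a with
  | Primed i => inl (inl i) | Plain i => inl (inr i) | DPrimed i => inr i
  end.

Definition letter_decode (c : nat + nat + nat) : letter :=
  match c with
  | inl (inl i) => Primed i | inl (inr i) => Plain i | inr i => DPrimed i
  end.

Lemma letter_codeK : cancel letter_code letter_decode. Proof. by case. Qed.

HB.instance Definition _ := Countable.copy letter (can_type letter_codeK).

Definition in_alphabet (n : nat) (a : letter) : bool :=
  match a with
  | Primed i | DPrimed i => (1 <= i < n)%N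
  | Plain i => (1 <= i)%N
  end.

(* The order is defined on all indices, so that bounds such as n' or 0'',
   which fall just outside the alphabet, make sense. *)
Definition letter_le (a b : letter) : bool :=
  match a, b with
  | Primed i, Primed j => (j <= i)%N
  | Plain i, Plain j | DPrimed i, DPrimed j => (i <= j)%N
  | Primed _, _ | Plain _, DPrimed _ => true
  | _, _ => false
  end.

Definition letter_lt (a b : letter) : bool := (a != b) && letter_le a b.

Notation monomial := {cmonom letter}.
Notation polyZ := {malg int[monomial]}.

Definition var_x (i : nat) : polyZ := << ucm (Primed i) >>.
Definition var_z (i : nat) : polyZ := << ucm (Plain i) >>.
Definition var_y (i : nat) : polyZ := << ucm (DPrimed i) >>.

(* Formal power series in all the variables x_i, z_i, y_i, as coefficient
   functions. *)
Definition fps : Type := monomial -> int.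

Definition fps_lim (p : nat -> polyZ) : fps := fun m =>
  xget 0 [set c | exists N0, forall N, (N0 <= N)%N -> (p N)@_m = c].

Definition fps_has_sum (I : choiceType) (D : set I) (p : I -> polyZ)
    (g : fps) : Prop :=
  forall m : monomial,
    finite_set (D `&` [set i | (p i)@_m != 0]) /\
    \sum_(i \in D) (p i)@_m = g m.

(* C(Z) is an infinite product: [N] is the number of its factors C(z_i) kept
   before passing to the coefficientwise limit in [schubert_C]. *)
Definition schubert_C_trunc (n : nat) (w : signed_perm) (N : nat) : polyZ :=
  nilcox_coef
    ((\prod_(i <- rev (iota 1 n.-1)) Atilde_prod n i (var_y i)) *
     (\prod_(i <- iota 1 N) C_prod n (var_z i)) *
     (\prod_(i <- iota 1 n.-1) A_prod n i (var_x i))) w.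

Definition schubert_C (n : nat) (w : signed_perm) : fps :=
  fps_lim (schubert_C_trunc n w).

Definition is_partition (lam : seq nat) : bool :=
  sorted geq lam && (0%N \notin lam).

Definition kstrict (k : nat) (lam : seq nat) : bool :=
  is_partition lam && all (fun p => (k < p)%N ==> (count_mem p lam == 1%N)) lam.

Definition part (lam : seq nat) (i : nat) : nat := nth 0%N lam i.-1.

Definition num_large (k : nat) (lam : seq nat) : nat :=
  count (fun p => k < p)%N lam.

Definition col_length (lam : seq nat) (c : nat) : nat :=
  count (fun p => c <= p)%N lam.

Definition gamma (k : nat) (lam : seq nat) (j : nat) : nat :=
  nth 0%N (sort leq [seq col_length lam c | c <- iota 1 k]) j.-1.

(* The last two conditions say that the remaining entries are the other
   positive integers, in increasing order. *)
Definition kgrass (k : nat) (lam : seq nat) : signed_perm :=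
  let l := num_large k lam in
  xget sp_one [set w : signed_perm |
    [/\ forall j : nat, (1 <= j <= k)%N ->
          w j = (gamma k lam j + j)%:Z -
            (count (fun p => gamma k lam j + j + k < part lam p + p)%N
               (iota 1 l))%:Z,
        forall i : nat, (1 <= i <= l)%N -> w (k + i)%N = k%:Z - (part lam i)%:Z,
        forall i : nat, (k + l < i)%N -> 0 < w i
      & forall i j : nat, (k + l < i < j)%N -> w i < w j]].

Definition compatible_pair (k : nat) (lam mu : seq nat) : Prop :=
  let u := kgrass k lam in
  let v := kgrass k mu in
  sp_length u = (sp_length (u * v^-1)%g + sp_length v)%N.

(* The box [r, c] is the pair (r, c); diagrams contain all of row zero. *)
Definition box : Type := (nat * nat)%type.

Definition in_diag (lam : seq nat) (b : box) : bool :=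
  (1 <= b.2)%N && ((b.1 == 0%N) || (b.2 <= part lam b.1)%N).

Definition diag (lam : seq nat) : set box := [set b | in_diag lam b].

Section Strips.

Variable k : nat.

Definition left_box (b : box) : bool := (b.2 <= k)%N.
Definition right_box (b : box) : bool := (k < b.2)%N.

Definition kdist (b : box) : rat := `|b.2%:R - k%:R - 1 / 2%:R| + b.1%:R.
Definition krelated (b d : box) : bool := kdist b == kdist d.

Definition rim (L : set box) : set box :=
  [set b | L b /\ ~ L (b.1.+1, b.2.+1)].

(* Below, L and M are the diagrams of lambda and mu. *)
Definition exposed_right (L M : set box) : set box :=
  [set b | [/\ M b, right_box b & ~ L (b.1.+1, b.2)]].

Definition R_set (L M : set box) : set box :=
  [set b | exposed_right L M b /\
    exists d, [/\ (L `\` M) d, left_box d & krelated b d]].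

Definition A_set (L M : set box) : set box :=
  exposed_right L M `\` R_set L M.

(* In the last condition, the boxes of R that are k'-related to b or to d are
   exactly two, and lie in one row. *)
Definition k_horizontal_strip (L M : set box) : Prop :=
  [/\ M `<=` L,
      L `\` M `<=` rim L /\
      (forall b d, (L `\` M) b -> (L `\` M) d -> right_box b -> right_box d ->
         b.2 = d.2 -> b = d),
      forall b d, R_set L M b -> R_set L M d -> krelated b d -> b = d
    & forall b d, (L `\` M) b -> (L `\` M) d -> b != d -> b.2 = d.2 ->
        exists e1 e2 : box, [/\ e1 != e2, e1.1 = e2.1 &
          R_set L M `&` [set e | krelated b e || krelated d e]
            = [set e1; e2]]].

Definition touching (b d : box) : bool :=
  [&& b != d, (b.1 <= d.1.+1)%N, (d.1 <= b.1.+1)%N,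
      (b.2 <= d.2.+1)%N & (d.2 <= b.2.+1)%N].

Definition connected_in (S : set box) (b d : box) : Prop :=
  exists p : seq box, [/\ path touching b p, last b p = d
                        & forall e, e \in b :: p -> S e].

Definition box_components (S : set box) : set (set box) :=
  [set connected_in S b | b in S].

Definition n_strip (L M : set box) : nat :=
  #|` fset_set (box_components (A_set L M) `&`
                [set D | forall b, D b -> b.2 <> k.+1]) |.

End Strips.

Definition x_strip (n k : nat) (lam mu : seq nat) : Prop :=
  k_horizontal_strip k (diag lam) (diag mu) /\
  decreasing_down_to_1 n (kgrass k lam * (kgrass k mu)^-1)%g.

Definition y_strip (n k : nat) (lam mu : seq nat) : Prop :=
  k_horizontal_strip k (diag lam) (diag mu) /\
  increasing_up_from_1 n (kgrass k lam * (kgrass k mu)^-1)%g.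

Definition skew_boxes (lam mu : seq nat) : seq box :=
  [seq b <- allpairs pair (iota 1 (size lam)) (iota 1 (part lam 1))
     | in_diag lam b && ~~ in_diag mu b].

Section Tritableaux.

Variables (n k : nat) (lam mu : seq nat).

Definition skew : finType := seq_sub (skew_boxes lam mu).

Definition filling : Type := {ffun skew -> letter}.

Definition U_le (U : filling) (a : letter) : set box :=
  diag mu `|` [set b | exists2 c : skew, val c = b & letter_le (U c) a].

Definition U_lt (U : filling) (a : letter) : set box :=
  diag mu `|` [set b | exists2 c : skew, val c = b & letter_lt (U c) a].

Definition strip_condition (U : filling) (a : letter) : Prop :=
  exists nu rho : seq nat,
    [/\ kstrict k nu /\ kstrict k rho,
        diag nu = U_le U a /\ diag rho = U_lt U a,
        k_horizontal_strip k (diag nu) (diag rho),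
        (if a is Primed _ then x_strip n k nu rho else True)
      & (if a is DPrimed _ then y_strip n k nu rho else True)].

Definition row_bounds (U : filling) (c : skew) : Prop :=
  let r := (val c).1 in
  ((r <= num_large k mu)%N -> letter_le (Primed (part mu r - k)) (U c)) /\
  ((r <= num_large k lam)%N -> letter_le (U c) (DPrimed (part lam r - k - 1))).

Definition column_bounds (U : filling) (c : skew) : Prop :=
  forall j : nat, (1 <= j <= k)%N -> (val c).2 = (k + 1 - j)%N ->
    letter_le (Primed `|kgrass k mu j|) (U c) /\
    letter_le (U c) (DPrimed (`|kgrass k lam j| - 1)).

Definition ktritableau : set filling := [set U : filling |
  [/\ (forall c, in_alphabet n (U c)),
      (forall c d, (val c).1 = (val d).1 -> ((val c).2 <= (val d).2)%N ->
         letter_le (U c) (U d)),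
      (forall c d, (val c).2 = (val d).2 -> ((val c).1 <= (val d).1)%N ->
         letter_le (U c) (U d)),
      (forall a, in_alphabet n a -> strip_condition U a)
    & forall c, row_bounds U c /\ column_bounds U c]].

Definition n_tableau (U : filling) : nat :=
  (\big[addn/0]_(a \in [set a | 1 <= a])
     n_strip k (U_le U (Plain a)) (U_lt U (Plain a)))%N.

Definition letter_weight (a : letter) : polyZ :=
  match a with
  | Primed i => var_x i | Plain i => var_z i | DPrimed i => - var_y i
  end.

Definition xyz (U : filling) : polyZ := \prod_(c : skew) letter_weight (U c).

End Tritableaux.

(* Main.v *)
(* A k-strict partition lambda is encoded by the word whose v-th letter tells
   whether the value at v of the inverse of w_lambda is negative, between 1 and
   k, or larger than k. A left multiplication of w_lambda by s_v that increases the
   length exchanges two increasing letters at v and v + 1 (or turns the first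
   letter from "larger than k" to "negative" if v = 0), so that xi_v acts on
   words by a 0-1 matrix. With Matsumoto's theorem, the coefficient of xi_w for
   w = w_lambda w_mu^-1 is the (lambda, mu) entry of the corresponding matrix.

   Expanding the product of the matrices of the factors Atilde, C and A along
   paths gives a sum over chains of k-strict partitions from mu to lambda, one
   step for each letter of the alphabet, that is over fillings of lambda/mu. The
   entry of C(t) follows by induction on n from the numbers of letters crossing
   each cut between two positions v and v + 1: it is nonzero exactly for
   k-horizontal strips, and then it is t^|lambda/mu| times 2 to the number of
   maximal runs of crossed cuts, which is n(lambda/mu). The factors A_i and
   Atilde_i involve only the s_v with v >= i; that no cut v < i is crossed is
   what the bounds on the entries of rows and columns express. *)

Require Import Defs.
From mathcomp Require Import all_boot all_order all_fingroup all_algebra.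
From mathcomp Require Import finmap boolp classical_sets cardinality.
From mathcomp Require Import fsbigop monalg zify lra ring.

Set Implicit Arguments.
Unset Strict Implicit.
Unset Printing Implicit Defensive.

Import Order.TTheory GRing.Theory Num.Theory.

Local Open Scope nat_scope.

(** * Partitions and their columns *)

(** The rightmost factor acts first, so the primed and double-primed factors come in the order of
    the alphabet, but C(z_1)C(z_2)... applies z_N before z_1. Reversing it needs the C(z_i) to
    commute, which is why the Yang-Baxter and reflection equations appear. The nilCoxeter
    coefficient is chosen among all possible expansions; it is pinned down by a linear functional
    that vanishes on the ideal and is dual to xi_w, namely one matrix entry of the action on words.
    Box geometry becomes arithmetic of cuts because [fc k mu v] is the k'-distance (less 1/2) of the
    lowest box of column k + v + 1 of mu, while the j-th letter 1 records the left column k + 1 - j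
    through [gc]. The powers of 2 come from the lowest crossed cut of each run: its reflection can
    be taken from either half of C(t), and all other choices are forced. The hypotheses place w_lam,
    but not w_mu, in W_n, so the path from mu to lam is first built in a larger group and then shown
    to use only s_v with v < n. *)

Lemma count_iota_prefix (P : pred nat) C :
  (forall c, 0 < c -> P c.+1 -> P c) ->
  forall c, 0 < c <= C -> (c <= count P (iota 1 C)) = P c.
Proof.
move=> Pdown; elim: C => [|C IH] c; first by lia.
have Pd a b : 0 < a <= b -> P b -> P a.
  move=> /andP[a0 /subnK <-]; elim: (b - a) => // d IHd Pb.
  by apply: IHd; apply: Pdown; [lia | rewrite -addSn].
rewrite -[X in iota 1 X]addn1 iotaD count_cat /= addn0 add1n.
move=> /andP[c0]; rewrite leq_eqVlt => /predU1P[->|cC].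
  case PC: (P C.+1).
    suff -> : count P (iota 1 C) = C by lia.
    rewrite -[RHS](size_iota 1 C); apply/eqP; rewrite -all_count.
    by apply/allP => x; rewrite mem_iota => ?; apply: Pd PC; lia.
  have := count_size P (iota 1 C); rewrite size_iota; lia.
have [PC|PC] := boolP (P C.+1); last by rewrite addn0 IH //; lia.
rewrite (Pd c C.+1) //; last lia.
have : c <= count P (iota 1 C) by rewrite IH; [apply: Pd PC; lia | lia].
lia.
Qed.

Lemma nth_col lam i c : sorted geq lam -> 0 < c ->
  (c <= nth 0 lam i) = (i < col_length lam c).
Proof.
move=> slam c0; elim: lam i slam => [|x l IH] i; first by rewrite nth_nil /col_length /=; lia.
rewrite /= (path_sortedE (leT := geq)); last by move=> a b d /= *; lia.
case/andP=> /allP xl sl; rewrite /col_length /=.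
case: (leqP c x) => cx.
  by case: i => [|i] //=; rewrite add1n ltnS IH.
have -> : count (fun p => c <= p) l = 0.
  by apply/eqP; rewrite -leqn0 leqNgt -has_count; apply/hasPn => y /xl /=; lia.
case: i => [|i] /=; first lia.
case: (ltnP i (size l)) => il; last by rewrite nth_default //; lia.
by have /xl /= := mem_nth 0 il; lia.
Qed.

Lemma part_col lam i c : is_partition lam -> 0 < i -> 0 < c ->
  (c <= part lam i) = (i <= col_length lam c).
Proof. by case/andP=> sl _ i0 c0; rewrite /part nth_col // prednK. Qed.

Lemma col_anti lam c d : c <= d -> col_length lam d <= col_length lam c.
Proof. by move=> cd; apply: sub_count => x /= ?; lia. Qed.

Lemma colS lam c : col_length lam c = col_length lam c.+1 + count_mem c lam.
Proof. by rewrite /col_length; elim: lam => //= x l ->; lia. Qed.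

Lemma col1_size lam : is_partition lam -> col_length lam 1 = size lam.
Proof.
case/andP=> _ n0; apply/eqP; rewrite -all_count; apply/allP => x xl.
by case: x xl n0 => // ->.
Qed.

Lemma partition_col_inj lam mu : is_partition lam -> is_partition mu ->
  (forall c, 0 < c -> col_length lam c = col_length mu c) -> lam = mu.
Proof.
move=> pl pm E; apply: (@eq_from_nth _ 0).
  by rewrite -!col1_size // E.
move=> i _; have [sl _] := andP pl; have [sm _] := andP pm.
have le a b : (forall c, 0 < c -> c <= a -> c <= b) -> a <= b.
  by move=> H; case: a H => // a; exact.
by apply/eqP; rewrite eqn_leq; apply/andP; split; apply: le => c c0;
  rewrite !nth_col // E.
Qed.

(** Consecutive columns differ by the multiplicity of the part [c], which is at most 1 beyond
    [k]. *)
Lemma kstrict_colS k lam c : kstrict k lam -> k < c ->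
  col_length lam c <= (col_length lam c.+1).+1.
Proof.
case/andP=> _ /allP kl kc; rewrite colS.
suff: count_mem c lam <= 1 by lia.
case: (boolP (c \in lam)) => [/kl|/count_memPn-> //].
by rewrite kc /= => /eqP->.
Qed.

(** The witness is the conjugate of [h]: its [r]-th part counts the columns of height at least
    [r]. *)
Lemma partition_of_cols (h : nat -> nat) C :
  (forall c, 0 < c -> h c.+1 <= h c) -> (forall c, C < c -> h c = 0) ->
  exists2 nu, is_partition nu & forall c, 0 < c -> col_length nu c = h c.
Proof.
move=> hS hC.
pose p r := count (fun c => r <= h c) (iota 1 C.+1).
have pE r c : 0 < r -> 0 < c -> (c <= p r) = (r <= h c).
  move=> r0 c0; case: (leqP c C.+1) => cC.
    by rewrite /p count_iota_prefix ?c0 // => d d0; have := hS d d0; lia.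
  have := count_size (fun c => r <= h c) (iota 1 C.+1).
  by rewrite size_iota -/(p r) hC; lia.
exists [seq p r | r <- iota 1 (h 1)].
  apply/andP; split.
    apply: (@homo_sorted _ _ p ltn geq); last exact: iota_ltn_sorted.
    move=> x y /= xy; apply: sub_count => c /=; lia.
  apply/mapP => -[r]; rewrite mem_iota => hr /esym p0.
  by have := pE r 1; rewrite p0; lia.
move=> c c0; rewrite /col_length count_map.
have E : {in iota 1 (h 1), preim p (fun p0 => c <= p0) =1 (fun r => r <= h c)}.
  by move=> r; rewrite mem_iota /= => ?; rewrite pE; lia.
rewrite (eq_in_count E).
have hc1 : h c <= h 1.
  by elim: c c0 {E} => // -[|c] IH _ //; apply: leq_trans (hS _ _) (IH _).
rewrite -(subnKC hc1) iotaD count_cat.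
have /eqP -> : count (fun r => r <= h c) (iota 1 (h c)) == size (iota 1 (h c)).
  by rewrite -all_count; apply/allP => r; rewrite mem_iota; lia.
rewrite size_iota; apply/eqP; rewrite -[X in _ == X]addn0 eqn_add2l.
by rewrite -leqn0 leqNgt -has_count; apply/hasPn => r; rewrite mem_iota; lia.
Qed.

Lemma kstrict_of_cols k (h : nat -> nat) C :
  (forall c, 0 < c -> h c.+1 <= h c) -> (forall c, C < c -> h c = 0) ->
  (forall c, k < c -> h c <= (h c.+1).+1) ->
  exists2 nu, kstrict k nu & forall c, 0 < c -> col_length nu c = h c.
Proof.
move=> hS hC hk; have [nu pnu E] := partition_of_cols hS hC.
exists nu => //; apply/andP; split => //; apply/allP => p pl.
apply/implyP => kp; rewrite eqn_leq -has_count has_pred1 pl andbT.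
by have := colS nu p; rewrite !E; have := hk p kp; lia.
Qed.

Lemma kstrict_part k lam : kstrict k lam -> is_partition lam.
Proof. by case/andP. Qed.

Lemma gamma_col k lam j : 0 < j <= k ->
  gamma k lam j = col_length lam (k + 1 - j).
Proof.
move=> hj; rewrite /gamma.
have -> : sort leq [seq col_length lam c | c <- iota 1 k]
        = rev [seq col_length lam c | c <- iota 1 k].
  apply: (sorted_eq leq_trans anti_leq); first exact: sort_sorted leq_total _.
    rewrite rev_sorted.
    apply: (@homo_sorted _ _ _ ltn geq); last exact: iota_ltn_sorted.
    by move=> x y /= xy; apply: col_anti; lia.
  by rewrite perm_sort perm_sym perm_rev.
rewrite nth_rev size_map size_iota; last lia.
by rewrite (nth_map 0) ?size_iota ?nth_iota; try lia; congr col_length; lia.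
Qed.

Lemma num_large_col k lam : num_large k lam = col_length lam k.+1.
Proof. by []. Qed.

Lemma sumn_cols lam C : (forall p, p \in lam -> p <= C) ->
  sumn lam = \sum_(1 <= c < C.+1) col_length lam c.
Proof.
rewrite big_add1 /= big_mkord; elim: lam => [|x l IH] H /=.
  by rewrite big1 // => i _.
rewrite IH; last by move=> p pl; apply: H; rewrite inE pl orbT.
rewrite /col_length big_split /=; congr (_ + _).
have xC : x <= C by apply: H; rewrite mem_head.
rewrite -(@big_mkord _ 0 addn C xpredT (fun i => nat_of_bool (i < x))).
rewrite (big_cat_nat (leq0n x) xC) /=.
  have -> : \sum_(0 <= i < x) nat_of_bool (i < x) = \sum_(0 <= i < x) 1.
    by apply: eq_big_nat => i /= ->.
  rewrite sum_nat_const_nat [X in _ = _ + X]big_nat big1; first lia.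
  by move=> i; lia.
Qed.

(** * Words of k-strict partitions *)

(* The word of [lam] has at position [v >= 1] the letter [tw v], which is 0 if
   [k + v] is a part of [lam], 1 if [v] is one of the first [k] entries of
   w_lam, and 2 otherwise. [Nc v] is the number of letters 0 beyond [v] and
   [Lc v] the number of letters 1 up to [v]; [fc v = gc j] holds when [v] is
   the position of the [j]-th letter 1. *)
Definition Nc k lam v := col_length lam (k + v).+1.
Definition fc k lam v := v + Nc k lam v.
Definition gc k lam j := col_length lam (k + 1 - j) + j.
Definition Lc k lam v :=
  count (fun j => gc k lam j <= fc k lam v) (iota 1 k).
Definition tw k lam v :=
  if Nc k lam v.-1 != Nc k lam v then 0
  else if Lc k lam v.-1 != Lc k lam v then 1 else 2.

Definition swapw (a : nat) (t : nat -> nat) (v : nat) : nat :=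
  if v == a then t a.+1 else if v == a.+1 then t a else t v.

Section OnePartition.

Variables (k : nat) (lam : seq nat).
Hypothesis ks : kstrict k lam.

Lemma Nc_step v : Nc k lam v.+1 <= Nc k lam v <= (Nc k lam v.+1).+1.
Proof.
rewrite /Nc addnS col_anti //=.
by apply: kstrict_colS ks _; lia.
Qed.

Lemma gc_lt i j : 0 < i -> i < j <= k -> gc k lam i < gc k lam j.
Proof.
move=> i0 ij; rewrite /gc.
have : col_length lam (k + 1 - i) <= col_length lam (k + 1 - j).
  by apply: col_anti; lia.
lia.
Qed.

(** As [gc] is strictly increasing, the indices counted by [Lc] form an initial segment of 1..k.
    Almost every later argument on [Lc] goes through this equivalence. *)
Lemma Lc_geq j v : 0 < j <= k ->
  (j <= Lc k lam v) = (gc k lam j <= fc k lam v).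
Proof.
move=> hj; rewrite /Lc.
pose P j := (gc k lam j <= fc k lam v) && (j <= k).
have -> : count (fun j => gc k lam j <= fc k lam v) (iota 1 k)
        = count P (iota 1 k).
  by apply: eq_in_count => i; rewrite mem_iota /P; lia.
rewrite count_iota_prefix //.
  by rewrite /P; lia.
move=> c c0; rewrite /P => /andP[H ck].
by have := @gc_lt c c.+1; lia.
Qed.

Lemma Lc_lek v : Lc k lam v <= k.
Proof. by rewrite -[X in _ <= X](size_iota 1) count_size. Qed.

Lemma gc_gt j : 0 < j <= k -> Nc k lam 0 < gc k lam j.
Proof.
move=> hj; rewrite /gc /Nc addn0.
have : col_length lam k.+1 <= col_length lam (k + 1 - j) by apply: col_anti; lia.
lia.
Qed.

Lemma Lc0 : Lc k lam 0 = 0.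
Proof.
apply/eqP; rewrite -leqn0 leqNgt; apply/negP => H.
have H1 : 0 < Lc k lam 0 <= k by rewrite H Lc_lek.
have := Lc_geq 0 H1; have := gc_gt H1; rewrite /fc; lia.
Qed.

Lemma Lc_same v w : fc k lam v = fc k lam w -> Lc k lam v = Lc k lam w.
Proof. by rewrite /Lc => ->. Qed.

(** A strictly increasing [gc] takes each value at most once, so raising the threshold by one admits
    at most one more index. *)
Lemma Lc_step v : fc k lam v.+1 = (fc k lam v).+1 ->
  Lc k lam v <= Lc k lam v.+1 <= (Lc k lam v).+1.
Proof.
move=> E; have [z|z] := posnP (Lc k lam v.+1).
  have [//|p] := posnP (Lc k lam v); first by rewrite z => ->.
  have := Lc_lek v; have := @Lc_geq (Lc k lam v) v.
  have := @Lc_geq (Lc k lam v) v.+1; lia.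
have b1 := Lc_lek v; have b2 := Lc_lek v.+1; apply/andP; split.
  have [->//|p] := posnP (Lc k lam v).
  have := @Lc_geq (Lc k lam v) v.
  have := @Lc_geq (Lc k lam v) v.+1; lia.
rewrite leqNgt; apply/negP => H.
have := @Lc_geq (Lc k lam v.+1) v.+1.
have := @Lc_geq (Lc k lam v).+1 v.
have := @gc_lt (Lc k lam v).+1 (Lc k lam v.+1); lia.
Qed.

(** When [Nc] drops by one, [fc] keeps its value and hence so does [Lc]: a position is never both a
    letter 0 and a letter 1. *)
Lemma tw_cases v :
  [\/ [/\ tw k lam v.+1 = 0, Nc k lam v = (Nc k lam v.+1).+1
        & Lc k lam v.+1 = Lc k lam v],
      [/\ tw k lam v.+1 = 1, Nc k lam v = Nc k lam v.+1
        & Lc k lam v.+1 = (Lc k lam v).+1]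
    | [/\ tw k lam v.+1 = 2, Nc k lam v = Nc k lam v.+1
        & Lc k lam v.+1 = Lc k lam v]].
Proof.
rewrite /tw /=; have := Nc_step v; case: eqVneq => /= [E _|E H].
  have := @Lc_step v; rewrite /fc -E => /(_ erefl).
  case: eqVneq => [->|?] ?; first by constructor 3.
  by constructor 2; split=> //; lia.
constructor 1; split=> //; first lia.
by apply: Lc_same; rewrite /fc; lia.
Qed.

Lemma tw_le2 v : tw k lam v <= 2.
Proof. by rewrite /tw; case: ifP => // _; case: ifP. Qed.

Lemma Nc_anti v w : v <= w -> Nc k lam w <= Nc k lam v.
Proof. by move=> vw; apply: col_anti; lia. Qed.

Lemma fc_mono v w : v <= w -> fc k lam v <= fc k lam w.
Proof.
move=> /subnK <-; elim: (w - v) => // d IH; apply: leq_trans IH _.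
by have := Nc_step (d + v); rewrite addSn /fc; lia.
Qed.

Lemma Lc_mono v w : v <= w -> Lc k lam v <= Lc k lam w.
Proof.
by move=> vw; apply: sub_count => j /= H; apply: leq_trans H (fc_mono vw).
Qed.

Lemma Lc_leS v : Lc k lam v.+1 <= (Lc k lam v).+1.
Proof. by case: (tw_cases v) => -[] *; lia. Qed.

Lemma Lc_lev v : Lc k lam v <= v.
Proof. by elim: v => [|v IH]; [rewrite Lc0 | have := Lc_leS v; lia]. Qed.

Lemma Nc_eventually : exists V, forall v, V <= v -> Nc k lam v = 0.
Proof.
exists (sumn lam) => v hv; rewrite /Nc /col_length.
apply/eqP; rewrite -leqn0 leqNgt -has_count; apply/hasPn => p pl.
have : p <= sumn lam.
  elim: lam pl => //= x l IH; rewrite inE => /predU1P[->|/IH]; lia.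
lia.
Qed.

Lemma eventually_tail :
  exists V, forall v, V <= v -> Nc k lam v = 0 /\ Lc k lam v = k.
Proof.
have [V hV] := Nc_eventually.
exists (V + gc k lam k) => v hv; split; first by apply: hV; lia.
apply/eqP; rewrite eqn_leq Lc_lek /=.
have [->//|k0] := posnP k.
by rewrite Lc_geq ?k0 //= /fc; lia.
Qed.

(** The position of the [j]-th letter 1 is the least one at which [Lc] reaches [j], and [Lc] is
    eventually [k]. *)
Lemma Lpos j : 0 < j <= k -> exists v,
  [/\ fc k lam v.+1 = gc k lam j, Lc k lam v.+1 = j, Lc k lam v = j.-1
    & tw k lam v.+1 = 1].
Proof.
move=> hj; have [V hV] := eventually_tail.
have ex : exists v, j <= Lc k lam v by exists V; rewrite (hV V _).2 //; lia.
case: (ex_minnP ex) => -[|v] hv hmin; first by rewrite Lc0 in hv; lia.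
have hv1 : Lc k lam v < j by rewrite ltnNge; apply/negP => /hmin; lia.
exists v; case: (tw_cases v) => -[t1 t2 t3]; try lia.
split=> //; try lia.
have := Lc_geq v hj; have := Lc_geq v.+1 hj; rewrite /fc; lia.
Qed.

(** Row [r] among the parts larger than [k] is the [r]-th letter 0 counted from infinity, hence the
    minimal [v] with fewer than [r] letters 0 beyond it. *)
Lemma Npos r : 0 < r <= Nc k lam 0 -> exists v,
  [/\ Nc k lam v = r, Nc k lam v.+1 = r.-1, part lam r = k + v.+1
    & tw k lam v.+1 = 0].
Proof.
move=> hr; have [V hV] := eventually_tail.
have ex : exists v, Nc k lam v < r by exists V; rewrite (hV V _).1 //; lia.
case: (ex_minnP ex) => -[|v] hv hmin; first lia.
have hv1 : r <= Nc k lam v by rewrite leqNgt; apply/negP => /hmin; lia.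
exists v; case: (tw_cases v) => -[t1 t2 t3]; try lia.
split=> //; try lia.
have pk := kstrict_part ks.
have := @part_col lam r (k + v).+1 pk; have := @part_col lam r (k + v.+1).+1 pk.
by rewrite -/(Nc k lam v) -/(Nc k lam v.+1); lia.
Qed.

Lemma gc_tw1 v : tw k lam v.+1 = 1 ->
  [/\ 0 < Lc k lam v.+1 <= k & gc k lam (Lc k lam v.+1) = fc k lam v.+1].
Proof.
case: (tw_cases v) => -[t1 t2 t3]; rewrite t1 // => _.
have h : 0 < Lc k lam v.+1 <= k by rewrite Lc_lek; lia.
split=> //.
have := Lc_geq v h; have := Lc_geq v.+1 h; rewrite /fc; lia.
Qed.

(** At a letter 2 the value of [fc] grows while [Lc] does not, so the new value is missed by [gc].
    This gives the strict inequality between neighbouring columns when a box is added or removed. *)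
Lemma gc_tw2 v j : tw k lam v.+1 = 2 -> 0 < j <= k ->
  gc k lam j != fc k lam v.+1.
Proof.
case: (tw_cases v) => -[t1 t2 t3]; rewrite t1 // => _ hj.
have := Lc_geq v hj; have := Lc_geq v.+1 hj; rewrite /fc; lia.
Qed.

End OnePartition.

(** The columns beyond [k] are values of [Nc]; a left column is recovered from [gc k lam j], the
    value of [fc] at the [j]-th letter 1. *)
Lemma counts_inj k lam mu : kstrict k lam -> kstrict k mu ->
  (forall v, Nc k lam v = Nc k mu v) -> (forall v, Lc k lam v = Lc k mu v) ->
  lam = mu.
Proof.
move=> kl km EN EL; apply: partition_col_inj => [||c c0];
  [exact: kstrict_part kl | exact: kstrict_part km |].
have Ef v : fc k lam v = fc k mu v by rewrite /fc EN.
have [kc|ck] := ltnP k c.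
  by have := EN (c - k - 1); rewrite /Nc; have -> : (k + (c - k - 1)).+1 = c by lia.
have hj : 0 < k + 1 - c <= k by lia.
have le l m : kstrict k l -> kstrict k m -> (forall v, Lc k l v = Lc k m v) ->
    (forall v, fc k l v = fc k m v) ->
    gc k l (k + 1 - c) <= gc k m (k + 1 - c).
  move=> hl hm hL hf; have [v [f1 L1 _ _]] := Lpos hm hj.
  by rewrite -f1 -hf -Lc_geq // hL L1.
have := le _ _ kl km EL Ef; have := le _ _ km kl (fsym EL) (fsym Ef).
by rewrite /gc subKn; lia.
Qed.

(** [Nc] counts letters from infinity and [Lc] from the origin, so the two inductions run in
    opposite directions. *)
Lemma tw_counts k lam mu : kstrict k lam -> kstrict k mu ->
  (forall v, 0 < v -> tw k lam v = tw k mu v) ->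
  (forall v, Nc k lam v = Nc k mu v) /\ (forall v, Lc k lam v = Lc k mu v).
Proof.
move=> kl km E; split.
  have [V1 h1] := eventually_tail kl; have [V2 h2] := eventually_tail km.
  suff H d : forall v, V1 + V2 <= v + d -> Nc k lam v = Nc k mu v.
    by move=> v; apply: (H (V1 + V2)); lia.
  elim: d => [|d IH] v hv; first by rewrite (h1 v _).1 ?(h2 v _).1; lia.
  have := E v.+1 isT; have := IH v.+1.
  by case: (tw_cases kl v) => -[-> -> _]; case: (tw_cases km v) => -[-> -> _] //; lia.
elim=> [|v IH]; first by rewrite !Lc0.
have := E v.+1 isT.
by case: (tw_cases kl v) => -[-> _ ->]; case: (tw_cases km v) => -[-> _ ->] //; rewrite IH.
Qed.

Lemma tw_inj k lam mu : kstrict k lam -> kstrict k mu ->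
  (forall v, 0 < v -> tw k lam v = tw k mu v) -> lam = mu.
Proof. by move=> kl km /(tw_counts kl km)[]; apply: counts_inj. Qed.

(** * Adding or removing one box *)

Section OneBox.

Variables (k : nat) (rho nu : seq nat) (c0 : nat).
Hypotheses (kr : kstrict k rho) (kn : kstrict k nu) (c0_gt0 : 0 < c0).
Hypothesis cols :
  forall c, 0 < c -> col_length nu c = col_length rho c + (c == c0).

Lemma sumn_box : sumn nu = (sumn rho).+1.
Proof.
clear kr kn.
have le_sumn (l : seq nat) p : p \in l -> p <= sumn l.
  elim: l => //= x l IH; rewrite inE => /predU1P[->|/IH]; lia.
pose C := sumn nu + sumn rho + c0.
rewrite (@sumn_cols nu C); last by move=> p /le_sumn; rewrite /C; lia.
rewrite (@sumn_cols rho C); last by move=> p /le_sumn; rewrite /C; lia.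
have -> : \sum_(1 <= c < C.+1) col_length nu c =
          \sum_(1 <= c < C.+1) (col_length rho c + (c == c0)).
  by apply: eq_big_nat => c /andP[c1 _]; rewrite cols.
rewrite big_split /= [X in _ + X](bigD1_seq c0) ?iota_uniq ?mem_index_iota //=.
  rewrite eqxx [X in _ + (_ + X)]big1 ?addn1 // => c /negPf-> //.
by rewrite /C; lia.
Qed.

(** Strictness of [nu] forces [Nc k rho a = Nc k rho a.+1], so [fc k nu a] equals [fc k rho a.+1]:
    at the cut [a] the letters 1 of [nu] are counted as those of [rho] one step further. At [a = 0]
    both counts vanish. *)
Lemma box_right a : c0 = (k + a).+1 ->
  [/\ forall v, Nc k nu v = Nc k rho v + (v == a),
      Nc k rho a = Nc k rho a.+1
    & forall v, Lc k nu v = Lc k rho (if (0 < a) && (v == a) then a.+1 else v)].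
Proof.
move=> E; have EN v : Nc k nu v = Nc k rho v + (v == a).
  by rewrite /Nc cols // E; congr (_ + nat_of_bool _); lia.
have Na : Nc k rho a = Nc k rho a.+1.
  have := Nc_step kr a; have := Nc_step kn a; rewrite !EN eqxx; lia.
split=> // v.
have Eg : {in iota 1 k, gc k nu =1 gc k rho}.
  by move=> j; rewrite mem_iota => hj; rewrite /gc cols ?E; lia.
have [a0|a0] := posnP a.
  have [->|v0] := posnP v; first by rewrite a0 !Lc0.
  apply: eq_in_count => j hj; rewrite Eg // /fc EN a0 /=.
  by case: v v0 => // v _; rewrite addn0.
case: eqVneq => [->|va]; apply: eq_in_count => j hj; rewrite Eg // /fc EN.
  by rewrite eqxx Na /= addnA addn1 -addSn addnC.
by rewrite (negPf va) addn0.
Qed.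

Lemma box_right_pos a : c0 = (k + a.+1).+1 ->
  tw k rho a.+1 = 0 /\ forall v, 0 < v -> tw k nu v = swapw a.+1 (tw k rho) v.
Proof.
move=> E; have [EN Na EL] := box_right E.
have Na' : Nc k rho a = (Nc k rho a.+1).+1.
  have := Nc_step kr a; have := Nc_step kn a; rewrite !EN eqxx; lia.
have t0 : tw k rho a.+1 = 0 by rewrite /tw /= Na'; case: eqP => //; lia.
split=> // -[//|v] _; rewrite /swapw t0 !eqSS.
have [->|va] := eqVneq v a.
  rewrite /tw /= !EN !EL /= eqxx.
  case: (tw_cases kr a) => -[_ w2 w3]; try lia.
  by rewrite w3; case: eqP; case: eqP; case: eqP; case: eqP; try lia.
have [->|va'] := eqVneq v a.+1.
  by rewrite /tw /= !EN !EL /= eqxx; case: eqP => //; lia.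
rewrite /tw /= !EN !EL /=.
have -> : (v == a.+1) = false by lia.
have -> : (v.+1 == a.+1) = false by lia.
by rewrite !addn0.
Qed.

(** The new box creates a part [k + 1], that is a letter 0 at position 1. The old letter there is
    not 1, since otherwise column [k + 1] of [nu] would be longer than column [k]. *)
Lemma box_right0 : c0 = k.+1 ->
  [/\ tw k rho 1 = 2 , tw k nu 1 = 0
    & forall v, 1 < v -> tw k nu v = tw k rho v].
Proof.
move=> E0; have E : c0 = (k + 0).+1 by rewrite addn0.
have [EN Na EL] := box_right E; split.
- case: (tw_cases kr 0) => -[w1 w2 w3] //; first lia.
  have := gc_tw1 kr w1; rewrite w3 Lc0 // => -[h1 h2].
  have := gc_gt kn h1; move: h2; rewrite /gc cols /fc ?EN; lia.
- by rewrite /tw /= !EN /=; case: eqP => //; lia.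
- case=> // -[//|v] _; by rewrite /tw /= !EN !EL /= !addn0.
Qed.

(** The box raises [gc j] by one, which moves the [j]-th letter 1 from [a + 1] to [a + 2]. The
    letter at [a + 2] is a 2: a next letter 1 there would have the same value of [gc] in [nu]. *)
Lemma box_left a j : 0 < j <= k -> c0 = k + 1 - j ->
    gc k rho j = fc k rho a.+1 -> Nc k rho a = Nc k rho a.+1 ->
    Nc k rho a.+2 = Nc k rho a.+1 ->
  [/\ tw k rho a.+1 = 1, tw k rho a.+2 = 2,
      forall v, Nc k nu v = Nc k rho v,
      forall v, Lc k rho v = Lc k nu v + (v == a.+1)
    & forall v, 0 < v -> tw k nu v = swapw a.+1 (tw k rho) v].
Proof.
move=> hj E hg h1 h2.
have EN v : Nc k nu v = Nc k rho v.
  by rewrite /Nc cols // E; case: eqP; lia.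
have Eg i : 0 < i <= k -> gc k nu i = gc k rho i + (i == j).
  by move=> hi; rewrite /gc cols ?E; [|lia]; case: (eqVneq i j) => [->|]; case: eqP; lia.
have f1 : fc k rho a < fc k rho a.+1 by rewrite /fc; lia.
have f2 : fc k rho a.+2 = (fc k rho a.+1).+1 by rewrite /fc; lia.
have EL v : Lc k rho v = Lc k nu v + (v == a.+1).
  have [->|va] := eqVneq v a.+1.
    have fn : fc k nu a.+1 = fc k rho a.+1 by rewrite /fc EN.
    have r1 := Lc_lek k rho a.+1; have r2 := Lc_lek k nu a.+1.
    have r3 : Lc k rho a.+1 = j.
      have := Lc_geq kr a.+1 hj; have := @Lc_geq _ _ kr j.+1 a.+1.
      have := @gc_lt _ _ kr j j.+1; lia.
    have := Lc_geq kn a.+1 hj; have := @Lc_geq _ _ kn j.-1 a.+1.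
    have := Eg j hj; have := Eg j.-1; have := @gc_lt _ _ kr j.-1 j.
    rewrite eqxx; lia.
  rewrite addn0; apply: eq_in_count => i; rewrite mem_iota => hi.
  have -> : fc k nu v = fc k rho v by rewrite /fc EN.
  have fv : fc k rho v != fc k rho a.+1.
    case: (ltngtP v a.+1) va => // hv _.
      by have := @fc_mono _ _ kr v a; lia.
    by have := @fc_mono _ _ kr a.+2 v; lia.
  rewrite Eg; last lia.
  by case: (eqVneq i j) => [->|_]; rewrite ?hg; lia.
have t1 : tw k rho a.+1 = 1.
  have La : Lc k rho a < j by have := Lc_geq kr a hj; lia.
  have La1 : j <= Lc k rho a.+1 by rewrite Lc_geq // hg.
  case: (tw_cases kr a) => -[] *; lia.
have t2 : tw k rho a.+2 = 2.
  case: (tw_cases kr a.+1) => -[w1 w2 w3] //; first lia.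
  have [i1 i2] := gc_tw1 kr w1.
  have La1 : Lc k rho a.+1 = j.
    have r1 := Lc_lek k rho a.+1.
    have := Lc_geq kr a.+1 hj; have := @Lc_geq _ _ kr j.+1 a.+1.
    have := @gc_lt _ _ kr j j.+1; lia.
  have := Eg (Lc k rho a.+2) i1; have := Eg j hj.
  have := @gc_lt _ _ kn j (Lc k rho a.+2); rewrite eqxx; lia.
split=> // -[//|v] _; rewrite /swapw t1 t2 !eqSS.
have Ltw x : tw k nu x = if Nc k rho x.-1 != Nc k rho x then 0
   else if Lc k nu x.-1 != Lc k nu x then 1 else 2 by rewrite /tw !EN.
have := EL v; have := EL v.+1; rewrite !eqSS.
have [->|va] := eqVneq v a.
  rewrite Ltw /= h1 eqxx /=; case: (tw_cases kr a) => -[w1 w2 w3]; try lia.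
  by case: eqP; case: eqP => //; lia.
have [->|va'] := eqVneq v a.+1.
  rewrite Ltw /= h2 eqxx /=; case: (tw_cases kr a.+1) => -[w1 w2 w3]; try lia.
  by case: eqP => //; lia.
rewrite !addn0 Ltw /= => e1 e2.
by rewrite /tw /= e1 e2.
Qed.

End OneBox.

Definition ascw a (t : nat -> nat) : bool :=
  if a is 0 then t 1 == 2 else t a < t a.+1.

Definition desw a (t : nat -> nat) : bool :=
  if a is 0 then t 1 == 0 else t a.+1 < t a.

(* The effect on words of a left multiplication of w_lam by s_a that increases
   the length. *)
Definition stepw a (t t' : nat -> nat) : Prop :=
  if a is 0 then [/\ t 1 = 2, t' 1 = 0 & forall v, 1 < v -> t' v = t v]
  else t a < t a.+1 /\ forall v, 0 < v -> t' v = swapw a t v.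

Definition box_added (rho nu : seq nat) : Prop :=
  exists2 c0, 0 < c0 &
    forall c, 0 < c -> col_length nu c = col_length rho c + (c == c0).

Lemma col_large lam c : sumn lam < c -> col_length lam c = 0.
Proof.
move=> H; apply/eqP; rewrite -leqn0 leqNgt -has_count; apply/hasPn => p pl.
suff: p <= sumn lam by lia.
elim: lam pl {H} => //= x l IH; rewrite inE => /predU1P[->|/IH]; lia.
Qed.

(** The first condition keeps the column lengths weakly decreasing, the second keeps the drop after
    a column beyond [k] at most 1, which is k-strictness. *)
Lemma kstrict_add k rho c0 : kstrict k rho -> 0 < c0 ->
    (1 < c0 -> col_length rho c0 < col_length rho c0.-1) ->
    (k < c0 -> col_length rho c0 = col_length rho c0.+1) ->
  exists2 nu, kstrict k nu &
    forall c, 0 < c -> col_length nu c = col_length rho c + (c == c0).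
Proof.
move=> kr c00 h1 h2.
apply: (kstrict_of_cols (C := sumn rho + c0)) => c hc.
- have := @col_anti rho c c.+1 (leqnSn c).
  case: (eqVneq c.+1 c0) => [e|_]; last lia.
  by move: h1; rewrite -e /=; lia.
- by rewrite col_large; lia.
- have := kstrict_colS kr hc.
  case: (eqVneq c c0) => [e|_]; last lia.
  by move: h2; rewrite -e; lia.
Qed.

(** Removal threatens the drop from column [c0 - 1] to [c0]; drops are bounded only from column
    [k + 1] on, whence the guard [k.+1 < c0]. *)
Lemma kstrict_remove k nu c0 : kstrict k nu -> 0 < c0 ->
    col_length nu c0.+1 < col_length nu c0 ->
    (k.+1 < c0 -> col_length nu c0.-1 = col_length nu c0) ->
  exists2 rho, kstrict k rho &
    forall c, 0 < c -> col_length nu c = col_length rho c + (c == c0).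
Proof.
move=> kn c00 h1 h2.
have [|||rho kr E] := @kstrict_of_cols k (fun c => col_length nu c - (c == c0)) (sumn nu).
- move=> c hc; have := @col_anti nu c c.+1 (leqnSn c).
  case: (eqVneq c c0) => [e|_]; last lia.
  by move: h1; rewrite -e /=; lia.
- by move=> c hc; rewrite col_large; lia.
- move=> c hc; have := kstrict_colS kn hc.
  case: (eqVneq c.+1 c0) => [e|_]; last lia.
  by move: h2; rewrite -e /=; lia.
exists rho => // c hc; rewrite E //; case: eqP => [->|_]; lia.
Qed.

(** The letter that moves right decides the column: a letter 0 at [a > 0] extends its row into
    column [k + a + 1], the [j]-th letter 1 lengthens column [k + 1 - j], and [a = 0] gives column
    [k + 1]. *)
Lemma addbox k rho a : kstrict k rho -> ascw a (tw k rho) ->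
  exists nu, [/\ kstrict k nu, stepw a (tw k rho) (tw k nu) & box_added rho nu].
Proof.
move=> kr; case: a => [|a] /=.
  move=> /eqP t1; case: (tw_cases kr 0) => -[w1 w2 w3]; try lia.
  have [nu kn E] : exists2 nu, kstrict k nu &
    forall c, 0 < c -> col_length nu c = col_length rho c + (c == k.+1).
    apply: kstrict_add => //.
      move=> /= k0; have hj : 0 < 1 <= k by lia.
      have := gc_gt kr hj; have := gc_tw2 kr t1 hj.
      by rewrite /fc -w2 /gc /Nc addn0 addnK; lia.
    by move: w2; rewrite /Nc addn0 addn1.
  have [h1 h2 h3] := box_right0 kr kn (ltn0Sn _) E (erefl _).
  by exists nu; split=> //; exists k.+1.
move=> asc; have := tw_le2 k rho a.+2.
case: (tw_cases kr a) => -[w1 w2 w3]; last lia.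
  have [nu kn E] : exists2 nu, kstrict k nu &
    forall c, 0 < c -> col_length nu c = col_length rho c + (c == (k + a.+1).+1).
    apply: kstrict_add => //.
      by move=> /= _; move: w2; rewrite /Nc addnS; lia.
    move=> _; case: (tw_cases kr a.+1) => -[x1 x2 x3]; try lia.
      by move: x2; rewrite /Nc !addnS.
    by move: x2; rewrite /Nc !addnS.
  have [h1 h2] := box_right_pos kr kn (ltn0Sn _) E (erefl _).
  by exists nu; split=> //; exists (k + a.+1).+1.
move=> _; have [hj hg] := gc_tw1 kr w1.
case: (tw_cases kr a.+1) => -[x1 x2 x3]; try lia.
set j := Lc k rho a.+1 in hj hg.
have c00 : 0 < k + 1 - j by lia.
have [nu kn E] : exists2 nu, kstrict k nu &
  forall c, 0 < c -> col_length nu c = col_length rho c + (c == k + 1 - j).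
  apply: kstrict_add => //; try lia.
  move=> c1; have hj1 : 0 < j.+1 <= k by lia.
  have := gc_tw2 kr x1 hj1; have := @gc_lt _ _ kr j j.+1.
  move: hg; rewrite /gc /fc x2.
  have -> : k + 1 - j.+1 = (k + 1 - j).-1 by lia.
  lia.
have [|h1 h2 h3 h4 h5] := box_left kr kn c00 E hj (erefl _) hg w2; first by rewrite x2.
by exists nu; split; rewrite //= ?h1 ?h2 //; exists (k + 1 - j).
Qed.

Lemma rembox k nu a : kstrict k nu -> desw a (tw k nu) ->
  exists rho, [/\ kstrict k rho, stepw a (tw k rho) (tw k nu) & box_added rho nu].
Proof.
move=> kn; case: a => [|a] /=.
  move=> /eqP t1; case: (tw_cases kn 0) => -[w1 w2 w3]; try lia.
  have [rho kr E] : exists2 rho, kstrict k rho &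
    forall c, 0 < c -> col_length nu c = col_length rho c + (c == k.+1).
    by apply: kstrict_remove => //; move: w2; rewrite /Nc addn0 addn1; lia.
  have [h1 h2 h3] := box_right0 kr kn (ltn0Sn _) E (erefl _).
  by exists rho; split=> //; exists k.+1.
move=> des.
have swK (t t' : nat -> nat) : (forall v, 0 < v -> t v = swapw a.+1 t' v) ->
    t a.+2 < t a.+1 -> t' a.+1 < t' a.+2.
  by move=> H; rewrite !H // /swapw eqxx; case: eqP => //; rewrite eqxx; lia.
have := tw_le2 k nu a.+1.
case: (tw_cases kn a.+1) => -[w1 w2 w3]; last lia.
  have [rho kr E] : exists2 rho, kstrict k rho &
    forall c, 0 < c -> col_length nu c = col_length rho c + (c == (k + a.+1).+1).
    apply: kstrict_remove => //.
      by move: w2; rewrite /Nc !addnS; lia.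
    move=> _; case: (tw_cases kn a) => -[x1 x2 x3]; try lia.
      by move: x2; rewrite /Nc !addnS.
    by move: x2; rewrite /Nc !addnS.
  have [h1 h2] := box_right_pos kr kn (ltn0Sn _) E (erefl _).
  exists rho; split=> //; last by exists (k + a.+1).+1.
  by split=> //; apply: swK h2 des.
move=> _; have [hj hg] := gc_tw1 kn w1.
case: (tw_cases kn a) => -[x1 x2 x3]; try lia.
set j := Lc k nu a.+2 in hj hg.
have c00 : 0 < k + 1 - j by lia.
have [rho kr E] : exists2 rho, kstrict k rho &
  forall c, 0 < c -> col_length nu c = col_length rho c + (c == k + 1 - j).
  apply: kstrict_remove => //; try lia.
  have [j1|j1] := leqP j 1.
    have -> : (k + 1 - j).+1 = k.+1 by lia.
    have := fc_mono kn (leq0n a); rewrite /fc {1}/Nc addn0.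
    by move: hg; rewrite /gc /fc; lia.
  have hj1 : 0 < j.-1 <= k by lia.
  have := gc_tw2 kn x1 hj1; have := @gc_lt _ _ kn j.-1 j.
  have -> : (k + 1 - j).+1 = k + 1 - j.-1 by lia.
  move: hg; rewrite /gc /fc -w2; lia.
have EN v : Nc k nu v = Nc k rho v.
  by rewrite /Nc E //; case: eqP; lia.
have hg' : gc k rho j = fc k rho a.+1.
  by move: hg; rewrite /gc E ?eqxx /fc -?EN; lia.
have e1 : Nc k rho a = Nc k rho a.+1 by rewrite -!EN.
have e2 : Nc k rho a.+2 = Nc k rho a.+1 by rewrite -!EN.
have [h1 h2 h3 h4 h5] := box_left kr kn c00 E hj (erefl _) hg' e1 e2.
by exists rho; split; rewrite //= ?h1 ?h2 //; exists (k + 1 - j).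
Qed.

(** * Horizontal strips and crossings of cuts *)

Section StripCounts.

Variables (k : nat) (lam mu : seq nat).

(* [dN v] is the gain of letters 0 and [dP v] the loss of letters 2 beyond
   position [v], when passing from the word of [mu] to that of [lam]. *)
Definition dN v : int := ((Nc k lam v)%:Z - (Nc k mu v)%:Z)%R.
Definition dP v : int := (dN v + (Lc k mu v)%:Z - (Lc k lam v)%:Z)%R.

(* The cut between [v] and [v + 1] is crossed by at most one letter 0 moving
   right and at most one letter 2 moving left; a 0 and a 1 are not exchanged
   across a 2 that stays at its position, nor a 1 and a 2 across such a 0. *)
Definition cut_strip : Prop :=
  [/\ forall v, dN v = 0%R \/ dN v = 1%R,
      forall v, dP v = 0%R \/ dP v = 1%R,
      forall v, tw k lam v.+1 = 2 -> tw k mu v.+1 = 2 ->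
        ~ (dN v.+1 = 1%R /\ dP v.+1 = 0%R)
    & forall v, tw k lam v.+1 = 0 -> tw k mu v.+1 = 0 ->
        ~ (dN v.+1 = 0%R /\ dP v.+1 = 1%R)].

(** These [f] are the k'-distances, less 1/2, of the boxes of [lam/mu] in the left column
    [k + 1 - j]. *)
Definition left_range j f := gc k mu j <= f < gc k lam j.

(** The lowest box of column [k + v + 1] of [mu] belongs to R: [lam] has no box below it, and some
    left box of [lam/mu] is at the same k'-distance. *)
Definition Rcol v : Prop :=
  Nc k lam v = Nc k mu v /\
  exists2 j, 0 < j <= k & left_range j (fc k mu v).

(** The horizontal strip conditions in coordinates: containment, right boxes in distinct columns,
    the rim condition for left columns, then (ii) and (iii). The rim condition in the columns from
    [k] on follows from the second clause. *)
Definition col_strip : Prop :=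
  [/\ forall c, 0 < c -> col_length mu c <= col_length lam c,
      forall c, k < c -> col_length lam c <= (col_length mu c).+1,
      forall c, 0 < c < k -> col_length mu c < col_length lam c ->
        col_length lam c.+1 <= (col_length mu c).+1,
      forall v w, Rcol v -> Rcol w -> fc k mu v = fc k mu w -> v = w
    & forall j f f', 0 < j <= k -> left_range j f -> left_range j f' ->
        f < f' -> exists v v', [/\ v <> v', Nc k mu v = Nc k mu v' &
         forall x, (Rcol x /\ (fc k mu x = f \/ fc k mu x = f')) <->
                   (x = v \/ x = v')]].

Hypotheses (kl : kstrict k lam) (km : kstrict k mu).

Lemma fc_dN v : Posz (fc k lam v) = (Posz (fc k mu v) + dN v)%R.
Proof. by rewrite /fc /dN; lia. Qed.

Lemma Lc_leP (l m : seq nat) v w : kstrict k l -> kstrict k m ->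
  (forall j, 0 < j <= k -> gc k l j <= fc k l v -> gc k m j <= fc k m w) ->
  Lc k l v <= Lc k m w.
Proof.
move=> hl hm H; have [->//|p] := posnP (Lc k l v).
have hj : 0 < Lc k l v <= k by rewrite p Lc_lek.
by rewrite Lc_geq //; apply: H => //; rewrite -Lc_geq.
Qed.

Section ColToCut.

Hypothesis cs : col_strip.

Let c1 c : 0 < c -> col_length mu c <= col_length lam c.
Proof. by case: cs => h _ _ _ _; apply: h. Qed.

Let c4 v w : Rcol v -> Rcol w -> fc k mu v = fc k mu w -> v = w.
Proof. by case: cs => _ _ _ h _; apply: h. Qed.

Let gle j : 0 < j <= k -> gc k mu j <= gc k lam j.
Proof. by move=> hj; rewrite /gc leq_add2r c1 //; lia. Qed.

Let dN01 v : dN v = 0%R \/ dN v = 1%R.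
Proof.
case: cs => _ h2 _ _ _.
have := c1 (ltn0Sn (k + v)); have := h2 (k + v).+1; rewrite /dN /Nc; lia.
Qed.

(** The rim condition amounts to [gc k lam j.-1 <= gc k mu j] when column [k + 1 - j] gains a box,
    so the range of a smaller index ends before that of a larger one begins. *)
Let range_disj i j f : 0 < i <= k -> 0 < j <= k ->
  left_range i f -> left_range j f -> i = j.
Proof.
wlog ij : i j / i < j.
  move=> H hi hj ri rj; case: (ltngtP i j) => // h; first exact: (H i j).
  by apply/esym/(H j i).
move=> hi hj; rewrite /left_range => /andP[i1 i2] /andP[j1 j2].
have [_ _ h3 _ _] := cs.
have := h3 (k + 1 - j); have -> : (k + 1 - j).+1 = k + 1 - j.-1 by lia.
have : col_length lam (k + 1 - i) <= col_length lam (k + 1 - j.-1).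
  by apply: col_anti; lia.
move: i2 j1 j2; rewrite /gc; lia.
Qed.

Let RcolP v : Nc k lam v = Nc k mu v -> (Rcol v <-> dP v = 1%R).
Proof.
move=> E; have fE : fc k lam v = fc k mu v by rewrite /fc E.
have d0 : dN v = 0%R by rewrite /dN E; lia.
have b1 := Lc_lek k lam v; have b2 := Lc_lek k mu v.
have LE : Lc k lam v <= Lc k mu v.
  apply: Lc_leP => // j hj; rewrite fE; have := gle hj; lia.
rewrite /dP d0; split.
  case=> _ [j hj /andP[j1 j2]].
  have := Lc_geq km v hj; have := Lc_geq kl v hj; rewrite fE.
  suff : Lc k mu v <= (Lc k lam v).+1 by lia.
  rewrite leqNgt; apply/negP => H.
  have hi : 0 < (Lc k lam v).+1 <= k by lia.
  have hi' : 0 < (Lc k lam v).+2 <= k by lia.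
  have := @range_disj _ _ (fc k mu v) hi hi'; rewrite /left_range.
  have := Lc_geq km v hi; have := Lc_geq kl v hi.
  have := Lc_geq km v hi'; have := Lc_geq kl v hi'.
  rewrite fE; lia.
move=> dp; split=> //.
have hj : 0 < Lc k mu v <= k by lia.
exists (Lc k mu v) => //; rewrite /left_range.
have := Lc_geq km v hj; have := Lc_geq kl v hj; rewrite fE; lia.
Qed.

Let dP0 v : Nc k lam v = Nc k mu v -> dP v = 0%R \/ dP v = 1%R.
Proof.
move=> E; have fE : fc k lam v = fc k mu v by rewrite /fc E.
have d0 : dN v = 0%R by rewrite /dN E; lia.
have b1 := Lc_lek k lam v; have b2 := Lc_lek k mu v.
have LE : Lc k lam v <= Lc k mu v.
  apply: Lc_leP => // j hj; rewrite fE; have := gle hj; lia.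
have [z|nz] := eqVneq (Lc k lam v) (Lc k mu v); first by left; rewrite /dP d0; lia.
right; apply/RcolP => //; split=> //.
have hj : 0 < Lc k mu v <= k by lia.
exists (Lc k mu v) => //; rewrite /left_range.
have := Lc_geq km v hj; have := Lc_geq kl v hj; rewrite fE; lia.
Qed.

Let dN_step v : tw k mu v.+1 = 0 -> (dN v <= dN v.+1)%R.
Proof.
rewrite /dN; case: (tw_cases km v) => -[-> e _] // _.
by case: (tw_cases kl v) => -[_ e' _]; lia.
Qed.

(** Condition (iii) applied to the levels [fc k mu v] and its successor gives two boxes of R in one
    row, at [x < x'], with [x] on the level of [v]. Between [v] and [x] all letters of [mu] are 0,
    and [dN] does not decrease across them, so it cannot pass from 1 at [v] to 0 at [x]. *)
Let no_double v j : 0 < j <= k -> dN v = 1%R ->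
  left_range j (fc k mu v) -> left_range j (fc k mu v).+1 -> False.
Proof.
move=> hj d1 r1 r2; have [_ _ _ _ h5] := cs.
have [x [x' [ne NE H]]] := h5 j _ _ hj r1 r2 (ltnSn _).
wlog lt : x x' ne NE H / x < x'.
  move=> W; case: (ltngtP x x') => // lt; first exact: (W x x').
  apply: (W x' x) => // [|y]; first by move/esym.
  by rewrite H; tauto.
have [Rx fx] : Rcol x /\ (fc k mu x = fc k mu v \/ fc k mu x = (fc k mu v).+1).
  by apply/H; left.
have [Rx' fx'] : Rcol x' /\ (fc k mu x' = fc k mu v \/ fc k mu x' = (fc k mu v).+1).
  by apply/H; right.
have f1 : fc k mu x = fc k mu v.
  have nx : x <> x' by lia.
  move: fx fx'; rewrite /fc NE; have := @Nc_anti _ _ km x x'.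
  by move=> _ [] // e [] e'; lia.
have xv : x < v \/ v < x.
  case: (ltngtP x v) => [||E]; [by left | by right|].
  by move: d1 Rx.1; rewrite /dN E; lia.
case: xv => xv.
  (* [v] follows [x], so the letter at [x + 1] is a 0, yet it is not. *)
  have := Nc_step km x; have := @Nc_anti _ _ km x.+1 x' lt.
  have := @fc_mono _ _ km x.+1 v xv; have := f1; rewrite /fc NE; lia.
suff : (dN v <= dN x)%R by rewrite d1; have := Rx.1; rewrite /dN; lia.
rewrite -(subnKC (ltnW xv)).
have : forall d, v + d <= x -> (dN v <= dN (v + d))%R.
  elim=> [|d IH] hd; first by rewrite addn0.
  apply: le_trans (IH _) _; first lia.
  rewrite addnS; apply: dN_step.
  have := @fc_mono _ _ km v (v + d); have := @fc_mono _ _ km (v + d).+1 x.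
  case: (tw_cases km (v + d)) => -[-> e _] //; rewrite /fc in f1 *; lia.
by apply; lia.
Qed.

Lemma cut_of_col_strip : cut_strip.
Proof.
split=> //.
- move=> v; case: (dN01 v) => d; first by apply: dP0; move: d; rewrite /dN; lia.
  have fE : fc k lam v = (fc k mu v).+1 by have := fc_dN v; rewrite d; lia.
  have b1 := Lc_lek k lam v; have b2 := Lc_lek k mu v.
  suff : Lc k mu v <= Lc k lam v <= (Lc k mu v).+1 by rewrite /dP d; lia.
  apply/andP; split.
    apply: Lc_leP => // j hj h; rewrite leqNgt; apply/negP => h'.
    apply: (no_double hj d); rewrite /left_range; lia.
  rewrite leqNgt; apply/negP => H.
  have hi : 0 < (Lc k mu v).+1 <= k by lia.
  have hi' : 0 < (Lc k mu v).+2 <= k by lia.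
  have := Lc_geq km v hi; have := Lc_geq kl v hi'; rewrite fE.
  have := gle hi; have := @gc_lt _ _ kl (Lc k mu v).+1 (Lc k mu v).+2; lia.
(* Here the index [j = Lc k mu v.+1 + 1] satisfies [gc k lam j <= fc k lam v.+1] and
   [gc k mu j > fc k mu v.+1]. Since [gc k mu j <= gc k lam j], all collapse to
   [gc k lam j = fc k lam v.+1], impossible at a letter 2. *)
- move=> v tl tm [dn dp].
  have dn' : dN v = 1%R.
    by move: dn; rewrite /dN; case: (tw_cases kl v) => -[]; case: (tw_cases km v) => -[]; lia.
  have dp' : dP v = 0%R.
    move: dp; rewrite /dP dn dn'.
    by case: (tw_cases kl v) => -[]; case: (tw_cases km v) => -[]; lia.
  have b1 := Lc_lek k lam v.+1; have b2 := Lc_lek k mu v.+1.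
  have L1 : Lc k lam v.+1 = (Lc k mu v.+1).+1 by move: dp; rewrite /dP dn; lia.
  have hj : 0 < (Lc k mu v.+1).+1 <= k by lia.
  have := gc_tw2 km tm hj; have := gc_tw2 kl tl hj.
  have := Lc_geq km v.+1 hj; have := Lc_geq kl v.+1 hj.
  have := gle hj; have := fc_dN v.+1; rewrite dn; lia.
(* A common letter 0 leaves [fc] and both differences unchanged, so [v] and [v + 1] would give two
   k'-related boxes of R. *)
- move=> v tl tm [dn dp].
  have Nv1 : Nc k lam v.+1 = Nc k mu v.+1 by move: dn; rewrite /dN; lia.
  have [Nv fv] : Nc k lam v = Nc k mu v /\ fc k mu v = fc k mu v.+1.
    by rewrite /fc; case: (tw_cases kl v) => -[]; case: (tw_cases km v) => -[]; lia.
  suff : v = v.+1 by lia.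
  apply: c4 => //; last by apply/RcolP.
  apply/RcolP => //; move: dp; rewrite /dP /dN.
  by case: (tw_cases kl v) => -[]; case: (tw_cases km v) => -[]; lia.
Qed.

End ColToCut.

Lemma fc_level f : Nc k mu 0 <= f -> exists v, fc k mu v = f.
Proof.
move=> hf; have ex : exists v, f <= fc k mu v by exists f; rewrite /fc; lia.
case: (ex_minnP ex) => -[|v] hv hmin; first by exists 0; rewrite /fc in hv *; lia.
exists v.+1; apply/eqP; rewrite eqn_leq hv andbT.
have : fc k mu v < f by rewrite ltnNge; apply/negP => /hmin; lia.
by have := Nc_step km v; rewrite /fc; lia.
Qed.

Section CutToCol.

Hypothesis vs : cut_strip.

Let dN01 v : dN v = 0%R \/ dN v = 1%R.
Proof. by case: vs. Qed.

Let dP01 v : dP v = 0%R \/ dP v = 1%R.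
Proof. by case: vs. Qed.

Lemma Rcol_dP v : Rcol v <-> dN v = 0%R /\ dP v = 1%R.
Proof.
split.
  case=> E [j hj /andP[j1 j2]].
  have fE : fc k lam v = fc k mu v by rewrite /fc E.
  have d0 : dN v = 0%R by rewrite /dN E; lia.
  have := Lc_geq km v hj; have := Lc_geq kl v hj; rewrite fE.
  by have := dP01 v; rewrite /dP d0; lia.
case=> dn dp; have E : Nc k lam v = Nc k mu v by move: dn; rewrite /dN; lia.
have fE : fc k lam v = fc k mu v by rewrite /fc E.
split=> //; have b1 := Lc_lek k lam v; have b2 := Lc_lek k mu v.
have hj : 0 < Lc k mu v <= k by move: dp; rewrite /dP dn; lia.
exists (Lc k mu v) => //; rewrite /left_range.
have := Lc_geq km v hj; have := Lc_geq kl v hj; rewrite fE.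
by move: dp; rewrite /dP dn; lia.
Qed.

(** Otherwise the [j]-th letter 1 of [lam] precedes that of [mu], and every cut between them has
    [dN = 1] and [dP = 0]. The letters in between agree; they are not 1 since [Lc] is constant, and
    not 2 by [cut_strip], so they are 0 and [fc k mu] is constant, which makes the two values of
    [gc] equal. *)
Let gle j : 0 < j <= k -> gc k mu j <= gc k lam j.
Proof.
move=> hj; rewrite leqNgt; apply/negP => lt.
have [u [fu Lu _ _]] := Lpos kl hj; have [w [fw Lw Lw' _]] := Lpos km hj.
have uw : u < w.
  rewrite ltnNge; apply/negP => h; have := fc_dN u.+1.
  have := @fc_mono _ _ km w.+1 u.+1; have := dN01 u.+1; lia.
have mid v : u < v <= w -> [/\ dN v = 1%R, dP v = 0%R & Lc k mu v = j.-1].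
  move=> hv; have := @Lc_mono _ _ kl u.+1 v; have := @Lc_mono _ _ km v w.
  have := dN01 v; have := dP01 v; rewrite /dP => *; split; lia.
have fE d : u.+1 + d <= w -> fc k mu (u.+1 + d) = fc k mu u.+1.
  elim: d => [|d IH] hd; first by rewrite addn0.
  rewrite -IH; last lia.
  rewrite addnS in hd *; set x := u.+1 + d in hd IH *.
  have [m1 m2 m3] := mid x ltac:(lia); have [m1' m2' m3'] := mid x.+1 ltac:(lia).
  have [_ _ hb _] := vs; move: (hb x); move: m1 m1' m2 m2'.
  rewrite /dP /dN /fc.
  by case: (tw_cases kl x) => -[-> ? ?]; case: (tw_cases km x) => -[-> ? ?]; lia.
have := fE (w - u.+1); rewrite subnKC // => /(_ (leqnn _)).
have := fc_dN u.+1; have [-> _ _] := mid u.+1 ltac:(lia).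
by have := tw_cases km w; rewrite /fc in fu fw lt * => -[] [] *; lia.
Qed.

(** Cuts on one level of [fc k mu] are separated by letters 0 of [mu]. The last of these would be a
    letter 0 of [lam] too, next to a cut with [dN = 0] and [dP = 1], which [cut_strip] excludes. *)
Let Rinj v w : Rcol v -> Rcol w -> fc k mu v = fc k mu w -> v = w.
Proof.
wlog vw : v w / v < w.
  move=> H rv rw e; case: (ltngtP v w) => // h; first exact: (H v w).
  by apply/esym/(H w v).
case: w vw => // w vw /Rcol_dP[n1 p1] /Rcol_dP[n2 p2] e.
have [_ _ _ hc] := vs.
have := @fc_mono _ _ km v w; have := dN01 w; move: (hc w); move: n2 p2 e.
rewrite /dP /dN /fc.
by case: (tw_cases kl w) => -[-> ? ?]; case: (tw_cases km w) => -[-> ? ?]; lia.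
Qed.

(** If [dN v] were 1, then [fc k lam v] would be the next level, still below [gc k lam j], so a
    letter 1 would be lost from the count and [dP v] would be at least 2. *)
Let level0 j v : 0 < j <= k -> left_range j (fc k mu v) ->
  left_range j (fc k mu v).+1 -> dN v = 0%R.
Proof.
move=> hj /andP[r1 _] /andP[_ r2]; case: (dN01 v) => // d.
have := Lc_geq km v hj; have := Lc_geq kl v hj; have := fc_dN v.
by have := dP01 v; rewrite /dP d; lia.
Qed.

Lemma col_of_cut_strip : col_strip.
Proof.
split=> //.
- move=> c c0; have [ck|kc] := leqP c k.
    have := @gle (k + 1 - c) ltac:(lia).
    have e : k + 1 - (k + 1 - c) = c by lia.
    by rewrite /gc e; lia.
  have e : (k + (c - k.+1)).+1 = c by lia.
  by have := dN01 (c - k.+1); rewrite /dN /Nc e; lia.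
- move=> c kc; have e : (k + (c - k.+1)).+1 = c by lia.
  by have := dN01 (c - k.+1); rewrite /dN /Nc e; lia.
- move=> c hc _; set j := k + 1 - c.
  have hj : 0 < j <= k by lia.
  have hi : 0 < j.-1 <= k by lia.
  suff : gc k lam j.-1 <= gc k mu j.
    have e : k + 1 - j = c by lia.
    have e' : k + 1 - j.-1 = c.+1 by lia.
    by rewrite /gc e e'; lia.
  rewrite leqNgt; apply/negP => lt.
  have [w [fw Lw _ _]] := Lpos km hj.
  have := Lc_geq kl w.+1 hj; have := Lc_geq kl w.+1 hi.
  have := @gc_lt _ _ kl j.-1 j.
  have := fc_dN w.+1; have := dN01 w.+1; have := dP01 w.+1; rewrite /dP; lia.
move=> j f f' hj rf rf' ff'.
have rg e : f <= e <= f' -> left_range j e.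
  by move: rf rf'; rewrite /left_range; lia.
have [v fv] : exists v, fc k mu v = f.
  by apply: fc_level; have := gc_gt km hj; move: rf; rewrite /left_range; lia.
(* No letter of [mu] after [v] is a 0, for it would put two boxes of R on one level. So [fc] climbs
   by one at each cut while the row stays fixed, and the two required boxes are [f' - f] columns
   apart. *)
have run d : f + d <= f' -> fc k mu (v + d) = f + d /\ dN (v + d) = 0%R.
  elim: d => [|d IH] hd.
    rewrite !addn0; split=> //.
    by apply: (level0 hj); rewrite fv; apply: rg; lia.
  have [IH1 IH2] := IH ltac:(lia).
  have dp : dP (v + d) = 1%R.
    have := Lc_geq km (v + d) hj; have := Lc_geq kl (v + d) hj.
    have := fc_dN (v + d); have := rg (f + d) ltac:(lia).
    by have := dP01 (v + d); rewrite /left_range /dP IH2; lia.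
  have R1 : Rcol (v + d) by apply/Rcol_dP.
  rewrite addnS.
  have t0 : tw k mu (v + d).+1 <> 0.
    case: (tw_cases km (v + d)) => -[t e1 e2]; rewrite t // => _.
    have fE : fc k mu (v + d).+1 = f + d by move: IH1; rewrite /fc; lia.
    have dn : dN (v + d).+1 = 0%R.
      by apply: (level0 hj); rewrite fE; apply: rg; lia.
    have dp' : dP (v + d).+1 = 1%R.
      have := Lc_geq km (v + d).+1 hj; have := Lc_geq kl (v + d).+1 hj.
      have := fc_dN (v + d).+1; have := rg (f + d) ltac:(lia).
      by have := dP01 (v + d).+1; rewrite /left_range /dP dn; lia.
    have R2 : Rcol (v + d).+1 by apply/Rcol_dP.
    by have := Rinj R1 R2; lia.
  have fE : fc k mu (v + d).+1 = f + d.+1.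
    by move: IH1 t0; rewrite /fc; case: (tw_cases km (v + d)) => -[-> ? ?]; lia.
  split=> //; have := dN01 (v + d).+1; move: IH2 t0; rewrite /dN.
  by case: (tw_cases km (v + d)) => -[-> ? ?]; case: (tw_cases kl (v + d)) => -[? ? ?]; lia.
have Rrun d : f + d <= f' -> Rcol (v + d).
  move=> hd; have [h1 h2] := run d hd; split; first by move: h2; rewrite /dN; lia.
  by exists j => //; rewrite h1; apply: rg; lia.
have [g1 g2] := run (f' - f) ltac:(lia).
have R0 : Rcol v by have := Rrun 0; rewrite !addn0; apply; lia.
have R1 : Rcol (v + (f' - f)) by apply: Rrun; lia.
exists v, (v + (f' - f)); split=> [||x].
- lia.
- by move: fv g1; rewrite /fc; lia.
split=> [[Rx [] e]|[]->].
- by left; apply: Rinj => //; lia.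
- by right; apply: Rinj => //; lia.
- by split=> //; left.
- by split=> //; right; lia.
Qed.

End CutToCol.

Lemma cut_strip_col : col_strip <-> cut_strip.
Proof. by split; [exact: cut_of_col_strip | exact: col_of_cut_strip]. Qed.

End StripCounts.

(** * Boxes, k'-relation and horizontal strips *)

Lemma diagP k lam : kstrict k lam -> forall b,
  diag lam b <-> 0 < b.2 /\ b.1 <= col_length lam b.2.
Proof.
move=> kl [r c]; rewrite /diag /= /in_diag /=.
have pl := kstrict_part kl; case: r => [|r] /=; first by split; lia.
case: c => [|c]; first by split=> [//|[]].
by rewrite part_col //; split=> [//|[]].
Qed.

Lemma diagE k lam b : kstrict k lam ->
  diag lam b = (0 < b.2 /\ b.1 <= col_length lam b.2) :> Prop.
Proof. by move=> kl; apply/propext; exact: (diagP kl). Qed.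

Definition kdn k (b : box) : nat :=
  (if b.2 <= k then k - b.2 else b.2 - k.+1) + b.1.

Lemma kdistE k b : kdist k b = ((kdn k b)%:R + 1 / 2%:R)%R.
Proof.
rewrite /kdist /kdn natrD [RHS]addrAC; congr (_ + _)%R.
case: leqP => h.
  rewrite natrB // ler0_norm.
    by lra.
  have : ((b.2)%:R <= k%:R :> rat)%R by rewrite ler_nat.
  have : (0 <= 1 / 2%:R :> rat)%R by [].
  lra.
have : (k%:R + 1 <= (b.2)%:R :> rat)%R by rewrite natr1 ler_nat.
rewrite natrB // -[k.+1]addn1 natrD => h'; rewrite ger0_norm; lra.
Qed.

Lemma krelatedE k b d : krelated k b d = (kdn k b == kdn k d).
Proof. by rewrite /krelated !kdistE (inj_eq (addIr _)) eqr_nat. Qed.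

Section StripBoxes.

Local Open Scope classical_set_scope.

Variables (k : nat) (lam mu : seq nat).

Definition Rbox v : box := (Nc k mu v, (k + v).+1).

Lemma Rbox_inj : injective Rbox.
Proof. by move=> v w []; lia. Qed.

(** This is the origin of [fc]: it measures the k'-distance, less 1/2, of the lowest box of a right
    column, possibly in row zero. *)
Lemma kdn_Rbox v : kdn k (Rbox v) = fc k mu v.
Proof. by rewrite /kdn /Rbox /fc /=; case: leqP; lia. Qed.

Hypotheses (kl : kstrict k lam) (km : kstrict k mu).

Lemma skewP b : (diag lam `\` diag mu) b <->
  0 < b.2 /\ col_length mu b.2 < b.1 <= col_length lam b.2.
Proof.
rewrite /setD /= -/(diag lam b) -/(diag mu b) !(diagP kl _) !(diagP km _).
by split=> [[[h1 h2] h3]|[h1 h2]]; lia.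
Qed.

Lemma left_skewP j f : 0 < j <= k -> left_range k lam mu j f ->
  (diag lam `\` diag mu) (f - j + 1, k + 1 - j)%N.
Proof. by move=> hj; rewrite /left_range /gc => h; apply/skewP => /=; lia. Qed.

Lemma exposedP : (forall c, 0 < c -> col_length mu c <= col_length lam c) ->
  forall b, exposed_right k (diag lam) (diag mu) b <->
    exists2 v, Nc k lam v = Nc k mu v & b = Rbox v.
Proof.
move=> c1 [r c]; rewrite /exposed_right /= -/(diag mu (r, c)).
rewrite -/(diag lam (r.+1, c)) (diagE _ km) (diagE _ kl) /right_box /=.
split=> [[[h1 h2] h3 h4]|[v E []-> ->]].
  have e : (k + (c - k.+1)).+1 = c by lia.
  have h5 := c1 c h1; exists (c - k.+1); rewrite ?/Rbox /Nc e; first lia.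
  by congr pair; lia.
by move: E; rewrite /Nc; split; lia.
Qed.

Lemma R_setP : (forall c, 0 < c -> col_length mu c <= col_length lam c) ->
  forall b, R_set k (diag lam) (diag mu) b <->
    exists2 v, Rcol k lam mu v & b = Rbox v.
Proof.
move=> c1 b; rewrite /R_set /= -/(exposed_right k (diag lam) (diag mu) b).
rewrite (exposedP c1); split.
  move=> [[v E ->] [d [/skewP[d1 d2] d3]]].
  rewrite krelatedE kdn_Rbox => /eqP H; exists v => //; split=> //.
  move: H; rewrite /left_box in d3; rewrite /kdn d3 => H.
  exists (k + 1 - d.2)%N; rewrite /left_range /gc; first lia.
  have -> : k + 1 - (k + 1 - d.2) = d.2 by lia.
  lia.
case=> v [E [j hj lr]] ->; split; first by exists v.
exists (fc k mu v - j + 1, k + 1 - j)%N; split; first exact: left_skewP.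
  by rewrite /left_box /=; lia.
rewrite krelatedE kdn_Rbox /kdn /= ifT; last lia.
by apply/eqP; move: lr; rewrite /left_range /gc; lia.
Qed.

Lemma strip_col : k_horizontal_strip k (diag lam) (diag mu) -> col_strip k lam mu.
Proof.
case=> h1 [h2 h3] h4 h5.
have c1 c : 0 < c -> col_length mu c <= col_length lam c.
  move=> c0; have H : diag mu (col_length mu c, c) by apply/(diagP km _).
  by have /(diagP kl _)[] := h1 _ H.
have c2 c : k < c -> col_length lam c <= (col_length mu c).+1.
  move=> kc; rewrite leqNgt; apply/negP => lt.
  have := h3 ((col_length mu c).+1, c) ((col_length mu c).+2, c).
  have H : ((col_length mu c).+1, c) <> ((col_length mu c).+2, c) by case; lia.
  move=> h; apply: H; apply: h => //; apply/skewP => /=; lia.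
split=> //.
- move=> c hc lt; rewrite leqNgt; apply/negP => H.
  have /h2 [_] : (diag lam `\` diag mu) ((col_length mu c).+1, c).
    by apply/skewP => /=; lia.
  by apply; apply/(diagP kl _) => /=; lia.
- move=> v w Rv Rw e; apply: Rbox_inj; apply: h4.
  + by apply/(R_setP c1); exists v.
  + by apply/(R_setP c1); exists w.
  by rewrite krelatedE !kdn_Rbox e.
move=> j f f' hj rf rf' ff'.
have lrge g : left_range k lam mu j g -> j <= g.
  by rewrite /left_range /gc; lia.
have := h5 _ _ (left_skewP hj rf) (left_skewP hj rf').
have ne : (f - j + 1, k + 1 - j)%N != (f' - j + 1, k + 1 - j)%N.
  by apply/eqP => -[]; have := lrge _ rf; have := lrge _ rf'; lia.
case=> // e1 [e2 [ne12 E12 ES]].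
have kd g : left_range k lam mu j g ->
    kdn k (g - j + 1, k + 1 - j)%N = g.
  by rewrite /kdn /= ifT => [/lrge|]; lia.
have key e : (e = e1 \/ e = e2) <-> R_set k (diag lam) (diag mu) e /\
    (kdn k e = f \/ kdn k e = f').
  have : [set e1; e2] e <-> (e = e1 \/ e = e2) by [].
  rewrite -ES => <-; rewrite /setI /= !krelatedE !kd //.
  split=> -[? H]; split=> //.
    by case/orP: H => /eqP ->; [left|right].
  by case: H => ->; rewrite eqxx ?orbT.
have [[v Rv Ev] kv] : (exists2 v, Rcol k lam mu v & e1 = Rbox v) /\
     (kdn k e1 = f \/ kdn k e1 = f').
  by rewrite -(R_setP c1); apply/key; left.
have [[w Rw Ew] kw] : (exists2 v, Rcol k lam mu v & e2 = Rbox v) /\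
     (kdn k e2 = f \/ kdn k e2 = f').
  by rewrite -(R_setP c1); apply/key; right.
exists v, w; split.
- by move=> vw; case/eqP: ne12; rewrite Ev Ew vw.
- by move: E12; rewrite Ev Ew.
move=> x; have := key (Rbox x); rewrite (R_setP c1) kdn_Rbox Ev Ew.
move=> [k1 k2]; split=> [[Rx fx]|xvw].
  by case: k2 => [|/Rbox_inj->|/Rbox_inj->]; [split=> //; exists x|left|right].
case: k1 => [|[y Ry /Rbox_inj->] //].
by case: xvw => ->; [left|right].
Qed.

Lemma col_strip_strip : col_strip k lam mu -> k_horizontal_strip k (diag lam) (diag mu).
Proof.
case=> c1 c2 c3 c4 c5; split.
- move=> b /(diagP km _)[b0 bm]; apply/(diagP kl _); split=> //.
  exact: leq_trans bm (c1 _ b0).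
- split.
    move=> [r c] /[dup] rc /skewP /= [c0 hr]; split; first by case: rc.
    move=> /(diagP kl _) /= [_ H].
    case: (ltngtP c k) => ck.
    + have := c3 c; lia.
    + have := c2 c; have := @col_anti lam c c.+1 (leqnSn c); lia.
    + have := c2 c.+1; have := @col_anti mu c c.+1 (leqnSn c); lia.
  move=> [r c] [r' c'] /skewP /= [? h] /skewP /= [? h'] kc _ e.
  move: kc h h'; rewrite /right_box -e /= => kc h h'.
  by have := c2 c; move=> ?; congr pair; lia.
- move=> b d /(R_setP c1)[v Rv ->] /(R_setP c1)[w Rw ->].
  rewrite krelatedE !kdn_Rbox => /eqP; move: Rv Rw; move=> Rv Rw e.
  by rewrite (c4 _ _ Rv Rw e).
move=> b d.
wlog lt : b d / b.1 < d.1.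
  move=> W hb hd ne e.
  have [lt|lt|e1] := ltngtP b.1 d.1; first exact: W.
    have [||e1 [e2 [x1 x2 x3]]] := W d b lt hd hb; rewrite 1?eq_sym //.
    exists e1, e2; split=> //; rewrite -x3; congr (_ `&` _).
    by apply/funext => x /=; rewrite orbC.
  by case/eqP: ne; case: b d e e1 {W hb hd} => ? ? [? ?] /= -> ->.
move=> /skewP[b0 hb] /skewP[d0 hd] _ e; rewrite -e in d0 hd.
have [bk|kb] := leqP b.2 k; last by have := c2 b.2 kb; lia.
pose j := k + 1 - b.2.
have hj : 0 < j <= k by rewrite /j; lia.
have jE : k + 1 - j = b.2 by rewrite /j; lia.
have kb : kdn k b = b.1 + j - 1 by rewrite /kdn bk /j; lia.
have kd : kdn k d = d.1 + j - 1 by rewrite /kdn -e bk /j; lia.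
have [||| v [w [vw NE H]]] := c5 j (kdn k b) (kdn k d) hj.
- by rewrite /left_range kb /gc jE; lia.
- by rewrite /left_range kd /gc jE; lia.
- by rewrite kb kd; lia.
exists (Rbox v), (Rbox w); split=> //; first by apply/eqP => /Rbox_inj.
apply/seteqP; split=> x /=.
  rewrite !krelatedE => -[/(R_setP c1)[y Ry ->]]; rewrite kdn_Rbox => hy.
  have /H : Rcol k lam mu y /\ (fc k mu y = kdn k b \/ fc k mu y = kdn k d).
    by split=> //; case/orP: hy => /eqP->; [left|right].
  by case=> ->; [left|right].
rewrite !krelatedE => hx.
have [y yE hy] : exists2 y, x = Rbox y & y = v \/ y = w.
  by case: hx => ->; [exists v; [|left] | exists w; [|right]].
have [Ry ky] : Rcol k lam mu y /\ (fc k mu y = kdn k b \/ fc k mu y = kdn k d).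
  exact/H.
split; first by apply/(R_setP c1); exists y.
by rewrite yE kdn_Rbox; case: ky => ->; rewrite eqxx ?orbT.
Qed.

Lemma horizontal_strip_cut :
  k_horizontal_strip k (diag lam) (diag mu) <-> cut_strip k lam mu.
Proof.
rewrite -(cut_strip_col kl km).
by split; [exact: strip_col | exact: col_strip_strip].
Qed.

End StripBoxes.

(** * Connected components of the set A *)

Definition zero_cut k lam mu v : bool :=
  (dN k lam mu v == 0%R) && (dP k lam mu v == 0%R).

Definition strip_tops k lam mu n : nat :=
  count (fun v => ~~ zero_cut k lam mu v && zero_cut k lam mu v.+1) (iota 0 n).

Section Components.

Local Open Scope classical_set_scope.

Variables (k : nat) (lam mu : seq nat) (n : nat).
Hypotheses (kl : kstrict k lam) (km : kstrict k mu).
Hypothesis vs : cut_strip k lam mu.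
Hypothesis tail : forall v, n <= v -> zero_cut k lam mu v.

Local Notation zc := (zero_cut k lam mu).
Local Notation Rbox := (Rbox k mu).
Local Notation A := (A_set k (diag lam) (diag mu)).

Lemma A_setP b : A b <-> exists2 v, zc v & b = Rbox v.
Proof.
have [c1 _ _ _ _] := col_of_cut_strip kl km vs.
rewrite /A_set /setD /= -/(exposed_right k (diag lam) (diag mu) b).
rewrite -/(R_set k (diag lam) (diag mu) b) (R_setP kl km c1) (exposedP kl km c1).
have [vs1 vs2 _ _] := vs; split.
  move=> [[v E ->] nR]; exists v => //.
  have dn : dN k lam mu v = 0%R by rewrite /dN E; lia.
  rewrite /zero_cut dn eqxx /=; case: (vs2 v) => [->//|dp].
  by case: nR; exists v => //; apply/Rcol_dP.
move=> [v /andP[/eqP dn /eqP dp] ->]; split.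
  by exists v => //; move: dn; rewrite /dN; lia.
by move=> [w /(Rcol_dP kl km vs)[_ dpw] /Rbox_inj E]; move: dpw; rewrite -E dp.
Qed.

(** Consecutive columns beyond [k] differ in height by at most one, so their lowest boxes share at
    least a vertex. Adjacency in A is thus adjacency of cuts. *)
Lemma touching_Rbox v w :
  touching (Rbox v) (Rbox w) = (v != w) && (v <= w.+1) && (w <= v.+1).
Proof.
rewrite /touching (inj_eq (@Rbox_inj k mu)) /=.
have [//|vw] := eqVneq v w => /=.
apply/idP/idP; first by lia.
move=> h; have [e|e] : w = v.+1 \/ v = w.+1 by lia.
  by have := Nc_step km v; rewrite e; lia.
by have := Nc_step km w; rewrite e; lia.
Qed.

Definition zero_run v w := forall x, minn v w <= x <= maxn v w -> zc x.

Lemma connected_Rbox v d : connected_in A (Rbox v) d <->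
  exists2 w, zero_run v w & d = Rbox w.
Proof.
split.
  case=> p [pp lp Ap]; elim: p v pp lp Ap => [|e p IH] v /=.
    move=> _ <- H; have /A_setP[w zw /Rbox_inj E] := H _ (mem_head _ _).
    by exists v => // x; rewrite minnn maxnn => ?; have -> : x = w by lia.
  case/andP=> t pp lp Ap.
  have /A_setP[w1 z1 /Rbox_inj E1] := Ap _ (mem_head _ _).
  have /A_setP[w2 z2 E2] : A e by apply: Ap; rewrite !inE eqxx orbT.
  rewrite E2 in t pp lp Ap; move: t; rewrite touching_Rbox => t.
  have [|w zw ->] := IH w2 pp lp.
    by move=> y hy; apply: Ap; rewrite inE hy orbT.
  exists w => // x hx; have [->|xw1] := eqVneq x w1; first by [].
  by apply: zw; lia.
case=> w zr ->; move: zr.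
have [m] := ubnP ((w - v) + (v - w)); elim: m v => // m IH v hm zr.
have Av : A (Rbox v) by apply/A_setP; exists v => //; apply: zr; lia.
have [e|vw] := eqVneq v w.
  by exists [::]; split=> [||x]; rewrite ?e // inE -e => /eqP->.
pose v1 := if v < w then v.+1 else v.-1.
have hv1 : (w - v1) + (v1 - w) < (w - v) + (v - w) by rewrite /v1; case: (ltnP v w); lia.
have [||p [pp lp Ap]] := IH v1; first lia.
  by move=> x hx; apply: zr; move: hx; rewrite /v1; case: (ltnP v w); lia.
exists (Rbox v1 :: p); split=> //=.
  by rewrite pp touching_Rbox andbT /v1; case: (ltnP v w); lia.
by move=> e; rewrite inE => /predU1P[->//|]; apply: Ap.
Qed.

(** The boxes of A are indexed by the uncrossed cuts, and its components are the maximal runs of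
    these. A component avoids column [k + 1] exactly when its run does not contain the cut 0, so
    that it starts just after a crossed cut; such pairs are what [strip_tops] counts. *)
Lemma n_strip_tops : n_strip k (diag lam) (diag mu) = strip_tops k lam mu n.
Proof.
pose F v := connected_in A (Rbox v.+1).
pose s := [seq v <- iota 0 n | ~~ zc v && zc v.+1].
have zn v : zc v.+1 -> ~~ zc v -> v \in s.
  move=> z nz; rewrite mem_filter z nz mem_iota /= add0n.
  by rewrite ltnNge; apply: contraNN nz => /tail.
have start v : zc v -> ~ zero_run 0 v -> exists2 w, w \in s & zero_run w.+1 v.
  elim: v => [|v IH] z nr; first by case: nr => x; rewrite maxnn => ?; have -> : x = 0 by lia.
  have [zv|nzv] := boolP (zc v).
    have [] := IH zv.
      by move=> H; apply: nr => x hx; have [->|ne] := eqVneq x v.+1 => //; apply: H; lia.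
    move=> w ws zw; exists w => // x hx; have [->//|ne] := eqVneq x v.+1.
    have wv : w.+1 <= v.
      move: ws; rewrite mem_filter => /andP[/andP[nw _] _].
      by rewrite ltnNge; apply: contraNN nw => h; apply: zw; lia.
    by apply: zw; lia.
  by exists v; [exact: zn | move=> x hx; have -> : x = v.+1 by lia].
have s_nz v : v \in s -> zc v.+1 /\ ~~ zc v.
  by rewrite mem_filter => /andP[/andP[-> ->]].
rewrite /n_strip.
have -> : box_components A `&` [set D | forall b, D b -> b.2 <> k.+1]
        = F @` [set` [fset v in s]%fset].
  apply/seteqP; split=> D /=.
    case=> -[b /A_setP[v zv ->] <-] H.
    have [w ws zw] : exists2 w, w \in s & zero_run w.+1 v.
      apply: start => // z0; apply: (H (Rbox 0)); last by rewrite /= addn0.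
      by apply/connected_Rbox; exists 0 => // x hx; apply: z0; lia.
    exists w; first by rewrite /= inE.
    by apply/seteqP; split=> d /connected_Rbox[x zx ->]; apply/connected_Rbox;
      exists x => // y hy; case: (boolP (minn w.+1 v <= y <= maxn w.+1 v)) => h;
      [exact: zw | apply: zx; lia | exact: zw | apply: zx; lia].
  case=> w; rewrite inE => ws <-; have [z nz] := s_nz w ws; split.
    by exists (Rbox w.+1) => //; apply/A_setP; exists w.+1.
  move=> b /connected_Rbox[x zx ->] /= e; case/negP: nz.
  by apply: zx; have -> : x = 0; lia.
rewrite fset_set_image ?card_in_imfset /=.
- rewrite set_fsetK card_fseq undup_id ?size_filter //.
  by rewrite filter_uniq // iota_uniq.
- move=> v w; rewrite !set_fsetK !inE => vs' ws' E.
  wlog vw : v w vs' ws' E / v < w.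
    by move=> W; case: (ltngtP v w) => // h; [exact: W|apply/esym; exact: W].
  have [_ nw] := s_nz w ws'; have [zv _] := s_nz v vs'.
  have : F w (Rbox v.+1).
    rewrite -E; apply/connected_Rbox; exists v.+1 => // x hx.
    by have -> : x = v.+1 by lia.
  move=> /connected_Rbox[y zy /Rbox_inj e]; case/negP: nw; apply: zy; lia.
exact: finite_fset.
Qed.

End Components.

Local Notation "n %:Z" := (Posz n) (only parsing) : nat_scope.

(** * k-Grassmannian elements *)

Lemma sp0 (w : signed_perm) : w 0%R = 0%R.
Proof. by have := sp_odd w 0%R; rewrite oppr0; move: (sp_fun _ _) => x; lia. Qed.

Lemma sp_pos_eq (u v : signed_perm) :
  (forall i : nat, 0 < i -> u i%:Z = v i%:Z) -> u = v.
Proof.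
move=> H; apply: signed_permP => -[[|i]|i]; first by rewrite !sp0.
  exact: H.
by rewrite NegzE !sp_odd H.
Qed.

(** Such a map preserves the interval [-n, n], where injectivity implies surjectivity by finiteness;
    [to] and [h] transport the map to an ordinal type. *)
Lemma odd_injection_bij (f : int -> int) n :
  (forall a, f (- a)%R = (- f a)%R) -> injective f ->
  (forall a : int, n < `|a|%N -> f a = a) -> exists g, cancel f g /\ cancel g f.
Proof.
move=> fodd finj fbig.
have fsmall a : `|a|%N <= n -> `|f a|%N <= n.
  move=> an; rewrite leqNgt; apply/negP => H.
  by have := fbig _ H; move/finj; lia.
pose to (i : 'I_(n.*2.+1)) : int := (i%:Z - n%:Z)%R.
pose h (i : 'I_(n.*2.+1)) : 'I_(n.*2.+1) := inord (absz (f (to i) + n%:Z)%R).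
have to_small i : `|to i|%N <= n by rewrite /to; have := ltn_ord i; lia.
have hE i : to (h i) = f (to i).
  by have sm := fsmall _ (to_small i); rewrite [LHS]/to /h inordK; lia.
have to_inj : injective to by move=> i j; rewrite /to => e; apply: val_inj => /=; lia.
have hinj : injective h by move=> i j e; apply/to_inj/finj; rewrite -!hE e.
have fsurj b : exists a, f a = b.
  have [bn|nb] := leqP `|b|%N n; last by exists b; apply: fbig.
  have bE : to (inord (absz (b + n%:Z)%R)) = b by rewrite /to inordK; lia.
  have /codomP[i Hi] : inord (absz (b + n%:Z)%R) \in codom h by rewrite (injF_onto hinj).
  by exists (to i); rewrite -hE -Hi bE.
have [g gK] := choice fsurj; exists g; split=> // a.
by apply: finj; rewrite gK.
Qed.

Section KGrass.

Variables (k : nat) (lam : seq nat).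
Hypothesis kl : kstrict k lam.

(* The value of the inverse of w_lam at [v]. *)
Definition uinv v : int :=
  match tw k lam v with
  | 0 => - ((k + Nc k lam v.-1)%:Z)
  | 1 => (Lc k lam v)%:Z
  | _ => (k + v + Nc k lam v - Lc k lam v)%:Z
  end%R.

(** This is the total number of letters 0 plus the number of letters 2 up to [v]; the letters 2 thus
    take the entries beyond [k] plus the number of large parts. *)
Definition Qc v := v + Nc k lam v - Lc k lam v.

Lemma Qc_step v :
  Qc v.+1 = (if tw k lam v.+1 == 2 then (Qc v).+1 else Qc v).
Proof.
have := Lc_lev kl v; rewrite /Qc.
by case: (tw_cases kl v) => -[-> h1 h2] /=; lia.
Qed.

Lemma Qc_mono v w : v <= w -> Qc v <= Qc w.
Proof.
move=> /subnK <-; elim: (w - v) => // d IH; apply: leq_trans IH _.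
by rewrite addSn Qc_step; case: ifP.
Qed.

Lemma Qc0 : Qc 0 = Nc k lam 0.
Proof. by rewrite /Qc Lc0 // subn0. Qed.

Lemma uinv_spec v : 0 < v ->
  [\/ [/\ tw k lam v = 0, uinv v = (- (k + Nc k lam v.-1)%:Z)%R,
          0 < Nc k lam v.-1 <= Nc k lam 0 & Nc k lam v < Nc k lam v.-1],
      [/\ tw k lam v = 1, uinv v = Lc k lam v, 0 < Lc k lam v <= k
        & Lc k lam v.-1 < Lc k lam v]
    | [/\ tw k lam v = 2, uinv v = (k + Qc v)%:Z, Nc k lam 0 < Qc v
        & Qc v.-1 < Qc v]].
Proof.
case: v => // v _ /=; rewrite /uinv.
have N0 := Nc_anti kl (leq0n v).
have q0 := Qc_mono (leq0n v); rewrite Qc0 in q0.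
have L1 := Lc_lek k lam v.+1; have := Qc_step v; have := Lc_lev kl v.+1.
case: (tw_cases kl v) => -[-> h1 h2] /= h3 h4.
- by constructor 1; split=> //; lia.
- by constructor 2; split=> //; lia.
- constructor 3; split=> //; last by rewrite h4.
    by move: h4; rewrite /Qc; lia.
  by rewrite h4; lia.
Qed.

(** The absolute values for letters 1, 0 and 2 fill three disjoint ranges, 1..k, then up to
    [k + Nc k lam 0], then beyond, and are strictly monotone in [v] within each. *)
Lemma uinv_inj v w : 0 < v -> 0 < w -> `|uinv v|%N = `|uinv w|%N -> v = w.
Proof.
wlog vw : v w / v < w.
  by move=> W v0 w0 e; case: (ltngtP v w) => // h; [exact: W|apply/esym/W].
case: w vw => // w vw v0 _ /=.
have := Nc_anti kl vw; have := Lc_mono kl vw; have := Qc_mono vw.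
have := uinv_spec (ltn0Sn w); have := uinv_spec v0 => /=.
have := Nc_anti kl (ltnSn v.-1); rewrite prednK //.
have : v <= w by lia.
move=> /[dup] /(Nc_anti kl) ? /[dup] /(Lc_mono kl) ? /Qc_mono ? ?.
by case=> -[t1 -> h1 h2] [] [t1' -> h1' h2']; lia.
Qed.

Lemma uinv_neq0 v : 0 < v -> uinv v <> 0%R.
Proof. by move=> /uinv_spec[] [_ -> *] /=; lia. Qed.

Lemma uinv_perm : exists w : signed_perm,
  forall v : nat, 0 < v -> sp_inv_fun w v%:Z = uinv v.
Proof.
pose f (a : int) : int := match a with
  | Posz 0 => 0 | Posz v => uinv v | Negz v => - uinv v.+1 end%R.
have [V hV] := eventually_tail kl.
have fodd a : f (- a)%R = (- f a)%R.
  case: a => [[|v]|v]; first by rewrite /f !oppr0.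
    by rewrite -NegzE.
  by rewrite NegzE !opprK.
have fbig (a : int) : V.+1 < `|a|%N -> f a = a.
  suff H v : V.+1 < v -> f v%:Z = v%:Z.
    case: a => [v|v]; first exact: H.
    by rewrite NegzE fodd => h; rewrite H //; move: h; lia.
  case: v => // v hv; rewrite /f /uinv.
  have [n1 l1] := hV v ltac:(lia); have [n2 l2] := hV v.+1 ltac:(lia).
  by case: (tw_cases kl v) => -[-> h1 h2]; lia.
have finj : injective f.
  have sgn v : f v.+1%:Z <> 0%R by apply: uinv_neq0.
  move=> [[|v]|v] [[|w]|w] //; rewrite /f => e.
  - by case: (sgn w).
  - by have := sgn w; rewrite /f; lia.
  - by case: (sgn v).
  - by congr Posz; apply: uinv_inj => //; rewrite e.
  - have := @uinv_inj v.+1 w.+1; rewrite e abszN => /(_ isT isT erefl) vw.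
    by move: e; rewrite vw; have := sgn w; rewrite /f; lia.
  - by have := sgn v; rewrite /f; lia.
  - have := @uinv_inj v.+1 w.+1; rewrite -e abszN => /(_ isT isT erefl) vw.
    by move: e; rewrite vw; have := sgn w; rewrite /f; lia.
  - by congr Negz; apply/eqP; rewrite -eqSS; apply/eqP/uinv_inj => //; move/oppr_inj: e => ->.
have [g [fK gK]] := odd_injection_bij fodd finj fbig.
have godd a : g (- a)%R = (- g a)%R by apply: finj; rewrite fodd !gK.
have gfin : exists n : nat, forall a : int, (n < `|a|)%N -> g a = a.
  by exists V.+1 => a ha; apply: finj; rewrite gK fbig.
exists (SignedPerm gK fK godd gfin) => -[//|v] _ /=.
by [].
Qed.

Definition kgrass_spec (w : signed_perm) : Prop :=
  let l := num_large k lam in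
    [/\ forall j : nat, (1 <= j <= k)%N ->
          w j = (gamma k lam j + j)%:Z -
            (count (fun p => gamma k lam j + j + k < part lam p + p)%N
               (iota 1 l))%:Z,
        forall i : nat, (1 <= i <= l)%N -> w (k + i)%N = k%:Z - (part lam i)%:Z,
        forall i : nat, (k + l < i)%N -> 0 < w i
      & forall i j : nat, (k + l < i < j)%N -> w i < w j]%R.

Lemma kgrass_spec_inv (w : signed_perm) :
  (forall v : nat, 0 < v -> sp_inv_fun w v%:Z = uinv v) -> kgrass_spec w.
Proof.
move=> wE.
have lE : num_large k lam = Nc k lam 0 by rewrite num_large_col /Nc addn0.
have winv v : 0 < v -> w (uinv v) = v%:Z by move=> v0; rewrite -wE // sp_inv_funK.
have wpos i : k + Nc k lam 0 < i -> exists2 v, 0 < v & uinv v = i%:Z.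
  move=> hi; have E := sp_funK w i%:Z; set a := w i%:Z in E.
  case: a E => [[|v]|v].
  - by have := sp0 (sp_inv w); rewrite /= => ->; lia.
  - by rewrite wE // => E; exists v.+1.
  - rewrite NegzE; have := sp_odd (sp_inv w) v.+1%:Z; rewrite /= => ->.
    by rewrite wE //; case: (uinv_spec (ltn0Sn v)) => -[_ -> *]; lia.
split.
- move=> j hj; rewrite gamma_col // -/(gc k lam j).
  have [x [fx Lx _ tx]] := Lpos kl hj.
  have ux : uinv x.+1 = j%:Z by rewrite /uinv tx Lx.
  rewrite -ux winv // -fx lE.
  (* Row [p] is a letter 0 at some position [y + 1] with [part lam p = k + y + 1] and
     [Nc k lam y = p]. The inequality says that this letter lies to the right of the [j]-th letter
     1, so the count is the number of letters 0 beyond that letter. *)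
  suff -> : count (fun p => fc k lam x.+1 + k < part lam p + p)
               (iota 1 (Nc k lam 0)) = Nc k lam x.+1 by rewrite /fc; lia.
  have -> : count (fun p => fc k lam x.+1 + k < part lam p + p)
               (iota 1 (Nc k lam 0)) = count (fun p => p <= Nc k lam x.+1) (iota 1 (Nc k lam 0)).
    apply: eq_in_count => p; rewrite mem_iota => hp.
    have [|y [Ny Ny' py ty]] := @Npos _ _ kl p; first lia.
    rewrite py; have xy : x <> y by move=> e; move: tx; rewrite e ty.
    case: (ltngtP x y) => // h.
      have := @Nc_anti _ _ kl x.+1 y h; have := @fc_mono _ _ kl x.+1 y h.
      by rewrite {2}/fc Ny; lia.
    have := @Nc_anti _ _ kl y.+1 x h; have := @fc_mono _ _ kl y.+1 x h.
    have := Nc_anti kl (leqnSn x).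
    by case: (tw_cases kl x) tx => -[-> e1 e2] // _; rewrite /fc; lia.
  rewrite -(@subnKC (Nc k lam x.+1) (Nc k lam 0)); last exact: (Nc_anti kl).
  rewrite iotaD count_cat.
  have /eqP -> : count (fun p => p <= Nc k lam x.+1) (iota 1 (Nc k lam x.+1)) ==
     size (iota 1 (Nc k lam x.+1)).
    by rewrite -all_count; apply/allP => r; rewrite mem_iota; lia.
  rewrite size_iota; apply/eqP; rewrite -[X in _ == X]addn0 eqn_add2l.
  by rewrite -leqn0 leqNgt -has_count; apply/hasPn => r; rewrite mem_iota; lia.
- move=> i; rewrite lE => hi; have [y [Ny Ny' py ty]] := Npos kl hi.
  have uy : uinv y.+1 = (- (k + i)%:Z)%R by rewrite /uinv ty Ny.
  have := winv y.+1 isT; rewrite uy sp_odd py; lia.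
- move=> i; rewrite lE => /wpos[v v0 <-]; rewrite winv //; lia.
move=> i j; rewrite lE => /andP[hi ij].
have [v v0 uv] := wpos i hi; have [x x0 ux] := wpos j (ltn_trans hi ij).
rewrite -uv -ux !winv //.
have : ~~ (x <= v); last lia.
apply/negP => /Qc_mono.
by case: (uinv_spec v0) uv => -[_ -> *]; case: (uinv_spec x0) ux => -[_ -> *]; lia.
Qed.

(** The entries up to [c] are prescribed. The later ones are positive and list the same remaining
    absolute values in increasing order, so equal values sit at equal places: [ge] gives each
    inequality. *)
Lemma kgrass_spec_uniq (w w' : signed_perm) :
  kgrass_spec w -> kgrass_spec w' -> w = w'.
Proof.
set c := k + num_large k lam.
have small (u u' : signed_perm) : kgrass_spec u -> kgrass_spec u' ->
    forall i : nat, i <= c -> u i%:Z = u' i%:Z.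
  case=> h1 h2 _ _ [h1' h2' _ _] [|i] hi; first by rewrite !sp0.
  have [ik|ki] := leqP i.+1 k; first by rewrite h1 // h1'.
  have -> : i.+1 = k + (i.+1 - k) by lia.
  by rewrite h2 ?h2' //; move: hi; rewrite /c; lia.
have tr (u u' : signed_perm) : kgrass_spec u -> kgrass_spec u' ->
    forall i : nat, c < i -> exists2 p : nat, c < p & u' p%:Z = u i%:Z.
  move=> hu hu' i ci; have [_ _ h3 _] := hu; have [_ _ h3' _] := hu'.
  have up := h3 i ci; have E := sp_inv_funK u' (u i%:Z).
  set p := sp_inv_fun u' (u i%:Z) in E.
  have cp : c < `|p|%N.
    rewrite ltnNge; apply/negP => pc.
    have := small _ _ hu hu' _ pc.
    have [pE|pE] : p = `|p|%N%:Z \/ p = (- `|p|%N%:Z)%R by lia.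
      by rewrite -pE E => /(can_inj (sp_funK u)); lia.
    rewrite pE sp_odd in E => e; have : u (- `|p|%N%:Z)%R = u i%:Z by rewrite sp_odd e.
    by move/(can_inj (sp_funK u)); lia.
  exists `|p|%N => //.
  have [pE|pE] : p = `|p|%N%:Z \/ p = (- `|p|%N%:Z)%R by lia.
    by rewrite -pE.
  by move: E (h3' _ cp); rewrite {1}pE sp_odd; lia.
have ge (u u' : signed_perm) : kgrass_spec u -> kgrass_spec u' ->
    forall i p : nat, c < i -> c < p -> u' p%:Z = u i%:Z -> i <= p.
  move=> hu hu'; elim=> // i IH p ci cp E.
  have [ic|ic] := leqP i c; first by lia.
  have [q cq Eq] := tr _ _ hu hu' i ic.
  have := IH q ic cq Eq.
  have [_ _ _ h4] := hu; have [_ _ _ h4'] := hu'.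
  have := h4 i i.+1; rewrite -Eq -E ltnSn andbT => /(_ ic) lt.
  case: (ltngtP p q) => pq; last by move: lt; rewrite pq; lia.
    by have := h4' p q; rewrite cp pq => /(_ isT); lia.
  lia.
move=> hw hw'; apply: sp_pos_eq => i _.
have [ic|ic] := leqP i c; first exact: small.
have [p cp Ep] := tr _ _ hw hw' i ic.
have e1 := ge _ _ hw hw' i p ic cp Ep.
have e2 := ge _ _ hw' hw p i cp ic (esym Ep).
by rewrite -Ep; congr (w' _%:Z); lia.
Qed.

Lemma kgrass_inv v : 0 < v -> sp_inv_fun (kgrass k lam) v%:Z = uinv v.
Proof.
have [w wE] := uinv_perm.
suff -> : kgrass k lam = w by exact: wE.
have hw := kgrass_spec_inv wE.
by apply: xget_unique => // w' hw'; apply: kgrass_spec_uniq.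
Qed.

Lemma kgrass_invN v : 0 < v -> sp_inv_fun (kgrass k lam) (- v%:Z)%R = (- uinv v)%R.
Proof.
by move=> v0; have := sp_odd (sp_inv (kgrass k lam)) v%:Z; rewrite /= kgrass_inv.
Qed.

End KGrass.

(** * Length and reduced words *)

Local Open Scope group_scope.
Local Open Scope nat_scope.

(** The left ascents, those with s_a w longer than w; multiplication on the left permutes positions
    of the inverse, which is why the inverse is tested. *)
Definition ascent a (w : signed_perm) : bool :=
  if a is 0 then (0 < sp_inv_fun w 1%:Z)%R
  else (sp_inv_fun w a%:Z < sp_inv_fun w a.+1%:Z)%R.

Definition tswap a v := if v == a then a.+1 else if v == a.+1 then a else v.

Lemma tswap_lt (x : nat -> int) a i j : (x a < x a.+1)%R ->
  (tswap a i < tswap a j) && (x j < x i)%R =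
  ((i < j) && (x j < x i)%R) + ((i == a.+1) && (j == a)) * 1 :> nat.
Proof.
rewrite /tswap => lt.
case: (i =P a) => [?|?]; case: (j =P a) => [?|?];
case: (i =P a.+1) => [?|?]; case: (j =P a.+1) => [?|?]; subst; try lia.
Qed.

(** The transposition reverses the order of [a] and [a + 1] only. The same summand is put on both
    sides, at [(a, a + 1)] and at [(a + 1, a)], so that the identity holds pair by pair and can be
    summed. *)
Lemma tswap_le (x : nat -> int) a i j :
  ((tswap a i <= tswap a j) && (x i + x j < 0)%R) +
    ((i == a) && (j == a.+1)) * (x a + x a.+1 < 0)%R =
  ((i <= j) && (x i + x j < 0)%R) +
    ((i == a.+1) && (j == a)) * (x a + x a.+1 < 0)%R :> nat.
Proof.
rewrite /tswap.
case: (i =P a) => [?|?]; case: (j =P a) => [?|?];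
case: (i =P a.+1) => [?|?]; case: (j =P a.+1) => [?|?]; subst; try lia.
Qed.

Section Inversions.

Variable m : nat.

(** The type B inversion number: ordinary inversions plus pairs, diagonal ones included, with
    negative sum. *)
Definition inversions (x : nat -> int) : nat :=
  \sum_(p : 'I_m * 'I_m) ((p.1 < p.2) && (x p.2 < x p.1)%R)
  + \sum_(p : 'I_m * 'I_m) ((p.1 <= p.2) && (x p.1 + x p.2 < 0)%R).

Lemma sum_pair_delta (p q : 'I_m) (c : nat) :
  \sum_(r : 'I_m * 'I_m) ((r.1 == p) && (r.2 == q)) * c = c.
Proof.
rewrite (bigD1 (p, q)) //= !eqxx mul1n big1 ?addn0 // => -[i j] /=.
by rewrite xpair_eqE => /negPf->.
Qed.

Lemma inversions_swap (x : nat -> int) a : a.+1 < m -> (x a < x a.+1)%R ->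
  inversions (fun i => if i == a then x a.+1 else if i == a.+1 then x a else x i)
  = (inversions x).+1.
Proof.
move=> am lt; pose p := Ordinal (ltnW am); pose q := Ordinal am.
pose s : 'I_m -> 'I_m := tperm p q.
set x' := (X in inversions X).
have x's (i : 'I_m) : x' i = x (s i).
  rewrite /x' /s; case: tpermP => [->|->|/eqP np /eqP nq] /=.
  - by rewrite eqxx.
  - by rewrite eqxx; case: eqP => //; lia.
  - by rewrite -!val_eqE /= in np nq; rewrite (negPf np) (negPf nq).
have sK : involutive (fun r : 'I_m * 'I_m => (s r.1, s r.2)).
  by move=> [i j] /=; rewrite /s !tpermK.
have sV i : (s i : nat) = tswap a i.
  rewrite /s /tswap; case: tpermP => [->|->|/eqP np /eqP nq] /=.
  - by rewrite eqxx.
  - by rewrite eqxx; case: eqP => //; lia.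
  - by rewrite -!val_eqE /= in np nq; rewrite (negPf np) (negPf nq).
have E1 : \sum_(r : 'I_m * 'I_m) ((r.1 < r.2) && (x' r.2 < x' r.1)%R) =
          (\sum_(r : 'I_m * 'I_m) ((r.1 < r.2) && (x r.2 < x r.1)%R)).+1.
  rewrite (reindex_inj (inv_inj sK)) /=.
  rewrite -[RHS]addn1 -(sum_pair_delta q p 1) -big_split /=.
  apply: eq_bigr => -[i j] _ /=; rewrite !x's /s !tpermK -/s !sV.
  exact: tswap_lt.
have E2 : \sum_(r : 'I_m * 'I_m) ((r.1 <= r.2) && (x' r.1 + x' r.2 < 0)%R) =
          \sum_(r : 'I_m * 'I_m) ((r.1 <= r.2) && (x r.1 + x r.2 < 0)%R).
  rewrite (reindex_inj (inv_inj sK)) /=.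
  apply: (@addIn (x a + x a.+1 < 0)%R).
  rewrite -{1}(sum_pair_delta p q (x a + x a.+1 < 0)%R).
  rewrite -{2}(sum_pair_delta q p (x a + x a.+1 < 0)%R) -!big_split /=.
  apply: eq_bigr => -[i j] _ /=; rewrite !x's /s !tpermK -/s !sV.
  exact: tswap_le.
by rewrite /inversions E1 E2 addSn.
Qed.

(** For a pair (0, j) with j > 0, negating [x 0] exchanges the inversion condition with the negative
    sum condition; only the diagonal pair (0, 0) adds one. *)
Lemma inversions_neg (x : nat -> int) : 0 < m -> (0 < x 0%N)%R ->
  inversions (fun i => if i == 0 then (- x 0%N)%R else x i) = (inversions x).+1.
Proof.
move=> m0 lt; pose o := Ordinal m0.
rewrite /inversions -!big_split /= -[RHS]addn1 -(sum_pair_delta o o 1) -big_split /=.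
apply: eq_bigr => -[i j] _ /=; rewrite -!val_eqE /=.
move: (i : nat) (j : nat) => {}i {}j.
by case: (eqVneq i 0) => [->|i0]; case: (eqVneq j 0) => [->|j0]; rewrite ?eqxx; lia.
Qed.

End Inversions.

Lemma inversionsS m (x : nat -> int) :
  (forall i, i < m -> (`|x i| <= m)%N) -> x m = m.+1%:Z ->
  inversions m.+1 x = inversions m x.
Proof.
move=> xs xm; rewrite /inversions.
have H (F : nat -> nat -> nat) : (forall i, i <= m -> F i m = 0) ->
   (forall i, i <= m -> F m i = 0) ->
   \sum_(p : 'I_m.+1 * 'I_m.+1) F p.1 p.2 = \sum_(p : 'I_m * 'I_m) F p.1 p.2.
  move=> F1 F2; rewrite -(pair_big xpredT xpredT (fun i j : 'I_m.+1 => F i j)) /=.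
  rewrite -(pair_big xpredT xpredT (fun i j : 'I_m => F i j)) /=.
  rewrite big_ord_recr /= [X in _ + X = _]big1 ?addn0.
    by apply: eq_bigr => i _; rewrite big_ord_recr /= F1 ?addn0 // ltnW.
  by move=> j _; apply: F2; rewrite -ltnS.
congr (_ + _).
  apply: (H (fun i j => nat_of_bool ((i < j) && (x j < x i)%R))) => i im; rewrite xm.
    have [->|ne] := eqVneq i m; first by rewrite xm; lia.
    by have := xs i; lia.
  lia.
apply: (H (fun i j => nat_of_bool ((i <= j) && (x i + x j < 0)%R))) => i im; rewrite xm.
  have [->|ne] := eqVneq i m; first by rewrite xm; lia.
  by have := xs i; lia.
by have [->|ne] := eqVneq i m; first rewrite xm; lia.
Qed.

Definition ninv m (w : signed_perm) : nat :=
  inversions m (fun i => sp_inv_fun w i.+1%:Z).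

Lemma sp_inv_fun0 (w : signed_perm) : sp_inv_fun w 0%R = 0%R.
Proof. exact: sp0 (sp_inv w). Qed.

Lemma sp_inv_funN (w : signed_perm) a : sp_inv_fun w (- a)%R = (- sp_inv_fun w a)%R.
Proof. exact: sp_odd (sp_inv w) a. Qed.

Lemma sp_inv_eq (u v : signed_perm) :
  (forall i : nat, 0 < i -> sp_inv_fun u i%:Z = sp_inv_fun v i%:Z) -> u = v.
Proof.
move=> H; have E : sp_inv u = sp_inv v by apply: sp_pos_eq.
apply: signed_permP => a; apply: (can_inj (sp_inv_funK u)).
have e : sp_inv_fun u (v a) = sp_inv_fun v (v a).
  by rewrite -[LHS]/(sp_fun (sp_inv u) (v a)) E.
by rewrite e !sp_funK.
Qed.

Lemma simple_fun_pos a v : simple_fun a.+1 v.+1%:Z =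
  (if v == a then a.+2 else if v == a.+1 then a.+1 else v.+1)%:Z.
Proof.
rewrite /simple_fun; case: (v =P a) => [->|?]; first by rewrite eqxx.
by case: (v =P a.+1) => ?; do 4 (try (case: (Posz v.+1 =P _) => ?)); lia.
Qed.

Lemma simpleK a (w : signed_perm) : (simple a * (simple a * w))%g = w.
Proof. by apply: signed_permP => x /=; rewrite simple_funK. Qed.

Lemma sp_inv_simple a (w : signed_perm) x :
  sp_inv_fun (simple a * w)%g x = sp_inv_fun w (simple_fun a x).
Proof. by []. Qed.

Lemma ascent_simple a (w : signed_perm) : ascent a (simple a * w)%g = ~~ ascent a w.
Proof.
case: a => [|a]; rewrite /ascent !sp_inv_simple.
  rewrite /simple_fun /= sp_inv_funN.
  have : sp_inv_fun w 1%:Z <> 0%R.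
    by rewrite -(sp_inv_fun0 w) => /(can_inj (sp_inv_funK w)).
  lia.
rewrite !simple_fun_pos !eqxx.
case: eqP => [|_]; first lia.
have : sp_inv_fun w a.+1%:Z <> sp_inv_fun w a.+2%:Z.
  by move/(can_inj (sp_inv_funK w)); lia.
lia.
Qed.

Lemma ninv_simple m a (w : signed_perm) : a < m -> ascent a w ->
  ninv m (simple a * w)%g = (ninv m w).+1.
Proof.
case: a => [|a] am asc; rewrite /ninv.
  rewrite -(@inversions_neg m (fun i => sp_inv_fun w i.+1%:Z)) //.
  congr inversions; apply/funext => -[|i] /=; last by [].
  by rewrite /simple_fun /= sp_inv_funN.
rewrite -(@inversions_swap m (fun i => sp_inv_fun w i.+1%:Z) a) //.
congr inversions; apply/funext => i; rewrite sp_inv_simple simple_fun_pos.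
by case: eqP => // _; case: eqP.
Qed.

Lemma ninv_simpleN m a (w : signed_perm) : a < m -> ~~ ascent a w ->
  ninv m w = (ninv m (simple a * w)%g).+1.
Proof.
by move=> am na; rewrite -{1}(simpleK a w) ninv_simple // ascent_simple.
Qed.

Lemma ninv1 m : ninv m 1%g = 0.
Proof.
rewrite /ninv /inversions !big1 // => -[i j] _ /=; first by lia.
by have := ltn_ord i; lia.
Qed.

Lemma WM m u v : W m u -> W m v -> W m (u * v)%g.
Proof. by move=> hu hv a am; rewrite /= hv // hu. Qed.

Lemma WV m u : W m u -> W m (u^-1)%g.
Proof.
by move=> hu a am; apply: (can_inj (sp_funK u)); rewrite /= sp_inv_funK hu.
Qed.

Lemma W_simple m a : a < m -> W m (simple a).
Proof.
move=> am x hx; case: a am => [|a] am; rewrite /= /simple_fun.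
  by case: eqP => //; lia.
by do 4 (case: eqP; first lia; move=> _).
Qed.

Lemma W_word m a : all (fun i => i < m) a -> W m (word_prod a).
Proof.
elim: a => [|i a IH]; rewrite /word_prod ?big_nil ?big_cons // => /andP[im am].
by apply: WM; [exact: W_simple | exact: IH].
Qed.

Lemma W_sub m m' w : m <= m' -> W m w -> W m' w.
Proof. by move=> mm hw a ha; apply: hw; apply: leq_ltn_trans ha. Qed.

Lemma W_inv m w a : W m w -> m < `|a|%N -> sp_inv_fun w a = a.
Proof. by move=> hw; apply: (WV hw). Qed.

Lemma W_inv_small m w a : W m w -> `|a|%N <= m -> (`|sp_inv_fun w a|%N <= m)%N.
Proof.
move=> hw am; rewrite leqNgt; apply/negP => H.
by have := W_inv hw H => /(can_inj (sp_inv_funK w)) e; move: H; rewrite e; lia.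
Qed.

Lemma ninv_sub m m' w : m <= m' -> W m w -> ninv m' w = ninv m w.
Proof.
move=> /subnK <- hw; elim: (m' - m) => // d IH; rewrite addSn -IH.
apply: inversionsS => [i im|]; last by rewrite (W_inv hw) //=; lia.
by apply: (@W_inv_small (d + m)); [apply: W_sub hw; lia | lia].
Qed.

(** The inverse is positive and strictly increasing on 1..m with values at most m: growth from the
    left bounds it below by the identity, and growth towards m bounds it above. *)
Lemma all_ascents m w : W m w -> (forall a, a < m -> ascent a w) -> w = 1%g.
Proof.
move=> hw asc; apply: sp_inv_eq => -[//|i] _ /=.
have lo j : j < m -> (j.+1%:Z <= sp_inv_fun w j.+1%:Z)%R.
  elim: j => [|j IH] jm; first by have := asc 0 jm; rewrite /ascent; lia.
  by have := asc j.+1 jm; have := IH (ltnW jm); rewrite /ascent; lia.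
have hi d : d < m -> (sp_inv_fun w (m - d)%:Z <= (m - d)%:Z)%R.
  elim: d => [|d IH] dm.
    by have := @W_inv_small m w m%:Z hw (leqnn _); rewrite subn0; lia.
  have := asc (m - d.+1) ltac:(lia); have := IH (ltnW dm); rewrite /ascent.
  have e : m - d = (m - d.+1).+1 by lia.
  have p : 0 < m - d.+1 by lia.
  by case: (m - d.+1) p e => // x _ ->; lia.
have [im|im] := ltnP i m; last by rewrite (W_inv hw) //=; lia.
have := lo i im; have := hi (m - i.+1); have -> : m - (m - i.+1) = i.+1 by lia.
lia.
Qed.

Lemma reduced_word_exists m w : W m w ->
  exists a, [/\ all (fun i => i < m) a, word_prod a = w & size a = ninv m w].
Proof.
have [d] := ubnP (ninv m w); elim: d w => // d IH w hd hw.
have [asc|] := boolP [forall a : 'I_m, ascent a w].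
  exists [::]; split=> //.
    rewrite /word_prod big_nil; apply/esym/(all_ascents hw) => a am.
    exact: (forallP asc (Ordinal am)).
  have -> : w = 1%g by apply: (all_ascents hw) => a am; exact: (forallP asc (Ordinal am)).
  by rewrite ninv1.
rewrite negb_forall => /existsP[a na].
have E := ninv_simpleN (ltn_ord a) na.
have [||b [b1 b2 b3]] := IH (simple a * w)%g; first by rewrite -ltnS -E.
  exact: WM (W_simple (ltn_ord a)) hw.
exists (val a :: b); split=> /=; first by rewrite ltn_ord.
  by rewrite /word_prod big_cons -/(word_prod b) b2 simpleK.
by rewrite b3 E.
Qed.

Lemma ninv_word m a : all (fun i => i < m) a -> ninv m (word_prod a) <= size a.
Proof.
elim: a => [|i a IH]; rewrite /word_prod ?big_nil ?ninv1 // big_cons => /andP[im am].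
rewrite -/(word_prod a) /=; have := IH am.
have [asc|nasc] := boolP (ascent i (word_prod a)).
  by rewrite ninv_simple.
by rewrite (ninv_simpleN im nasc); lia.
Qed.

Lemma sp_lengthE m w : W m w -> sp_length w = ninv m w.
Proof.
move=> hw; apply: xget_unique => /=.
  have [a [a1 a2 a3]] := reduced_word_exists hw; split; first by exists a.
  (* A competing word may use generators outside W_m; [m'] exceeds all of them, and the inversion
     number of [w] does not depend on the window. *)
  move=> b bw; pose m' := maxn m (\max_(i <- b) i).+1.
  rewrite -(@ninv_sub m m' w) ?leq_maxl // -bw; apply: ninv_word.
  apply/allP => i ib; rewrite leq_max ltnS; apply/orP; right.
  exact: (@leq_bigmax_seq _ b xpredT (fun i => i) i ib isT).
move=> l [[b b1 b2] H]; have [a [a1 a2 a3]] := reduced_word_exists hw.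
apply/eqP; rewrite eqn_leq -{1}a3 (H _ a2) /= -b2.
pose m' := maxn m (\max_(i <- b) i).+1.
rewrite -(@ninv_sub m m' w) ?leq_maxl // -b1; apply: ninv_word.
apply/allP => i ib; rewrite leq_max ltnS; apply/orP; right.
exact: (@leq_bigmax_seq _ b xpredT (fun i => i) i ib isT).
Qed.

Lemma reduced_wordP m a w : W m w ->
  reduced_word a w <-> word_prod a = w /\ size a = ninv m w.
Proof. by move=> hw; rewrite /reduced_word (sp_lengthE hw). Qed.

Local Close Scope group_scope.

Lemma simple_l i : 0 < i -> simple_fun i i%:Z = i.+1%:Z.
Proof. by case: i => // i _; rewrite simple_fun_pos eqxx. Qed.

Lemma simple_r i : 0 < i -> simple_fun i i.+1%:Z = i%:Z.
Proof. by case: i => // i _; rewrite simple_fun_pos eqxx; case: eqP => //; lia. Qed.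

Lemma simple_o i v : 0 < v -> v <> i -> v <> i.+1 -> simple_fun i v%:Z = v%:Z.
Proof.
case: v => // v _; case: i => [_ v0|i v1 v2]; first by rewrite /simple_fun /=; case: v v0.
by rewrite simple_fun_pos; case: eqP; [lia|]; case: eqP; lia.
Qed.

Lemma simple_0 : simple_fun 0 1%:Z = (- 1%:Z)%R.
Proof. by []. Qed.

Lemma sp_mulE (u v : signed_perm) x : (u * v)%g x = u (v x).
Proof. by []. Qed.

Lemma simpleE i x : simple i x = simple_fun i x.
Proof. by []. Qed.

Lemma simple_comm i j : i.+2 <= j -> (simple i * simple j = simple j * simple i)%g.
Proof.
move=> ij; apply: sp_pos_eq => v v0; rewrite !sp_mulE !simpleE.
have [->|vj] := eqVneq v j; first by rewrite simple_l ?(@simple_o i) ?simple_l; lia.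
have [->|vj'] := eqVneq v j.+1; first by rewrite simple_r ?(@simple_o i) ?simple_r; lia.
rewrite (@simple_o j v); try lia.
case: i ij => [|i] ij.
  have [->|v1] := eqVneq v 1; first by rewrite simple_0 simple_fun_odd simple_o; lia.
  by rewrite (@simple_o 0 v) ?(@simple_o j); lia.
have [->|vi] := eqVneq v i.+1; first by rewrite simple_l ?(@simple_o j); lia.
have [->|vi'] := eqVneq v i.+2; first by rewrite simple_r ?(@simple_o j); lia.
by rewrite (@simple_o i.+1 v) ?(@simple_o j); lia.
Qed.

Lemma simple_braid3 i :
  (simple i.+1 * simple i.+2 * simple i.+1 = simple i.+2 * simple i.+1 * simple i.+2)%g.
Proof.
apply: sp_pos_eq => v v0; rewrite !sp_mulE !simpleE.
have [->|v1] := eqVneq v i.+1.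
  by rewrite simple_l // simple_l // (@simple_o i.+1 i.+3) ?(@simple_o i.+2 i.+1) ?simple_l ?simple_l //; lia.
have [->|v2] := eqVneq v i.+2.
  by rewrite simple_r // (@simple_o i.+2 i.+1) ?simple_l ?(@simple_o i.+1 i.+3) ?simple_r //; lia.
have [->|v3] := eqVneq v i.+3.
  by rewrite (@simple_o i.+1 i.+3) ?simple_r ?(@simple_o i.+2 i.+1) ?simple_r //; lia.
by rewrite !(@simple_o i.+1 v, @simple_o i.+2 v); lia.
Qed.

Lemma simple_braid4 :
  (simple 0 * simple 1 * simple 0 * simple 1 =
   simple 1 * simple 0 * simple 1 * simple 0)%g.
Proof.
by apply: sp_pos_eq => -[//|[|[|v]]].
Qed.

(** * Matsumoto's theorem and the nilCoxeter coefficients *)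

Section ShortProducts.

Variables (R : pzRingType) (I : Type) (F : I -> R).

Local Open Scope ring_scope.

Lemma prod_word2 i j : \prod_(x <- [:: i; j]) F x = F i * F j.
Proof. by rewrite !big_cons big_nil mulr1. Qed.

Lemma prod_word3 i j l : \prod_(x <- [:: i; j; l]) F x = F i * F j * F l.
Proof. by rewrite big_cons prod_word2 mulrA. Qed.

Lemma prod_word4 i j l m : \prod_(x <- [:: i; j; l; m]) F x = F i * F j * F l * F m.
Proof. by rewrite big_cons prod_word3 !mulrA. Qed.

End ShortProducts.

Section Matsumoto.

Variables (n : nat) (R : comNzRingType).

Local Open Scope ring_scope.

Local Notation alg := {malg R[{fmonom 'I_n}]}.
Local Notation ideal := (@nilcox_ideal n R).

Definition mon (a : seq 'I_n) : alg := \prod_(i <- a) xi R i.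

Lemma mon_cons i a : mon (i :: a) = xi R i * mon a.
Proof. by rewrite /mon big_cons. Qed.

Lemma mon_cat a b : mon (a ++ b) = mon a * mon b.
Proof. by rewrite /mon big_cat. Qed.

Lemma ideal_mull p q : ideal q -> ideal (p * q).
Proof.
elim=> [|p' r q' hr|q1 q2 _ IH1 _ IH2]; first by rewrite mulr0; exact: Ideal_zero.
  by rewrite !mulrA; exact: Ideal_gen.
by rewrite mulrDr; exact: Ideal_add.
Qed.

Lemma ideal_mulr p q : ideal q -> ideal (q * p).
Proof.
elim=> [|p' r q' hr|q1 q2 _ IH1 _ IH2]; first by rewrite mul0r; exact: Ideal_zero.
  by rewrite -!mulrA mulrA; exact: Ideal_gen.
by rewrite mulrDl; exact: Ideal_add.
Qed.

Lemma ideal_scale c q : ideal q -> ideal (c *: q).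
Proof. by move=> hq; rewrite -mul_malgC; apply: ideal_mull. Qed.

Lemma ideal_opp q : ideal q -> ideal (- q).
Proof. by move=> hq; rewrite -mulN1r; apply: ideal_mull. Qed.

Lemma ideal_rel r : nilcox_relator r -> ideal r.
Proof. by move=> hr; rewrite -[r]mul1r -[1 * r]mulr1; exact: Ideal_gen. Qed.

Definition eqv (p q : alg) := ideal (p - q).

Lemma eqv_refl p : eqv p p. Proof. by rewrite /eqv subrr; exact: Ideal_zero. Qed.

Lemma eqv_sym p q : eqv p q -> eqv q p.
Proof. by rewrite /eqv -[q - p]opprB; apply: ideal_opp. Qed.

Lemma eqv_trans q p r : eqv p q -> eqv q r -> eqv p r.
Proof. by move=> h1 h2; rewrite /eqv -(subrKA q p (- r)); exact: Ideal_add. Qed.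

Lemma eqv_mull p q r : eqv q r -> eqv (p * q) (p * r).
Proof. by rewrite /eqv -mulrBr; apply: ideal_mull. Qed.

Lemma eqv_mulr p q r : eqv q r -> eqv (q * p) (r * p).
Proof. by rewrite /eqv -mulrBl; apply: ideal_mulr. Qed.

Lemma eqv_ideal p q : eqv p q -> ideal q -> ideal p.
Proof. by move=> h hq; rewrite -(subrK q p); exact: Ideal_add. Qed.

Definition rw (a : seq 'I_n) : signed_perm := word_prod (map val a).

Lemma rw_cons i a : rw (i :: a) = (simple i * rw a)%g.
Proof. by rewrite /rw /word_prod /= big_cons. Qed.

Lemma rw_cat a b : rw (a ++ b) = (rw a * rw b)%g.
Proof. by rewrite /rw /word_prod map_cat big_cat. Qed.

Lemma W_rw a : W n (rw a).
Proof. by apply: W_word; rewrite all_map; apply/allP => i _ /=. Qed.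

Definition red a := ninv n (rw a) == size a.

Lemma ninv_rw a : (ninv n (rw a) <= size a)%N.
Proof.
rewrite -(size_map val); apply: ninv_word.
by rewrite all_map; apply/allP => i _ /=.
Qed.

Lemma red_cons i a : red (i :: a) = red a && ascent i (rw a).
Proof.
rewrite /red rw_cons /=; have := ninv_rw a.
have [asc|nasc] := boolP (ascent i (rw a)).
  by rewrite ninv_simple // eqSS andbT.
have := ninv_simpleN (ltn_ord i) nasc; rewrite andbF.
by move=> -> h; apply/negP => /eqP e; move: h; rewrite e; lia.
Qed.

Lemma red_exists w : W n w -> exists2 a, red a & rw a = w.
Proof.
move=> /reduced_word_exists[b [b1 b2 b3]].
have [a E] : exists a : seq 'I_n, map val a = b.
  elim: b b1 {b2 b3} => [|i b IH] /=; first by exists [::].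
  by case/andP=> im /IH[a <-]; exists (Ordinal im :: a).
exists a; last by rewrite /rw E.
by rewrite /red /rw E b2 -b3 -E size_map.
Qed.

Fixpoint descents_along (p : seq 'I_n) (w : signed_perm) : bool :=
  if p is i :: p' then ~~ ascent i w && descents_along p' (simple i * w)%g
  else true.

(** Each letter of [p] is a left descent when its turn comes, so peeling it off lowers the length by
    one; any reduced word of what remains completes [p]. *)
Lemma strip_word p w : W n w -> descents_along p w ->
  exists2 c, red (p ++ c) & rw (p ++ c) = w.
Proof.
elim: p w => [|i p IH] w hw; first by move=> _; apply: red_exists.
move=> /= /andP[nasc hp].
have [|c c1 c2] := IH (simple i * w)%g _ hp.
  by apply: WM => //; apply: W_simple.
exists c; last by rewrite rw_cons c2 simpleK.
by rewrite red_cons c1 c2 ascent_simple.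
Qed.

Lemma descents_prefix p c : red (p ++ c) -> descents_along p (rw (p ++ c)).
Proof.
elim: p => //= x s IH; rewrite red_cons => /andP[r1 r2].
by rewrite rw_cons ascent_simple r2 simpleK IH.
Qed.

(* Two reduced words starting with [i] and [j] are compared through the
   longest element of the dihedral group generated by [i] and [j]. *)
Lemma dihedral_words (i j : 'I_n) w : W n w -> i != j ->
    ~~ ascent i w -> ~~ ascent j w ->
  exists p q : seq 'I_n, [/\ descents_along (i :: p) w, rw (i :: p) = rw (j :: q),
    size p = size q & eqv (mon (i :: p)) (mon (j :: q))].
Proof.
wlog ij : i j / (i < j)%N => [H hw ne hi hj|hw _ hi hj].
  have [lt|lt|e] := ltngtP i j; first exact: H.
    have [|p [q [h1 h2 h3 h4]]] := H j i lt hw _ hj hi; first by rewrite eq_sym.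
    have [c c1 c2] := strip_word hw h1.
    exists q, p; split=> //; last exact: eqv_sym.
    rewrite -c2 rw_cat h2 -rw_cat; apply: descents_prefix.
    by rewrite /red rw_cat -h2 -rw_cat (eqP c1) !size_cat /= h3.
  by case/eqP: ne; apply: val_inj.
have [ij2|] := leqP i.+2 j.
  exists [:: j], [:: i]; split=> //=.
  - rewrite hi /= andbT; case: (val j) ij2 hj => // j' ij2 hj.
    by move: hj; rewrite /ascent !sp_inv_simple !simple_o //; lia.
  - by rewrite !rw_cons !mulgA simple_comm.
  - by rewrite /eqv /mon !prod_word2; apply: ideal_rel; constructor 2.
move=> ij2; have jE : (j : nat) = i.+1 by apply/eqP; rewrite eqn_leq ij andbT.
have [i0|ipos] := posnP i.
  exists [:: j; i; j], [:: i; j; i]; split=> //=.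
  - move: hi hj; rewrite jE i0 /ascent /=.
    rewrite !sp_inv_funN; lia.
  - by rewrite !rw_cons jE i0 !mulgA simple_braid4.
  - rewrite /eqv /mon !prod_word4; apply: ideal_rel.
    by constructor 4; rewrite ?jE ?i0.
exists [:: j; i], [:: i; j]; split=> //=.
- have [i' iE] : exists i', (i : nat) = i'.+1 by case: (val i) ipos => // i' _; exists i'.
  move: hi hj; rewrite jE iE /ascent !sp_inv_simple.
  rewrite !simple_l ?simple_r // (@simple_o i'.+1 i'.+3) ?(@simple_o i'.+2 i'.+1) ?simple_l ?simple_r //; lia.
- have [i' iE] : exists i', (i : nat) = i'.+1 by case: (val i) ipos => // i' _; exists i'.
  by rewrite !rw_cons jE iE !mulgA simple_braid3.
by rewrite /eqv /mon !prod_word3; apply: ideal_rel; constructor 3.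
Qed.

(** Words with a common first letter are settled by induction. Otherwise two intermediate words
    [i :: p ++ c] and [j :: q ++ c], differing by one braid relation, share their first letters with
    the two given words. *)
Lemma matsumoto a b : red a -> red b -> rw a = rw b -> eqv (mon a) (mon b).
Proof.
have [N] := ubnP (size a); elim: N a b => // N IH [|i a] b sa ra rb E.
  have := eqP rb; rewrite -E (eqP ra) /=; case: b {rb E} => // _.
  exact: eqv_refl.
have sb : size b = (size a).+1 by have := eqP rb; rewrite -E (eqP ra).
case: b sb rb E => // j b [sb] rb E.
have [ij|ij] := eqVneq i j.
  rewrite -ij in rb E *; rewrite !mon_cons; apply: eqv_mull; apply: IH => //.
  - by move: ra; rewrite red_cons => /andP[].
  - by move: rb; rewrite red_cons => /andP[].
  - by move: E; rewrite !rw_cons => /mulgI.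
have hw := W_rw (i :: a).
have di : ~~ ascent i (rw (i :: a)).
  by move: ra; rewrite red_cons rw_cons ascent_simple => /andP[_ ->].
have dj : ~~ ascent j (rw (i :: a)).
  by move: rb; rewrite E red_cons rw_cons ascent_simple => /andP[_ ->].
have [p [q [h1 h2 h3 h4]]] := dihedral_words hw ij di dj.
have [c c1 c2] := strip_word hw h1.
have c1' : red ((j :: q) ++ c).
  by rewrite /red rw_cat -h2 -rw_cat (eqP c1) !size_cat /= h3.
have step x s t : (size s < N)%N -> red (x :: s) -> red (x :: t) ->
    rw (x :: s) = rw (x :: t) -> eqv (mon (x :: s)) (mon (x :: t)).
  move=> hs; rewrite !red_cons => /andP[rs _] /andP[rt _].
  rewrite !rw_cons => /mulgI e; rewrite !mon_cons; apply: eqv_mull.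
  exact: IH.
apply: (@eqv_trans (mon ((i :: p) ++ c))).
  by apply: step => //; rewrite -c2.
apply: (@eqv_trans (mon ((j :: q) ++ c))).
  by rewrite !mon_cat; apply: eqv_mulr.
apply/eqv_sym; apply: step => //; first by rewrite sb.
by rewrite -E -c2 -cat_cons !rw_cat h2.
Qed.

(** When the reduced word [a] becomes non-reduced on adding [i], the letter [i] is a descent, so [a]
    is equivalent to a reduced word starting with [i] and the square of xi_i appears. *)
Lemma mon_nonred a : ~~ red a -> ideal (mon a).
Proof.
elim: a => [|i a IH]; first by rewrite /red /rw /word_prod big_nil ninv1.
rewrite red_cons mon_cons negb_and; have [ra /= nasc|/IH h _] := boolP (red a).
  have [|c c1 c2] := @strip_word [:: i] _ (W_rw a).
    by rewrite /= nasc.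
  apply: (@eqv_ideal _ (xi R i * mon (i :: c))).
    by apply: eqv_mull; apply: matsumoto.
  rewrite mon_cons mulrA; apply: ideal_mulr; apply: ideal_rel.
  by constructor.
exact: ideal_mull.
Qed.

End Matsumoto.

Local Open Scope ring_scope.

Lemma W_finite n : finite_set (W n).
Proof.
pose F := {ffun 'I_n.+1 -> 'I_(n.*2.+1)}.
pose h (w : signed_perm) : F := [ffun i : 'I_n.+1 => inord (absz (w (val i)%:Z + n%:Z))].
pose g (f : F) : signed_perm := xget 1%g [set w | W n w /\ h w = f]%classic.
suff sub : (W n `<=` g @` setT)%classic.
  by apply: sub_finite_set sub _; apply: finite_image; apply: finite_finset.
move=> w hw; exists (h w) => //; rewrite /g; apply: xget_unique => // v [hv E].
apply: sp_pos_eq => i i0; have [ni|ni] := ltnP n i.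
  by rewrite hv ?hw.
have small (u : signed_perm) : W n u -> (`|u i%:Z|%N <= n)%N.
  move=> hu; rewrite leqNgt; apply/negP => H.
  by have := hu _ H => /(can_inj (sp_funK u)) e; move: H; rewrite e /=; lia.
have sv := small _ hv; have sw := small _ hw.
have := congr1 (fun f : F => val (f (inord i))) E; rewrite /= !ffunE /=.
by rewrite !inordK //; lia.
Qed.

Lemma fsbig_only (T : choiceType) (V : nmodType) (D : set T) (F : T -> V) w :
  finite_set D -> D w -> (forall v, v <> w -> F v = 0) -> \sum_(v \in D) F v = F w.
Proof.
move=> fD Dw F0; rewrite (fsbigD1 w) //= fsbig1 ?addr0 // => v [_ vw].
exact: F0.
Qed.

Section Coefficient.

Variables (n : nat) (R : comNzRingType).

Local Notation alg := {malg R[{fmonom 'I_n}]}.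
Local Notation ideal := (@nilcox_ideal n R).

Lemma monE (a : seq 'I_n) : mon R a = << FMonom a >> :> alg.
Proof.
elim: a => [|i a IH].
  by rewrite /mon big_nil -mpolyC1E -[FMonom [::]]fmoneE.
rewrite mon_cons IH /xi malgM_def fgmulUU mulr1; congr (<< 1 *g _ >>).
by rewrite fmuE -[LHS]/(fmmul _ _) fmmulE.
Qed.

Lemma malg_word_ind (P : alg -> Prop) : P 0 ->
  (forall p q, P p -> P q -> P (p + q)) ->
  (forall c a, P (c *: mon R a)) -> forall p, P p.
Proof.
move=> P0 PD Pm p; rewrite [p]monalgE; elim/big_ind: _ => // k _.
rewrite -[X in P X](_ : p@_k *: mon R (fmonom_val k) = _) //.
apply/malgP => m; rewrite mcoeffZ monE fmK mcoeffU1 mcoeffU.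
by case: eqP; rewrite ?mulr1 ?mulr0.
Qed.

Lemma xi_permE w : W n w ->
  exists a, [/\ red a, rw a = w & xi_perm n R w = mon R a].
Proof.
move=> hw; have [a ra aw] := red_exists hw.
rewrite /xi_perm; case: xgetP => [b _ /= rb|].
  exists b; split=> //; have [h1 h2] := (reduced_wordP _ hw).1 rb.
    by rewrite /red /rw h1 -h2 size_map.
  exact: h1.
move/(_ a); case; apply/(reduced_wordP _ hw); split=> //.
by rewrite size_map -(eqP ra) aw.
Qed.

Lemma nilcox_span (p : alg) : exists c : signed_perm -> R,
  ideal (p - \sum_(v \in W n) c v *: xi_perm n R v).
Proof.
elim/malg_word_ind: p => [|p q [c hc] [d hd]|x a].
- exists (fun=> 0); rewrite fsbig1 ?subrr; first exact: Ideal_zero.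
  by move=> v _; rewrite scale0r.
- exists (fun v => c v + d v).
  have -> : \sum_(v \in W n) (c v + d v) *: xi_perm n R v =
     \sum_(v \in W n) c v *: xi_perm n R v + \sum_(v \in W n) d v *: xi_perm n R v.
    rewrite -fsbig_split; last exact: W_finite.
    by apply: eq_fsbigr => v _; rewrite scalerDl.
  rewrite opprD addrACA; exact: (Ideal_add hc hd).
have [ra|na] := boolP (red a); last first.
  exists (fun=> 0); rewrite fsbig1 ?subr0; last by move=> v _; rewrite scale0r.
  exact/ideal_scale/mon_nonred.
exists (fun v => if v == rw a then x else 0).
have wa := W_rw a; have [b [rb bw bE]] := xi_permE wa.
rewrite (fsbig_only (W_finite n) wa) => [|v /eqP/negPf ->]; last by rewrite scale0r.
rewrite eqxx -(scalerBr x (mon R a) (xi_perm n R (rw a))).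
apply: ideal_scale.
by rewrite bE; apply: matsumoto.
Qed.

(** An expansion exists by [nilcox_span]; applying [phi] to whichever one [xget] selects leaves only
    its coefficient at [w]. *)
Lemma nilcox_coefE (phi : {additive alg -> R}) w (p : alg) : W n w ->
  (forall c q, phi (c *: q) = c * phi q) ->
  (forall q, ideal q -> phi q = 0) ->
  (forall v, W n v -> phi (xi_perm n R v) = (v == w)%:R) ->
  nilcox_coef p w = phi p.
Proof.
move=> hw phiZ phi0 phiE; rewrite /nilcox_coef.
case: xgetP => [x _ /= [c hc ->]|]; last first.
  have [c hc] := nilcox_span p; move/(_ (c w)); case.
  by exists c.
have -> : phi p = phi (\sum_(v \in W n) c v *: xi_perm n R v).
  by apply/eqP; rewrite -subr_eq0 -raddfB phi0.
rewrite fsbig_finite /=; last exact: W_finite.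
rewrite raddf_sum big_seq.
rewrite (eq_bigr (fun v => if v == w then c v else 0)); last first.
  move=> v; rewrite in_fset_set; last exact: W_finite.
  by rewrite inE => hv; rewrite phiZ phiE //; case: eqP; rewrite ?mulr1 ?mulr0.
rewrite -big_seq (big_fsetD1 w) /=; last first.
  by rewrite in_fset_set ?inE //; exact: W_finite.
rewrite eqxx big_seq big1 ?addr0 // => v; rewrite !inE => /andP[/negPf -> _] //.
Qed.

End Coefficient.

Local Close Scope ring_scope.

(** * The action of the nilCoxeter algebra on words *)

Definition setw0 (f : nat -> nat) (v : nat) : nat := if v == 1 then 0 else f v.

Definition updw a (f : nat -> nat) : nat -> nat :=
  if a is 0 then setw0 f else swapw a f.

Definition stepf a (f : nat -> nat) : option (nat -> nat) :=
  if ascw a f then Some (updw a f) else None.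

Lemma swapw_l a f : swapw a f a = f a.+1.
Proof. by rewrite /swapw eqxx. Qed.

Lemma swapw_r a f : swapw a f a.+1 = f a.
Proof. by rewrite /swapw eqxx; case: eqP => //; lia. Qed.

Lemma swapw_o a f v : v != a -> v != a.+1 -> swapw a f v = f v.
Proof. by rewrite /swapw => /negPf-> /negPf->. Qed.

Lemma stepf_square a f : obind (stepf a) (stepf a f) = None.
Proof.
rewrite /stepf; case: ifP => //= h; rewrite ifF //.
case: a h => [|a] /= h; first by rewrite /setw0 /=.
by rewrite swapw_l swapw_r; lia.
Qed.

Lemma updw_o a f v : v != a -> v != a.+1 -> updw a f v = f v.
Proof.
case: a => [|a] h1 h2; last exact: swapw_o.
by rewrite /= /setw0 (negPf h2).
Qed.

Lemma updw_local a f h v : h a = f a -> h a.+1 = f a.+1 ->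
  (v == a) || (v == a.+1) -> updw a h v = updw a f v.
Proof.
move=> e1 e2; case: a e1 e2 => [|a] e1 e2 /=.
  by rewrite /setw0; case: (v =P 1) => //= ne; case: (v =P 0) => [->|] //; lia.
by rewrite /swapw; case: eqP => // _ /= ->.
Qed.

Lemma ascw_local a f h : h a = f a -> h a.+1 = f a.+1 -> ascw a h = ascw a f.
Proof. by case: a => [|a] /= e1 e2; rewrite ?e1 e2. Qed.

Lemma stepf_comm a b f : a.+2 <= b ->
  obind (stepf a) (stepf b f) = obind (stepf b) (stepf a f).
Proof.
move=> ab.
have Ea : ascw a (updw b f) = ascw a f by apply: ascw_local; apply: updw_o; lia.
have Eb : ascw b (updw a f) = ascw b f by apply: ascw_local; apply: updw_o; lia.
rewrite /stepf; case hb: (ascw b f); case ha: (ascw a f);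
  rewrite /obind /oapp ?Ea ?Eb ?ha ?hb //.
congr Some; apply/funext => v.
have [va|va] := boolP ((v == a) || (v == a.+1)).
  rewrite (@updw_o b (updw a f) v); try lia.
  by apply: updw_local => //; apply: updw_o; lia.
have [vb|vb] := boolP ((v == b) || (v == b.+1)).
  rewrite (@updw_o a (updw b f) v); try lia.
  by apply/esym; apply: updw_local => //; apply: updw_o; lia.
by rewrite !updw_o //; lia.
Qed.

(** Both sides are defined exactly when the three letters strictly increase, and both then reverse
    them. *)
Lemma stepf_braid3 a f :
  obind (stepf a.+1) (obind (stepf a.+2) (stepf a.+1 f)) =
  obind (stepf a.+2) (obind (stepf a.+1) (stepf a.+2 f)).
Proof.
have s1 (h : nat -> nat) : swapw a.+1 h a.+3 = h a.+3 by rewrite swapw_o //; lia.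
have s2 (h : nat -> nat) : swapw a.+2 h a.+1 = h a.+1 by rewrite swapw_o //; lia.
set p := a.+1; set q := a.+2.
have c1 h : ascw p h = (h a.+1 < h a.+2) by [].
have c2 h : ascw q h = (h a.+2 < h a.+3) by [].
rewrite /stepf !c1 !c2; case: ifP => h1; case: ifP => h2;
  rewrite /obind /oapp ?c1 ?c2 /= ?swapw_l ?swapw_r ?s1 ?s2 ?h1 ?h2 //;
  case: ifP => h3; rewrite /= ?c1 ?c2 ?swapw_l ?swapw_r ?s1 ?s2 ?swapw_l ?swapw_r ?h1 ?h2 //.
congr Some; apply/funext => v; rewrite /p /q.
have [->|n1] := eqVneq v a.+1; first by rewrite !(swapw_l, swapw_r, s1, s2).
have [->|n2] := eqVneq v a.+2; first by rewrite !(swapw_l, swapw_r, s1, s2).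
have [->|n3] := eqVneq v a.+3; first by rewrite !(swapw_l, swapw_r, s1, s2).
by rewrite !swapw_o //; lia.
Qed.

(** Both sides are undefined. On the left the second use of s_0 needs [f 1 = 2], while the first
    step required [f 1] to be smaller than [f 2]; on the right the last step would exchange two
    letters 0. *)
Lemma stepf_braid4 f :
  obind (stepf 0) (obind (stepf 1) (obind (stepf 0) (stepf 1 f))) =
  obind (stepf 1) (obind (stepf 0) (obind (stepf 1) (stepf 0 f))).
Proof.
have -> : obind (stepf 0) (obind (stepf 1) (obind (stepf 0) (stepf 1 f))) = None.
  rewrite /stepf /=; case: ifP => h1 //=; case: ifP => h2 //=; case: ifP => h3 //=.
  case: ifP => // h4; move: h1 h2 h4; rewrite /setw0 /swapw /= => h1 /eqP h2 /eqP h4.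
  lia.
rewrite /stepf /=; case: ifP => h1 //=; case: ifP => h2 //=.
by case: ifP.
Qed.

(** * Words of length n *)

Section Words.

Variables (k n : nat).

Definition word := {ffun 'I_n -> 'I_3}.

(* The letter at [v] in the word of the empty partition. *)
Definition dflt v := if v is 0 then 2 else if v <= k then 1 else 2.

Definition ext (t : word) (v : nat) : nat :=
  if v is v'.+1 then (if insub v' is Some i then val (t i) else dflt v) else 2.

Definition mkw (f : nat -> nat) : word := [ffun i : 'I_n => inord (f i.+1)].

(** The image of [ext]: such a word is determined by its letters at 1..n, as is the word of lambda
    when w_lambda lies in W_n. *)
Definition good (f : nat -> nat) : Prop :=
  (forall v, f v <= 2) /\ (forall v, ~~ (0 < v <= n) -> f v = dflt v).

Lemma ext_good t : good (ext t).
Proof.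
split=> [[|v]|[|v]] //=.
  case: insubP => [i _ _|_]; first by rewrite -ltnS.
  by case: ifP.
by rewrite /= => h; rewrite insubF //; apply/negbTE.
Qed.

Lemma extK f : good f -> ext (mkw f) = f.
Proof.
move=> [g1 g2]; apply/funext => -[|v]; first by rewrite g2.
rewrite /ext; case: insubP => [i _ <-|h]; first by rewrite ffunE /= inordK // ltnS.
by rewrite g2.
Qed.

Lemma mkwK t : mkw (ext t) = t.
Proof.
apply/ffunP => i; rewrite ffunE /ext insubT // => h.
by apply: val_inj; rewrite /= inordK // (_ : Sub _ _ = i) //; apply: val_inj.
Qed.

Lemma ext_inj : injective ext.
Proof. exact: can_inj mkwK. Qed.

Lemma updw_good a f : a < n -> good f -> good (updw a f).
Proof.
move=> an [g1 g2]; split=> v.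
  by case: a an => [|a] _ /=; rewrite ?/setw0 ?/swapw; case: ifP => // _; case: ifP.
move=> h; case: a an => [|a] an /=.
  rewrite /setw0; case: eqP => [e|_]; [|exact: g2]; lia.
by rewrite swapw_o ?g2 //; lia.
Qed.

Definition step (a : nat) (t : word) : option word := omap mkw (stepf a (ext t)).

Definition wact (p : seq 'I_n) (t : word) : option word :=
  foldr (fun i o => obind (step (val i)) o) (Some t) p.

Lemma act_cat p q t : wact (p ++ q) t = obind (wact p) (wact q t).
Proof.
rewrite /wact foldr_cat; case: (foldr _ (Some t) q) => [t1|] //=.
by elim: p => //= i p ->.
Qed.

Lemma stepP a t t' : a < n -> (step a t = Some t' <-> stepw a (ext t) (ext t')).
Proof.
move=> an; rewrite /step /stepf; split.
  case: ifP => // asc [<-]; rewrite extK; last exact/updw_good/ext_good.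
  case: a an asc => [|a] an asc; last by split.
  split; first exact/eqP.
    by rewrite /= /setw0.
  by move=> v v1; rewrite /= /setw0; case: eqP => //; lia.
move=> H; have asc : ascw a (ext t).
  by case: a an H => [|a] an; [case=> h1 _ _; exact/eqP | case].
rewrite asc; congr Some; apply: ext_inj; rewrite extK; last exact/updw_good/ext_good.
apply/funext => v; case: a an H {asc} => [|a] an.
  case=> h1 h2 h3; case: v => [|[|v]] //; exact: esym (h3 v.+2 isT).
by case=> _ H; case: v => [//|v]; apply/esym/H.
Qed.

Lemma actE (p : seq 'I_n) t : wact p t =
    omap mkw (foldr (fun i o => obind (stepf (val i)) o) (Some (ext t)) p) /\
  (forall f, foldr (fun i o => obind (stepf (val i)) o) (Some (ext t)) p = Some f -> good f).
Proof.
elim: p => [|i p [IH1 IH2]] /=; first by rewrite mkwK; split=> // f [<-]; apply: ext_good.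
rewrite IH1; case E: foldr IH2 => [f|] //= /(_ f erefl) gf; split.
  by rewrite /step extK.
by move=> g; rewrite /stepf; case: ifP => // _ [<-]; apply: updw_good.
Qed.

Lemma act_square (i : 'I_n) t : wact [:: i; i] t = None.
Proof. by rewrite (actE _ t).1 /= stepf_square. Qed.

Lemma act_comm (i j : 'I_n) t : i.+2 <= j -> wact [:: i; j] t = wact [:: j; i] t.
Proof. by move=> ij; rewrite !(actE _ t).1 /= stepf_comm. Qed.

Lemma act_braid3 (i j : 'I_n) t : 0 < i -> j = i.+1 :> nat ->
  wact [:: i; j; i] t = wact [:: j; i; j] t.
Proof.
move=> i0 ji; rewrite !(actE _ t).1 /= ji.
by case: (val i) i0 => // a _; rewrite stepf_braid3.
Qed.

Lemma act_braid4 (i j : 'I_n) t : i = 0 :> nat -> j = 1 :> nat ->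
  wact [:: i; j; i; j] t = wact [:: j; i; j; i] t.
Proof. by move=> i0 j1; rewrite !(actE _ t).1 /= i0 j1 stepf_braid4. Qed.

End Words.

(** * Steps on words and left multiplication of k-Grassmannian elements *)

Lemma Nc_tw k lam v : kstrict k lam ->
  Nc k lam v = Nc k lam v.+1 + (tw k lam v.+1 == 0).
Proof. by move=> kl; case: (tw_cases kl v) => -[-> -> _] /=; lia. Qed.

Lemma Lc_tw k lam v : kstrict k lam ->
  Lc k lam v.+1 = Lc k lam v + (tw k lam v.+1 == 1).
Proof. by move=> kl; case: (tw_cases kl v) => -[-> _ ->] /=; lia. Qed.

Lemma Nc_eq_above k lam mu v : kstrict k lam -> kstrict k mu ->
  (forall x, v < x -> tw k lam x = tw k mu x) -> Nc k lam v = Nc k mu v.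
Proof.
move=> kl km; have [V1 h1] := eventually_tail kl; have [V2 h2] := eventually_tail km.
suff H d : forall v, V1 + V2 <= v + d -> (forall x, v < x -> tw k lam x = tw k mu x) ->
    Nc k lam v = Nc k mu v.
  by apply: (H (V1 + V2)); lia.
elim: d => [|d IH] {}v hv E; first by rewrite (h1 v _).1 ?(h2 v _).1; lia.
rewrite (Nc_tw v kl) (Nc_tw v km) E // IH //; first by lia.
by move=> x hx; apply: E; apply: ltnW.
Qed.

Lemma Lc_eq_below k lam mu v : kstrict k lam -> kstrict k mu ->
  (forall x, 0 < x <= v -> tw k lam x = tw k mu x) -> Lc k lam v = Lc k mu v.
Proof.
move=> kl km; elim: v => [|v IH] E; first by rewrite !Lc0.
rewrite (Lc_tw v kl) (Lc_tw v km) IH ?E //; first by lia.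
by move=> x hx; apply: E; lia.
Qed.

(** The two exchanged letters lie on the same side of every cut other than [a]. For [a = 0] the
    changed letter is at position 1, beyond the cut 0, and neither 2 nor 0 is counted by [Lc]. *)
Lemma stepw_counts k rho nu a : kstrict k rho -> kstrict k nu ->
    stepw a (tw k rho) (tw k nu) ->
  (forall v, v != a -> Nc k nu v = Nc k rho v) /\
  (forall v, v != a -> Lc k nu v = Lc k rho v).
Proof.
move=> kr kn; case: a => [|a] /=.
  move=> [t1 t2 E]; split=> -[//|v] _.
    by apply: Nc_eq_above => // x hx; apply: E; lia.
  elim: v => [|v IH]; last by rewrite (Lc_tw _ kn) (Lc_tw _ kr) IH E.
  by rewrite (Lc_tw _ kn) (Lc_tw _ kr) t1 t2 !Lc0.
move=> [lt E].
have Na v : a.+1 < v -> Nc k nu v = Nc k rho v.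
  by move=> av; apply: Nc_eq_above => // x hx; rewrite E ?swapw_o //; lia.
have Ea : tw k nu a.+1 = tw k rho a.+2 by rewrite E // swapw_l.
have Ea' : tw k nu a.+2 = tw k rho a.+1 by rewrite E // swapw_r.
have N1 : Nc k nu a = Nc k rho a.
  rewrite (Nc_tw a kn) (Nc_tw a.+1 kn) (Nc_tw a kr) (Nc_tw a.+1 kr).
  by rewrite Na // Ea Ea'; lia.
have La v : v <= a -> Lc k nu v = Lc k rho v.
  by move=> va; apply: Lc_eq_below => // x hx; rewrite E ?swapw_o //; lia.
have L1 : Lc k nu a.+2 = Lc k rho a.+2.
  rewrite (Lc_tw a.+1 kn) (Lc_tw a kn) (Lc_tw a.+1 kr) (Lc_tw a kr).
  by rewrite La // Ea Ea'; lia.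
split=> v va.
  have [lt'|le] := ltnP a.+1 v; first exact: Na.
  have {}va : v <= a by lia.
  rewrite -(subKn va); elim: (a - v) (leq_subr v a) => [|d IH] hd; first by rewrite subn0.
  have e : (a - d.+1).+1 = a - d by lia.
  rewrite (Nc_tw _ kn) (Nc_tw _ kr) e IH; last lia.
  by rewrite E ?swapw_o //; lia.
have [le|lt'] := leqP v a; first exact: La.
have {}va : a.+2 <= v by lia.
rewrite -(subnK va); elim: (v - a.+2) => [|d IH]; first by rewrite add0n.
rewrite addSn (Lc_tw _ kn) (Lc_tw _ kr) IH E ?swapw_o //; lia.
Qed.

Lemma uinvE k lam v : kstrict k lam -> uinv k lam v.+1 =
  (if tw k lam v.+1 == 0 then - (k + Nc k lam v)%:Z
   else if tw k lam v.+1 == 1 then (Lc k lam v.+1)%:Z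
   else (k + v.+1 + Nc k lam v.+1)%:Z - (Lc k lam v.+1)%:Z)%R.
Proof.
move=> kl; rewrite /uinv /=; have := Lc_lev kl v.+1.
by case: (tw_cases kl v) => -[-> _ _] //= h; lia.
Qed.

Lemma kgrass_step k rho nu a : kstrict k rho -> kstrict k nu ->
    stepw a (tw k rho) (tw k nu) ->
  kgrass k nu = (simple a * kgrass k rho)%g.
Proof.
move=> kr kn st; have [EN EL] := stepw_counts kr kn st.
apply: sp_inv_eq => -[//|v] _; rewrite sp_inv_simple.
case: a st EN EL => [|a] st EN EL.
  case: st => t1 t2 E.
  have [->|v0] := eqVneq v 0.
    rewrite simple_0 kgrass_inv // kgrass_invN // !uinvE // t1 t2 /=.
    have l1 := Lc_tw 0 kr; rewrite Lc0 // t1 in l1.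
    have := EN 1 isT; have := Nc_tw 0 kn; have := Nc_tw 0 kr; rewrite t1 t2 /=; lia.
  rewrite simple_o // ?kgrass_inv // ?uinvE //; try lia.
  rewrite E; last lia.
  by rewrite !EN ?EL //; lia.
case: st => lt E.
have Ea : tw k nu a.+1 = tw k rho a.+2 by rewrite E // swapw_l.
have Ea' : tw k nu a.+2 = tw k rho a.+1 by rewrite E // swapw_r.
have ra := tw_le2 k rho a.+1; have ra' := tw_le2 k rho a.+2.
have N1 := Nc_tw a kr; have N2 := Nc_tw a.+1 kr.
have N1' := Nc_tw a kn; have N2' := Nc_tw a.+1 kn.
have L1 := Lc_tw a kr; have L2 := Lc_tw a.+1 kr.
have L1' := Lc_tw a kn; have L2' := Lc_tw a.+1 kn.
have e1 := EN a; have e2 := EN a.+2; have e3 := EL a; have e4 := EL a.+2.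
rewrite Ea in N1' L1'; rewrite Ea' in N2' L2'.
have [->|va] := eqVneq v a.
  rewrite simple_l // !kgrass_inv // !uinvE // Ea.
  by case: (tw k rho a.+2) ra' lt N2 N1' L2 L1' => [|[|[|]]] //=;
     case: (tw k rho a.+1) N1 L1 N2' L2' => [|[|]] //=; lia.
have [->|va'] := eqVneq v a.+1.
  rewrite simple_r // !kgrass_inv // !uinvE // Ea'.
  by case: (tw k rho a.+2) ra' lt N2 N1' L2 L1' => [|[|[|]]] //=;
     case: (tw k rho a.+1) N1 L1 N2' L2' => [|[|]] //=; lia.
rewrite simple_o // ?kgrass_inv // ?uinvE //; try lia.
rewrite E // swapw_o; try lia.
by rewrite EN ?(EN v.+1) ?EL //; lia.
Qed.

Lemma ascent_kgrass k lam a : kstrict k lam ->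
  ascent a (kgrass k lam) = ~~ desw a (tw k lam).
Proof.
move=> kl; case: a => [|a]; rewrite /ascent /desw !kgrass_inv //.
  by have := uinv_spec kl (ltn0Sn 0) => -[] [-> -> *] /=; lia.
have N1 := Nc_tw a.+1 kl; have L1 := Lc_tw a.+1 kl; have Q1 := Qc_step kl a.+1.
have := uinv_spec kl (ltn0Sn a.+1); have := uinv_spec kl (ltn0Sn a) => /=.
by case=> -[t1 u1 h1 h2]; case=> -[t2 u2 h3 h4]; rewrite u1 u2 t1 t2 /=;
  rewrite t2 /= in N1 L1 Q1; lia.
Qed.

Lemma good_tw k n lam : kstrict k lam -> W n (kgrass k lam) -> good k n (tw k lam).
Proof.
move=> kl hW; split=> v; first exact: tw_le2.
case: v => [|v] h; first by rewrite /tw eqxx eqxx.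
have := @W_inv n _ v.+1%:Z hW; rewrite kgrass_inv // => /(_ ltac:(rewrite /=; lia)).
have := Lc_lek k lam v.+1; rewrite /dflt.
have := uinv_spec kl (ltn0Sn v); case: (leqP v.+1 k) => vk; by case=> -[-> -> ? ? ? ?]; lia.
Qed.

Lemma kgrass_inj k lam mu : kstrict k lam -> kstrict k mu ->
  kgrass k lam = kgrass k mu -> lam = mu.
Proof.
move=> kl km E; apply: (tw_inj kl km) => v v0.
have := kgrass_inv km v0; rewrite -E kgrass_inv //.
by have := uinv_spec kl v0; have := uinv_spec km v0;
  case=> -[-> -> ? ?]; case=> -[-> -> ? ?]; lia.
Qed.

Lemma good_step k n f f' a : a < n -> stepw a f f' ->
  (good k n f -> (forall v, f' v <= 2) -> f' 0 = 2 -> good k n f') /\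
  (good k n f' -> (forall v, f v <= 2) -> f 0 = 2 -> good k n f).
Proof.
move=> an; case: a an => [|a] an /=.
  by move=> [t1 t2 E]; split=> -[g1 g2] h h0; split=> // -[//|v] hv;
     [rewrite E | rewrite -E]; rewrite ?g2; lia.
by move=> [lt E]; split=> -[g1 g2] h h0; split=> // -[//|v] hv;
   have := E v.+1 isT; rewrite swapw_o; try lia; [move=> ->|move=> <-]; apply: g2.
Qed.

(** A convention forced by [0.-1 = 0] in [tw]; [dflt] and [ext] use the same value, so that words
    can be compared as functions on all of nat. *)
Lemma tw0 k lam : tw k lam 0 = 2.
Proof. by rewrite /tw !eqxx. Qed.

Definition wordof k n lam : word n := mkw n (tw k lam).

Lemma wordof_inj k n lam mu : kstrict k lam -> kstrict k mu ->
    good k n (tw k lam) -> good k n (tw k mu) ->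
  wordof k n lam = wordof k n mu -> lam = mu.
Proof.
move=> kl km gl gm E; apply: (tw_inj kl km) => v _.
by rewrite -(extK gl) -(extK gm) -/(wordof k n lam) E.
Qed.

(** A letter that acts is an ascent of the word, hence of the k-Grassmannian element; it adds one
    box and raises the length by one. *)
Lemma act_forward k n (p : seq 'I_n) rho sg : kstrict k rho -> good k n (tw k rho) ->
    wact k p (wordof k n rho) = Some sg ->
  exists nu, [/\ kstrict k nu, good k n (tw k nu), sg = wordof k n nu,
    kgrass k nu = (rw p * kgrass k rho)%g & sumn nu = sumn rho + size p] /\
    (forall c, 0 < c -> col_length rho c <= col_length nu c) /\
    (forall m, n <= m -> ninv m (kgrass k nu) = ninv m (kgrass k rho) + size p).
Proof.
move=> kr gr; elim: p sg => [|i p IH] sg /=.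
  move=> [<-]; exists rho; split; last by split=> // m _; rewrite addn0.
  by split=> //; rewrite ?addn0 // /rw /word_prod big_nil mul1g.
case E: (wact k p _) => [t|] //= st.
have [nu [[kn gn tE kE sE] [cE lE]]] := IH _ E.
rewrite tE in st; move/(stepP k _ _ (ltn_ord i)): (st) => sw.
rewrite extK // in sw.
have asc : ascw i (tw k nu).
  by case: (val i) sw => [|a] /=; [case=> -> | case].
have [nu' [kn' sw' bx]] := addbox kn asc.
have gn' : good k n (tw k nu').
  by apply: (good_step k (ltn_ord i) sw').1 => // [v|]; [exact: tw_le2 | exact: tw0].
have sgE : sg = wordof k n nu'.
  have st' : step k i (wordof k n nu) = Some (wordof k n nu').
    by apply/(stepP k _ _ (ltn_ord i)); rewrite !extK.
  by move: st; rewrite st' => -[].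
have ke := kgrass_step kn kn' sw'.
exists nu'; case: bx => c0 c00 cE'; split; last split.
- split=> //; first by rewrite ke kE rw_cons mulgA.
  by rewrite (sumn_box c00 cE') sE addnS.
- by move=> c c1; rewrite cE' //; have := cE c c1; lia.
move=> m nm; rewrite ke ninv_simple ?lE ?addnS //.
  exact: leq_trans (ltn_ord i) nm.
rewrite (ascent_kgrass _ kn); case: (val i) asc => [|a] /=; lia.
Qed.

Lemma ninv_mul_word m (p : seq nat) w : all (fun i => i < m) p ->
  ninv m (word_prod p * w)%g <= size p + ninv m w.
Proof.
elim: p => [|i p IH]; rewrite /word_prod ?big_nil ?mul1g // big_cons => /andP[im pm].
rewrite -/(word_prod p) -mulgA [size _]/=; have le := IH pm.
have [asc|nasc] := boolP (ascent i (word_prod p * w)%g).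
  by rewrite ninv_simple.
rewrite (ninv_simpleN im nasc) in le.
by apply: leq_trans (ltnW le) _; rewrite addSn.
Qed.

(** Additivity of lengths makes the first letter of [p] a left descent of w_lam, so a box can be
    removed and the rest of [p] treated by induction. That [w] is k-Grassmannian comes out as a
    conclusion. *)
Lemma act_backward k n m (p : seq 'I_n) w lam : kstrict k lam -> good k n (tw k lam) ->
    n <= m -> kgrass k lam = (rw p * w)%g ->
    ninv m (kgrass k lam) = size p + ninv m w ->
  exists rho, [/\ kstrict k rho, good k n (tw k rho), w = kgrass k rho
    & wact k p (wordof k n rho) = Some (wordof k n lam)].
Proof.
move=> + + nm; elim: p lam => [|i p IH] lam kl gl /=.
  by rewrite /rw /word_prod big_nil mul1g => <- _; exists lam.
rewrite rw_cons => E hl.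
have im : i < m := leq_trans (ltn_ord i) nm.
have pm : all (fun i => i < m) (map val p).
  by rewrite all_map; apply/allP => j _ /=; apply: leq_trans (ltn_ord j) nm.
have sE : (simple i * kgrass k lam = rw p * w)%g by rewrite E -mulgA simpleK.
have le := ninv_mul_word w pm; rewrite -/(rw p) -sE size_map in le.
have nasc : ~~ ascent i (kgrass k lam).
  by apply/negP => asc; move: le; rewrite ninv_simple // hl /=; lia.
have ds : desw i (tw k lam) by move: nasc; rewrite ascent_kgrass // negbK.
have [rho1 [kr1 sw bx]] := rembox kl ds.
have ke := kgrass_step kr1 kl sw.
have gr1 : good k n (tw k rho1).
  by apply: (good_step k (ltn_ord i) sw).2 => // [v|]; [exact: tw_le2 | exact: tw0].
have e1 : kgrass k rho1 = (rw p * w)%g by rewrite -sE ke simpleK.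
have [|rho [kr gr we ac]] := IH rho1 kr1 gr1 e1.
  have := ninv_simpleN im nasc; rewrite hl sE -e1; lia.
exists rho; split=> //=; rewrite ac /=.
by apply/(stepP k _ _ (ltn_ord i)); rewrite !extK.
Qed.

Local Open Scope ring_scope.

(** * Matrix entries as functionals on the nilCoxeter algebra *)

Section Representation.

Variables (k n : nat) (R : comNzRingType).

Local Notation alg := {malg R[{fmonom 'I_n}]}.
Local Notation word := (word n).

(* The (s, t) matrix entry of the action of the free algebra on words, which
   factors through the nilCoxeter algebra. *)
Definition phi (s t : word) : alg -> R :=
  mmap idfun (fun m : {fmonom 'I_n} => (wact k (fmonom_val m) t == Some s)%:R).

Lemma monZE c a : c *: mon R a = << c *g FMonom a >> :> alg.
Proof.
apply/malgP => m; rewrite mcoeffZ monE mcoeffU1 mcoeffU.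
by case: eqP; rewrite ?mulr1 ?mulr0.
Qed.

Lemma phi_monZ s t c a : phi s t (c *: mon R a) = c * (wact k a t == Some s)%:R.
Proof. by rewrite monZE /phi mmapU. Qed.

Lemma phi_mon s t a : phi s t (mon R a) = (wact k a t == Some s)%:R.
Proof. by rewrite -[mon R a]scale1r phi_monZ mul1r. Qed.

Lemma phiD s t p q : phi s t (p + q) = phi s t p + phi s t q.
Proof. exact: mmapD. Qed.

Lemma phiB s t p q : phi s t (p - q) = phi s t p - phi s t q.
Proof. exact: mmapB. Qed.

Lemma phi0 s t : phi s t 0 = 0.
Proof. exact: mmap0. Qed.

Lemma phiZ s t c p : phi s t (c *: p) = c * phi s t p.
Proof.
elim/malg_word_ind: p => [|p q IHp IHq|x a].
- by rewrite scaler0 phi0 mulr0.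
- rewrite scalerDr.
  rewrite phiD phiD mulrDr.
  exact: (congr2 _ IHp IHq).
rewrite scalerA; apply: etrans (phi_monZ s t (c * x) a) _.
apply/esym; apply: etrans (congr1 _ (phi_monZ s t x a)) _.
exact: mulrA.
Qed.

Lemma monZM x y a b : (x *: mon R a) * (y *: mon R b) = (x * y) *: mon R (a ++ b) :> alg.
Proof.
rewrite !monZE malgM_def fgmulUU; congr (<< _ *g _ >>).
by rewrite -[LHS]/(fmmul _ _) fmmulE.
Qed.

Lemma phiM s t p q : phi s t (p * q) = \sum_r phi s r p * phi r t q.
Proof.
elim/malg_word_ind: p => [|p p' IHp IHp'|x a].
- by rewrite mul0r phi0 big1 // => r _; rewrite phi0 mul0r.
- rewrite mulrDl.
  rewrite phiD.
  apply: etrans (congr2 _ IHp IHp') _.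
  rewrite -big_split /=; apply: eq_bigr => r _.
  by rewrite phiD mulrDl.
elim/malg_word_ind: q => [|q q' IHq IHq'|y b].
- by rewrite mulr0 phi0 big1 // => r _; rewrite phi0 mulr0.
- rewrite mulrDr phiD; apply: etrans (congr2 _ IHq IHq') _; rewrite -big_split /=; apply: eq_bigr => r _.
  by rewrite [in RHS]phiD mulrDr.
rewrite monZM phi_monZ act_cat.
case E: (wact k b t) => [r|] /=.
  rewrite (bigD1 r) //= !phi_monZ E eqxx mulr1 big1 ?addr0 ?mulrA.
    by rewrite mulrAC.
  move=> r' ne; rewrite !phi_monZ E.
  by rewrite (_ : (Some r == Some r') = false) ?mulr0 //; apply/eqP => -[e]; rewrite e eqxx in ne.
by rewrite mulr0 big1 // => r' _; rewrite !phi_monZ E !mulr0.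
Qed.

Lemma xi_mon (i : 'I_n) : xi R i = mon R [:: i].
Proof. by rewrite /mon big_seq1. Qed.

Lemma phi_relator s t r : nilcox_relator r -> phi s t r = 0.
Proof.
case=> [i|i j ij|i j i0 ji|i j i0 j1]; rewrite !xi_mon -!mon_cat ?phiB !phi_mon.
- by rewrite act_square.
- by rewrite [_ ++ _]/= act_comm // subrr.
- by rewrite [X in wact _ X]/= act_braid3 // subrr.
- by rewrite [X in wact _ X]/= act_braid4 // subrr.
Qed.

Lemma phi_ideal s t p : nilcox_ideal p -> phi s t p = 0.
Proof.
elim=> [|p' r q hr|p1 p2 _ IH1 _ IH2]; first exact: phi0.
  rewrite phiM big1 // => v _; rewrite phiM big1 ?mul0r // => u _.
  by rewrite (phi_relator _ _ hr) mulr0.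
by rewrite phiD IH1 IH2 addr0.
Qed.

End Representation.

(** Beyond [n] the letters are 1 up to [k] and 2 afterwards, with no descent. A descent at [n]
    itself would be a 2 followed by a default 1; then fewer than [k] letters 1 occur in all, against
    the limit of [Lc]. *)
Lemma desw_lt k n lam i : kstrict k lam -> good k n (tw k lam) ->
  desw i (tw k lam) -> (i < n)%N.
Proof.
move=> kl [_ gl] ds; rewrite ltnNge; apply/negP => ni.
have e1 := gl i.+1 ltac:(lia); rewrite /dflt in e1.
case: i ni ds e1 => [|i] ni /=; first by case: leqP => _ /eqP->.
have [lt|le] := ltnP n i.+1.
  have := gl i.+1 ltac:(lia); rewrite /dflt => ->.
  by case: (leqP i.+1 k) => h1 h2 h3; move: h2; rewrite h3; case: (leqP i.+2 k) => ?; lia.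
have {le ni} nE : n = i.+1 by lia.
have t2 := tw_le2 k lam i.+1; case: (leqP i.+2 k) => [ik|ki] ds e1; last first.
  by move: ds; rewrite e1; lia.
have tn : tw k lam i.+1 = 2%N by move: ds; rewrite e1; lia.
have Ln : (Lc k lam i.+1 <= i)%N by rewrite Lc_tw // tn addn0 Lc_lev.
have run d : (Lc k lam (i.+1 + d) <= i + d)%N.
  by elim: d => [|d IH]; rewrite ?addn0 // !addnS; have := Lc_leS kl (i.+1 + d); lia.
have [V hV] := eventually_tail kl.
have tl d : Lc k lam (k + d) = Lc k lam k.
  elim: d => [|d IH]; rewrite ?addn0 // addnS Lc_tw // IH gl; last lia.
  by rewrite /dflt; case: leqP => //; lia.
have := run (k - i.+1)%N; rewrite subnKC; last lia.
by rewrite -(tl V) (hV _ _).2; lia.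
Qed.

Lemma wact_down k n M (p : seq 'I_M) rho lam : kstrict k rho -> kstrict k lam ->
    good k M (tw k rho) -> good k M (tw k lam) -> good k n (tw k lam) ->
    wact k p (wordof k M rho) = Some (wordof k M lam) ->
  good k n (tw k rho) /\ all (fun i : 'I_M => i < n)%N p.
Proof.
move=> kr + gr; elim: p lam => [|i p IH] lam kl gM gn /=.
  by move=> [/(wordof_inj kr kl gr gM)->].
case E: (wact k p _) => [t|] //= st.
have [nu [[kn gnu tE _ _] _]] := act_forward kr gr E.
rewrite tE in st E; move/(stepP k _ _ (ltn_ord i)): st.
rewrite !extK // => sw.
have ds : desw i (tw k lam).
  case: (val i) sw => [|a] /=; first by case=> _ ->.
  by case=> lt e; rewrite !e // swapw_l swapw_r.
have iln := desw_lt kl gn ds; rewrite iln /=.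
apply: IH E => //.
by apply: (good_step k iln sw).2 => // [v|]; [exact: tw_le2 | exact: tw0].
Qed.

Section Coefficient.

Variables (k n : nat) (R : comNzRingType) (lam mu : seq nat).
Hypotheses (kl : kstrict k lam) (km : kstrict k mu).
Hypotheses (hl : W n (kgrass k lam)) (cp : compatible_pair k lam mu).

Local Notation w := (kgrass k lam * (kgrass k mu)^-1)%g.

(** The path from [mu] to [lam] is built in W_M, with [M] large enough for both elements. Read back
    from [lam], each of its steps is a descent of a good word and hence below [n], so [mu] and the
    whole path live in W_n. *)
Lemma compatible_good : [/\ W n w, good k n (tw k mu),
    forall c, (0 < c)%N -> (col_length mu c <= col_length lam c)%N
  & forall p : seq 'I_n, red p -> rw p = w ->
      wact k p (wordof k n mu) = Some (wordof k n lam)].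
Proof.
have gl := good_tw kl hl.
move: cp; rewrite /compatible_pair => cp'.
have [m hm] := sp_finite (kgrass k mu); pose M := maxn m n.
have hmu : W M (kgrass k mu) by apply: W_sub hm; rewrite leq_maxl.
have hla : W M (kgrass k lam) by apply: W_sub hl; rewrite leq_maxr.
have hw : W M w by apply: WM => //; exact: WV.
rewrite !(@sp_lengthE M) // in cp'.
have gl' := good_tw kl hla.
have key n' (p : seq 'I_n') : (n' <= M)%N -> good k n' (tw k lam) -> red p -> rw p = w ->
    good k n' (tw k mu) /\ wact k p (wordof k n' mu) = Some (wordof k n' lam).
  move=> nM g rp pw.
  have sp : size p = ninv M w by rewrite -pw -(eqP rp) (@ninv_sub n' M) //; apply: W_rw.
  have E : kgrass k lam = (rw p * kgrass k mu)%g by rewrite pw mulgVK.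
  have [|rho [kr gr e ac]] := @act_backward k n' M p _ lam kl g nM E.
    by rewrite cp' sp.
  by rewrite (kgrass_inj km kr e).
have [p rp pw] := red_exists hw.
have [gm' ac] := key M p (leqnn _) gl' rp pw.
have [gm pn] := wact_down km kl gm' gl' gl ac.
have [nu [[kn gn nE _ _] [cE _]]] := act_forward km gm' ac.
rewrite -(wordof_inj kl kn gl' gn nE) in cE.
split=> //.
  by rewrite -pw; apply: W_word; rewrite all_map.
by move=> q rq qw; apply: (key n q _ gl rq qw).2; rewrite leq_maxr.
Qed.

(** A reduced word of [v] leading from [mu] to [lam] forces w_lam = v w_mu, that is v = w;
    conversely compatibility makes the word of [w] act. So this entry is dual to xi_w. *)
Lemma nilcox_coef_phi (p : {malg R[{fmonom 'I_n}]}) :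
  nilcox_coef p w = phi k (wordof k n lam) (wordof k n mu) p.
Proof.
have [hw gm _ ac] := compatible_good; have gl := good_tw kl hl.
pose F : {additive {malg R[{fmonom 'I_n}]} -> R} :=
  mmap idfun (fun m : {fmonom 'I_n} =>
     (wact k (fmonom_val m) (wordof k n mu) == Some (wordof k n lam))%:R).
apply: (@nilcox_coefE n R F) => // [c q|q|v hv].
- exact: phiZ.
- exact: phi_ideal.
have [a [ra av ->]] := xi_permE R hv.
rewrite [LHS]phi_mon -av; congr (_%:R); congr nat_of_bool; apply/eqP/eqP => [E|E].
  have [nu [[kn gn nE ke _] _]] := act_forward km gm E.
  by rewrite (wordof_inj kl kn gl gn nE) ke mulgK.
exact: ac.
Qed.

End Coefficient.

(** * Matrices of the factors *)

Section YangBaxter.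

Variables (N : nat) (R : comNzRingType).

Local Notation M := 'M[R]_N.+1.

Definition hfac (a : M) (t : R) : M := 1 + t *: a.

Lemma hfac_add a s t : a * a = 0 -> hfac a s * hfac a t = hfac a (s + t).
Proof.
move=> aa; rewrite /hfac mulrDl !mulrDr !mul1r mulr1 -scalerAl -scalerAr aa !scaler0.
by rewrite addr0 scalerDl -addrA [t *: a + _]addrC.
Qed.

Lemma hfac_comm a b s t : a * b = b * a -> hfac a s * hfac b t = hfac b t * hfac a s.
Proof.
move=> ab; rewrite /hfac !mulrDl !mulrDr !mul1r !mulr1 -!scalerAl -!scalerAr ab.
by move: (b * a) => u; apply/matrixP => i j; rewrite !mxE; ring.
Qed.

Lemma yang_baxter a b x y : a * a = 0 -> b * b = 0 -> a * b * a = b * a * b ->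
  hfac a x * hfac b (x + y) * hfac a y = hfac b y * hfac a (x + y) * hfac b x.
Proof.
move=> aa bb ab; rewrite /hfac !(mulrDl, mulrDr, mul1r, mulr1).
rewrite -!(scalerAl, scalerAr) ?mulrA aa bb ab.
move: (a * b) (b * a) (b * a * b) => u v w.
by apply/matrixP => i j; rewrite !mxE; ring.
Qed.

(** The base case of the reflection equation; the parameters 2x and 2y arise because the square of 1
    + t a is 1 + 2t a. *)
Lemma yang_baxter_B a b x y : a * a = 0 -> b * b = 0 -> a * b * a * b = b * a * b * a ->
  hfac b (x - y) * hfac a (2%:R * x) * hfac b (x + y) * hfac a (2%:R * y) =
  hfac a (2%:R * y) * hfac b (x + y) * hfac a (2%:R * x) * hfac b (x - y).
Proof.
move=> aa bb ab.
have e1 : b * a * b * b = 0 by rewrite -mulrA bb mulr0.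
have e2 : a * b * b = 0 by rewrite -mulrA bb mulr0.
have e3 : b * a * a = 0 by rewrite -mulrA aa mulr0.
have e4 : a * b * a * a = 0 by rewrite -mulrA aa mulr0.
rewrite /hfac !(mulrDl, mulrDr, mul1r, mulr1).
rewrite -!(scalerAl, scalerAr) ?mulrA ?(aa, bb, e1, e2, e3, e4, mul0r) ab.
move: (a * b * a) (b * a * b) (b * a * b * a) => u v w.
move: (a * b) (b * a) => u' v'.
by apply/matrixP => i j; rewrite !mxE; ring.
Qed.

Variable X : nat -> M.

Hypothesis X_square : forall i, X i * X i = 0.
Hypothesis X_comm : forall i j, (i.+2 <= j)%N -> X i * X j = X j * X i.
Hypothesis X_braid3 : forall i, X i.+1 * X i.+2 * X i.+1 = X i.+2 * X i.+1 * X i.+2.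
Hypothesis X_braid4 : X 0 * X 1 * X 0 * X 1 = X 1 * X 0 * X 1 * X 0.

Local Notation h i t := (hfac (X i) t).

Fixpoint Cmx (m : nat) (t : R) : M :=
  if m is m'.+1 then h m t * Cmx m' t * h m t else h 0 t * h 0 t.

Lemma Cmx_comm m i s t : (m.+1 < i)%N -> Cmx m s * h i t = h i t * Cmx m s.
Proof.
elim: m => [|m IH] mi.
  have c : h 0 s * h i t = h i t * h 0 s by apply/hfac_comm/X_comm.
  by rewrite -[Cmx _ _]/(h 0 s * h 0 s) -mulrA c !mulrA c.
have c : h m.+1 s * h i t = h i t * h m.+1 s by apply/hfac_comm/X_comm.
rewrite -[Cmx _ _]/(h m.+1 s * Cmx m s * h m.+1 s) -mulrA c !mulrA.
by rewrite -[h m.+1 s * _ * h i t]mulrA IH ?mulrA ?c //; apply: ltnW.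
Qed.

Lemma Cmx0 t : Cmx 0 t = h 0 (2%:R * t).
Proof. by rewrite /= hfac_add // mulr_natl mulr2n. Qed.

(* Sklyanin's reflection equation for [Cmx m]. *)
Lemma reflection m x y :
  h m.+1 (x - y) * Cmx m x * h m.+1 (x + y) * Cmx m y =
  Cmx m y * h m.+1 (x + y) * Cmx m x * h m.+1 (x - y).
Proof.
elim: m => [|m IH]; first by rewrite !Cmx0 yang_baxter_B.
have YB u v : h m.+1 u * h m.+2 (u + v) * h m.+1 v = h m.+2 v * h m.+1 (u + v) * h m.+2 u.
  by apply: yang_baxter.
have YB' u v : h m.+2 u * h m.+1 (u + v) * h m.+2 v = h m.+1 v * h m.+2 (u + v) * h m.+1 u.
  by apply: yang_baxter.
have cm u v : Cmx m u * h m.+2 v = h m.+2 v * Cmx m u by apply: Cmx_comm.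
have E t : Cmx m.+1 t = h m.+1 t * Cmx m t * h m.+1 t by [].
rewrite !E; set K := Cmx m; rewrite -/K in IH cm.
transitivity (h m.+2 (x - y) * h m.+1 x * K x *
    (h m.+1 x * h m.+2 (x + y) * h m.+1 y) * K y * h m.+1 y); first by rewrite !mulrA.
rewrite YB.
transitivity (h m.+2 (x - y) * h m.+1 x * (K x * h m.+2 y) * h m.+1 (x + y) *
    (h m.+2 x * K y) * h m.+1 y); first by rewrite !mulrA.
rewrite cm -(cm y x).
transitivity ((h m.+2 (x - y) * h m.+1 x * h m.+2 y) * K x * h m.+1 (x + y) *
    K y * h m.+2 x * h m.+1 y); first by rewrite !mulrA.
have -> : h m.+2 (x - y) * h m.+1 x * h m.+2 y = h m.+1 y * h m.+2 x * h m.+1 (x - y).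
  by have := YB' (x - y) y; rewrite subrK.
transitivity (h m.+1 y * h m.+2 x *
    (h m.+1 (x - y) * K x * h m.+1 (x + y) * K y) * h m.+2 x * h m.+1 y).
  by rewrite !mulrA.
rewrite IH.
transitivity (h m.+1 y * (h m.+2 x * K y) * h m.+1 (x + y) * K x *
    (h m.+1 (x - y) * h m.+2 x * h m.+1 y)); first by rewrite !mulrA.
have -> : h m.+1 (x - y) * h m.+2 x * h m.+1 y = h m.+2 y * h m.+1 x * h m.+2 (x - y).
  by have := YB (x - y) y; rewrite subrK.
rewrite -cm.
transitivity (h m.+1 y * K y * h m.+2 x * h m.+1 (x + y) * (K x * h m.+2 y) *
    h m.+1 x * h m.+2 (x - y)); first by rewrite !mulrA.
rewrite cm.
transitivity (h m.+1 y * K y * (h m.+2 x * h m.+1 (x + y) * h m.+2 y) * K x *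
    h m.+1 x * h m.+2 (x - y)); first by rewrite !mulrA.
by rewrite YB' !mulrA.
Qed.

(** The two inner factors merge into [h m.+1 (x + y)]. The reflection equation, multiplied by the
    inverse [h m.+1 (y - x)] of its first factor, exchanges the two cores, and the extra factors at
    both ends turn the outer x into y and y into x. *)
Lemma Cmx_commute m x y : Cmx m x * Cmx m y = Cmx m y * Cmx m x.
Proof.
case: m => [|m]; first by rewrite !Cmx0; apply: hfac_comm.
have E t : Cmx m.+1 t = h m.+1 t * Cmx m t * h m.+1 t by [].
have R' : Cmx m x * h m.+1 (x + y) * Cmx m y =
    h m.+1 (y - x) * Cmx m y * h m.+1 (x + y) * Cmx m x * h m.+1 (x - y).
  have := congr1 (fun A => h m.+1 (y - x) * A) (reflection m x y).
  rewrite !mulrA hfac_add // (_ : y - x + (x - y) = 0); last by ring.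
  by rewrite {1}/hfac scale0r addr0 mul1r.
rewrite !E.
transitivity (h m.+1 x * (Cmx m x * (h m.+1 x * h m.+1 y) * Cmx m y) * h m.+1 y).
  by rewrite !mulrA.
rewrite hfac_add // R'.
transitivity ((h m.+1 x * h m.+1 (y - x)) * Cmx m y * h m.+1 (x + y) * Cmx m x *
   (h m.+1 (x - y) * h m.+1 y)); first by rewrite !mulrA.
rewrite !hfac_add // subrK (_ : x + (y - x) = y); last by ring.
by rewrite [x + y]addrC -hfac_add // !mulrA.
Qed.

End YangBaxter.

(** * The matrices of the generators and of the factors *)

Section MatrixRep.

Variables (k n : nat) (R : comNzRingType).

Local Notation alg := {malg R[{fmonom 'I_n}]}.
Local Notation word := (word n).
Local Notation N := #|{: word}|.-1.
Local Notation M := 'M[R]_N.+1.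

Lemma card_word : #|{: word}| = N.+1.
Proof.
by rewrite prednK //; apply/card_gt0P; exists [ffun=> ord0].
Qed.

Definition wofi (i : 'I_N.+1) : word := enum_val (cast_ord (esym card_word) i).
Definition iofw (s : word) : 'I_N.+1 := cast_ord card_word (enum_rank s).

Lemma iofwK : cancel iofw wofi.
Proof. by move=> s; rewrite /wofi /iofw cast_ordK enum_rankK. Qed.

Lemma wofiK : cancel wofi iofw.
Proof. by move=> i; rewrite /wofi /iofw enum_valK cast_ordKV. Qed.

Definition Phi (p : alg) : M := \matrix_(i, j) phi k (wofi i) (wofi j) p.

Definition entry (A : M) (s t : word) : R := A (iofw s) (iofw t).

Lemma entry_Phi p s t : entry (Phi p) s t = phi k s t p.
Proof. by rewrite /entry mxE !iofwK. Qed.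

Lemma entryP A B : (forall s t, entry A s t = entry B s t) -> A = B.
Proof.
by move=> H; apply/matrixP => i j; rewrite -(wofiK i) -(wofiK j); apply: H.
Qed.

Lemma entryM A B s t : entry (A * B) s t = \sum_r entry A s r * entry B r t.
Proof.
rewrite /entry -[A * B]/(A *m B) mxE (reindex iofw) //.
by apply: onW_bij; exists wofi; [exact: iofwK | exact: wofiK].
Qed.

Lemma entryD A B s t : entry (A + B) s t = entry A s t + entry B s t.
Proof. by rewrite /entry mxE. Qed.

Lemma entryZ c A s t : entry (c *: A) s t = c * entry A s t.
Proof. by rewrite /entry mxE. Qed.

Lemma entry0 s t : entry 0 s t = 0.
Proof. by rewrite /entry mxE. Qed.

Lemma entry1 s t : entry 1 s t = (s == t)%:R.
Proof. by rewrite /entry mxE (inj_eq (can_inj iofwK)). Qed.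

Lemma PhiM p q : Phi (p * q) = Phi p * Phi q.
Proof.
apply: entryP => s t; rewrite entryM entry_Phi phiM.
by apply: eq_bigr => r _; rewrite !entry_Phi.
Qed.

Lemma PhiD p q : Phi (p + q) = Phi p + Phi q.
Proof. by apply: entryP => s t; rewrite entryD !entry_Phi phiD. Qed.

Lemma PhiZ c p : Phi (c *: p) = c *: Phi p.
Proof. by apply: entryP => s t; rewrite entryZ !entry_Phi phiZ. Qed.

Lemma Phi1 : Phi 1 = 1.
Proof.
apply: entryP => s t; rewrite entry1 entry_Phi.
have -> : 1 = mon R [::] :> alg by rewrite /mon big_nil.
rewrite phi_mon /=; congr (_%:R); congr nat_of_bool.
by rewrite eq_sym; apply/eqP/eqP => [[->]|->].
Qed.

Lemma Phi_ideal p : nilcox_ideal p -> Phi p = 0.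
Proof. by move=> hp; apply: entryP => s t; rewrite entry0 entry_Phi phi_ideal. Qed.

Lemma Phi_prod (I : Type) (r : seq I) (P : pred I) (F : I -> alg) :
  Phi (\prod_(i <- r | P i) F i) = \prod_(i <- r | P i) Phi (F i).
Proof.
elim: r => [|i r IH]; first by rewrite !big_nil Phi1.
by rewrite !big_cons; case: ifP => _; rewrite ?PhiM IH.
Qed.

(** Extended by 0 beyond [n], so that the relations hold for all natural indices as the Yang-Baxter
    section requires. *)
Definition Xm (v : nat) : M := if insub v is Some i then Phi (xi R (i : 'I_n)) else 0.

Lemma Xm_ord (i : 'I_n) : Xm i = Phi (xi R i).
Proof. by rewrite /Xm valK. Qed.

Lemma Xm_lt v (vn : (v < n)%N) : Xm v = Phi (xi R (Ordinal vn)).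
Proof. exact: (Xm_ord (Ordinal vn)). Qed.

Lemma Xm_out v : (n <= v)%N -> Xm v = 0.
Proof. by move=> nv; rewrite /Xm insubF //; apply/negbTE; rewrite -leqNgt. Qed.

Lemma entry_Xm v s t : (v < n)%N -> entry (Xm v) s t = (step k v t == Some s)%:R.
Proof.
move=> vn; rewrite (Xm_lt vn) entry_Phi xi_mon phi_mon.
by rewrite /wact /=.
Qed.

Lemma Xm_square v : Xm v * Xm v = 0.
Proof.
have [nv|vn] := leqP n v; first by rewrite Xm_out // mul0r.
by rewrite (Xm_lt vn) -PhiM Phi_ideal //; apply/ideal_rel/Rel_square.
Qed.

Lemma Phi_rel p q : nilcox_relator (p - q) -> Phi p = Phi q.
Proof.
move=> /ideal_rel/Phi_ideal E; apply/eqP; rewrite -subr_eq0; apply/eqP.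
by rewrite -E -[- q]scaleN1r PhiD PhiZ scaleN1r.
Qed.

Lemma Xm_comm i j : (i.+2 <= j)%N -> Xm i * Xm j = Xm j * Xm i.
Proof.
move=> ij; have [nj|jn] := leqP n j; first by rewrite (Xm_out nj) mulr0 mul0r.
have lt : (i < n)%N by lia.
rewrite (Xm_lt lt) (Xm_lt jn) -!PhiM.
by apply: Phi_rel; apply: Rel_commute.
Qed.

Lemma Xm_braid3 i : Xm i.+1 * Xm i.+2 * Xm i.+1 = Xm i.+2 * Xm i.+1 * Xm i.+2.
Proof.
have [nj|jn] := leqP n i.+2; first by rewrite (Xm_out nj) !(mulr0, mul0r).
have lt : (i.+1 < n)%N by lia.
rewrite (Xm_lt lt) (Xm_lt jn) -!PhiM.
by apply: Phi_rel; apply: Rel_braid3.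
Qed.

Lemma Xm_braid4 : Xm 0 * Xm 1 * Xm 0 * Xm 1 = Xm 1 * Xm 0 * Xm 1 * Xm 0.
Proof.
have [nj|jn] := leqP n 1; first by rewrite (Xm_out nj) !(mulr0, mul0r).
have lt : (0 < n)%N by lia.
rewrite (Xm_lt lt) (Xm_lt jn) -!PhiM.
by apply: Phi_rel; apply: Rel_braid4.
Qed.

Definition Hprod (l : seq nat) (t : R) : M := \prod_(v <- l) hfac (Xm v) t.

Lemma big_enum_ord (F : nat -> M) (P : pred nat) :
  \prod_(j <- enum 'I_n | P j) F j = \prod_(v <- [seq v <- iota 0 n | P v]) F v.
Proof. by rewrite big_filter -val_enum_ord big_map. Qed.

Lemma big_rev_enum_ord (F : nat -> M) (P : pred nat) :
  \prod_(j <- rev (enum 'I_n) | P j) F j = \prod_(v <- rev [seq v <- iota 0 n | P v]) F v.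
Proof. by rewrite -filter_rev big_filter -val_enum_ord -map_rev big_map. Qed.

Lemma Phi_factor t (i : 'I_n) : Phi (1 + t *: xi R i) = hfac (Xm i) t.
Proof. by rewrite PhiD Phi1 PhiZ -Xm_ord. Qed.

Lemma Phi_A_prod i t : Phi (A_prod n i t) = Hprod (rev [seq v <- iota 0 n | (i <= v)%N]) t.
Proof.
rewrite /A_prod Phi_prod /Hprod -big_rev_enum_ord.
by apply: eq_bigr => j _; exact: Phi_factor.
Qed.

Lemma Phi_Atilde_prod i t :
  Phi (Atilde_prod n i t) = Hprod [seq v <- iota 0 n | (i <= v)%N] (- t).
Proof.
rewrite /Atilde_prod Phi_prod /Hprod -big_enum_ord.
by apply: eq_bigr => j _; rewrite -scaleNr; exact: Phi_factor.
Qed.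

Lemma Cmx_Hprod m t :
  Cmx Xm m t = Hprod (rev (iota 0 m.+1) ++ iota 0 m.+1) t.
Proof.
rewrite /Hprod big_cat; elim: m => [|m IH]; first by rewrite /= !big_seq1.
have E : iota 0 m.+2 = rcons (iota 0 m.+1) m.+1.
  by rewrite -cats1 -[m.+2]addn1 iotaD add0n.
rewrite -[Cmx _ _ _]/(hfac (Xm m.+1) t * Cmx Xm m t * hfac (Xm m.+1) t) IH.
rewrite E rev_rcons big_cons -cats1 [X in _ = _ * X]big_cat big_seq1.
by rewrite !mulrA.
Qed.

Lemma Phi_C_prod t : (0 < n)%N -> Phi (C_prod n t) = Cmx Xm n.-1 t.
Proof.
move=> n0; rewrite Cmx_Hprod.
have -> : iota 0 n.-1.+1 = iota 0 n by rewrite (prednK n0).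
rewrite /Hprod big_cat /= /C_prod PhiM !Phi_prod.
congr (_ * _).
  rewrite -[iota 0 n]filter_predT -big_rev_enum_ord.
  by apply: eq_bigr => j _; exact: Phi_factor.
rewrite -[iota 0 n]filter_predT -big_enum_ord.
by apply: eq_bigr => j _; exact: Phi_factor.
Qed.

Lemma Cmx_commX m x y : Cmx Xm m x * Cmx Xm m y = Cmx Xm m y * Cmx Xm m x.
Proof.
apply: Cmx_commute; [exact: Xm_square | exact: Xm_comm | exact: Xm_braid3 | exact: Xm_braid4].
Qed.

End MatrixRep.

Local Close Scope ring_scope.

(** * Entries of monotone products *)

Section Cuts.

Variables (k n : nat).

Local Notation word := (word n).
Local Notation ext := (@ext k n).
Local Notation step := (@step k n).

Definition cc c (s : word) v := count (fun x => ext s x == c) (iota v.+1 (n - v)).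

Definition changed (s t : word) v : bool :=
  (cc 0 s v != cc 0 t v) || (cc 1 s v != cc 1 t v).

Lemma cc_rec c s v : v < n -> cc c s v = (ext s v.+1 == c) + cc c s v.+1.
Proof. by move=> vn; rewrite /cc -(subnSK vn) /=. Qed.

Lemma cc_eq_above c s t v : (forall x, v < x -> ext s x = ext t x) -> cc c s v = cc c t v.
Proof.
by move=> E; apply: eq_in_count => x; rewrite mem_iota => /andP[vx _]; rewrite E.
Qed.

(** Exchanging two distinct letters across the cut [a] is seen by the counts beyond [a] and by no
    others. Counting letters 0 and 1 suffices to detect it, as the number of letters beyond a cut is
    fixed. *)
Lemma cc_step a s t : a < n -> stepw a (ext t) (ext s) ->
  (forall c v, v != a -> cc c s v = cc c t v) /\ changed s t a.
Proof.
move=> an; case: a an => [|a] an.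
  move=> [t2 s0 E]; have E1 c v : 0 < v -> cc c s v = cc c t v.
    by move=> v0; apply: cc_eq_above => x vx; apply: E; lia.
  split=> [c v v0|]; first by apply: E1; lia.
  by rewrite /changed !(@cc_rec _ _ 0) // !E1 // s0 t2; lia.
move=> [lt E].
have Ea : ext s a.+1 = ext t a.+2 by rewrite E // swapw_l.
have Eb : ext s a.+2 = ext t a.+1 by rewrite E // swapw_r.
have Ab c v : a.+1 < v -> cc c s v = cc c t v.
  by move=> av; apply: cc_eq_above => x hx; rewrite E ?swapw_o //; lia.
have low c d : d <= a -> cc c s (a - d) = cc c t (a - d).
  elim: d => [|d IH] hd.
    rewrite subn0 !(@cc_rec _ _ a) ?(ltnW an) // !(@cc_rec _ _ a.+1) // Ab //.
    by rewrite Ea Eb; lia.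
  have e : (a - d.+1).+1 = a - d by lia.
  rewrite !(@cc_rec _ _ (a - d.+1)) ?e ?IH; try lia.
  by rewrite E ?swapw_o //; lia.
split=> [c v va|].
  have [lt'|le] := ltnP a.+1 v; first exact: Ab.
  by rewrite -(@subKn v a) ?low //; lia.
have g := (ext_good k t).1 a.+2.
rewrite /changed !(@cc_rec _ _ a.+1) // !Ab // Eb.
by case: (ext t a.+1) lt => [|[|x]]; case: (ext t a.+2) g => [|[|[|y]]] //= _ _; lia.
Qed.

Lemma step_inj a r r' s : a < n -> step a r = Some s -> step a r' = Some s -> r = r'.
Proof.
move=> an /(stepP k _ _ an) h /(stepP k _ _ an) h'; apply: (@ext_inj k n); apply/funext.
case: a an h h' => [|a] an.
  move=> [t1 _ E] [t1' _ E'] [|[|v]] //; first by rewrite [LHS]t1 [RHS]t1'.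
  by have := E v.+2 isT; have := E' v.+2 isT => -> ->.
move=> [_ E] [_ E'] [|v] //.
have [->|va] := eqVneq v.+1 a.+1.
  by rewrite -swapw_r -E // E' // swapw_r.
have [->|va'] := eqVneq v.+1 a.+2.
  by rewrite -swapw_l -E // E' // swapw_l.
by have := E v.+1 isT; rewrite E' // !swapw_o.
Qed.

Definition wactn (p : seq nat) (t : word) : option word :=
  foldr (fun v o => obind (step v) o) (Some t) p.

Lemma wactE (p : seq 'I_n) t : wact k p t = wactn (map val p) t.
Proof. by rewrite /wactn foldr_map. Qed.

Lemma wactn_changed p t s : all (fun v => v < n) p -> uniq p ->
  wactn p t = Some s -> forall v, changed s t v = (v \in p).
Proof.
elim: p s => [|i p IH] s /=; first by move=> _ _ [<-] v; rewrite /changed !eqxx.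
move=> /andP[ilt pn] /andP[ip up]; case E: (wactn p t) => [r|] //= st v.
have [c1 c2] := cc_step ilt ((stepP k _ _ ilt).1 st).
have := IH r pn up E v; rewrite inE; have [->|vi] := eqVneq v i; last first.
  by rewrite /changed !c1.
by rewrite (negPf ip) /= => /negbT; rewrite /changed negb_or !negbK
   => /andP[/eqP <- /eqP <-].
Qed.

Section Entries.

Variable R : comNzRingType.

Local Open Scope ring_scope.

Local Notation X := (Xm k n R).

Lemma entry_hfac_l v x A s t : (v < n)%N ->
  entry (hfac (X v) x * A) s t =
    entry A s t + x * (if [pick r | step v r == Some s] is Some r then entry A r t else 0).
Proof.
move=> vn; rewrite /hfac mulrDl mul1r -scalerAl entryD entryZ entryM.
congr (_ + _ * _); case: pickP => [r /eqP hr|none].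
  rewrite (bigD1 r) //= entry_Xm // hr eqxx mul1r big1 ?addr0 // => r' ne.
  rewrite entry_Xm //; case: eqP => [e|_]; last by rewrite mul0r.
  by rewrite (step_inj vn e hr) eqxx in ne.
by rewrite big1 // => r _; rewrite entry_Xm // none mul0r.
Qed.

Lemma entry_hfac_r v x A s t : (v < n)%N ->
  entry (A * hfac (X v) x) s t =
    entry A s t + x * (if step v t is Some r then entry A s r else 0).
Proof.
move=> vn; rewrite /hfac mulrDr mulr1 -scalerAr entryD entryZ entryM.
congr (_ + _ * _); case E: (step v t) => [r|].
  rewrite (bigD1 r) //= entry_Xm // E eqxx mulr1 big1 ?addr0 // => r' ne.
  rewrite entry_Xm // E; case: eqP => [[e]|_]; last by rewrite mulr0.
  by rewrite e eqxx in ne.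
by rewrite big1 // => r _; rewrite entry_Xm // E mulr0.
Qed.

(** Each reflection occurs once, so the subword used must be exactly the set of changed cuts, in the
    order of [l]: at most one term of the expanded product contributes. *)
Lemma entry_Hprod l (x : R) s t : all (fun v => v < n)%N l -> uniq l ->
  entry (Hprod k n l x) s t =
    (let p := [seq v <- l | changed s t v] in
     x ^+ size p * (wactn p t == Some s)%:R).
Proof.
elim: l s => [|v l IH] s /=.
  by move=> _ _; rewrite /Hprod big_nil entry1 expr0 mul1r eq_sym.
move=> /andP[vn ln] /andP[vl ul]; rewrite /Hprod big_cons entry_hfac_l // -/(Hprod k n l x).
rewrite IH //= ; have filt s' : {subset [seq v <- l | changed s' t v] <= l}.
  by move=> y; rewrite mem_filter => /andP[].
have fn s' : all (fun v => v < n)%N [seq v <- l | changed s' t v].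
  by apply/allP => y /filt; apply: (allP ln).
have fu s' : uniq [seq v <- l | changed s' t v] by rewrite filter_uniq.
have nv s' : wactn [seq v <- l | changed s' t v] t = Some s' -> changed s' t v = false.
  move=> e; rewrite (wactn_changed (fn _) (fu _) e).
  by apply/negbTE; apply: contra vl => /filt.
case: ifP => cv /=.
  rewrite [X in _ * (nat_of_bool X)%:R](_ : _ = false); last first.
    by apply/negP => /eqP /nv; rewrite cv.
  rewrite mulr0 add0r; case: pickP => [r /eqP hr|none].
    rewrite IH //; have [c1 c2] := cc_step vn ((stepP k _ _ vn).1 hr).
    have -> : [seq v <- l | changed r t v] = [seq v <- l | changed s t v].
      apply: eq_in_filter => y yl; rewrite /changed !c1 //;
      by apply: contraNN vl => /eqP <-.
    rewrite exprS -mulrA; congr (_ * (_ * (nat_of_bool _)%:R)).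
    apply/eqP/eqP => [->//|]; case: (wactn _ t) => //= r' hr'.
    by rewrite (step_inj vn hr' hr).
  rewrite mulr0 [X in _ * (nat_of_bool X)%:R](_ : _ = false) ?mulr0 //.
  by apply/negP; case: (wactn _ t) => //= r' hr'; have := none r'; rewrite hr'.
case: pickP => [r /eqP hr|_]; last by rewrite mulr0 addr0.
rewrite IH // [X in x * (_ * (nat_of_bool X)%:R)](_ : _ = false) ?mulr0 ?addr0 //.
apply/negP => /eqP /nv; have [c1 c2] := cc_step vn ((stepP k _ _ vn).1 hr).
rewrite /changed => /negbT; rewrite negb_or !negbK => /andP[/eqP e1 /eqP e2].
by move: c2 cv; rewrite /changed e1 e2 => ->.
Qed.

End Entries.

End Cuts.

(* The words [f], [g] agree beyond position [m + 1], where they carry [p] and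
   [q]; [Wt] counts the ways to go from [f] to [g] using first letters [<= m]
   in decreasing order, then in increasing order. *)
Fixpoint Wt (f g : nat -> nat) m p q : nat :=
  if m is m'.+1 then
    let a := f m in let b := g m in
    (p == q) * Wt f g m' a b + ((a < p) && (a == q)) * Wt f g m' p b
    + ((q < b) && (b == p)) * Wt f g m' a q
    + [&& a < p, q < b & a == b] * Wt f g m' p q
  else (p == q) + 2 * ((p == 2) && (q == 0)).

Lemma Wt_local f g f' g' m p q :
  (forall x, 0 < x <= m -> f' x = f x) -> (forall x, 0 < x <= m -> g' x = g x) ->
  Wt f' g' m p q = Wt f g m p q.
Proof.
elim: m p q => [//|m IH] p q Ef Eg /=.
rewrite Ef ?Eg ?leqnn // !IH // => x hx; [apply: Ef|apply: Eg|apply: Ef|apply: Eg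
 |apply: Ef|apply: Eg|apply: Ef|apply: Eg]; lia.
Qed.

(** * Entries of C(1) *)

Section CEntries.

Variables (k n : nat) (R : comNzRingType).

Local Notation word := (word n).
Local Notation ext := (@ext k n).
Local Notation step := (@step k n).
Local Notation X := (Xm k n R).

Definition agree m (s t : word) := all (fun x => ext s x == ext t x) (iota m (n.+1 - m)).

Lemma agreeP m s t : reflect (forall x, m <= x -> ext s x = ext t x) (agree m s t).
Proof.
apply: (iffP allP) => H x.
  move=> mx; have [xn|nx] := leqP x n.
    by apply/eqP/H; rewrite mem_iota; lia.
  rewrite !(ext_good k _).2; lia.
by rewrite mem_iota => hx; apply/eqP/H; lia.
Qed.

Lemma agreeS m s t : agree m s t = (ext s m == ext t m) && agree m.+1 s t.
Proof.
apply/agreeP/andP => [H|[/eqP E /agreeP H] x].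
  by split; [exact/eqP/H | apply/agreeP => x mx; apply: H; lia].
by rewrite leq_eqVlt => /predU1P[<-|/H].
Qed.

Lemma step_swap v t : 0 < v < n -> ext t v < ext t v.+1 ->
  exists2 r, step v t = Some r & forall x, 0 < x -> ext r x = swapw v (ext t) x.
Proof.
move=> hv lt; have vn : v < n by lia.
have : exists r, step v t = Some r.
  rewrite /step /stepf; case: v hv lt {vn} => // v hv lt.
  by rewrite [ascw _ _]lt; eexists.
move=> [r hr]; exists r => //; move/(stepP k _ _ vn): hr.
by case: v hv {lt vn} => // v _ [].
Qed.

Lemma step_some v t r : 0 < v < n -> step v t = Some r ->
  ext t v < ext t v.+1 /\ forall x, 0 < x -> ext r x = swapw v (ext t) x.
Proof.
move=> hv; have vn : v < n by lia.
by move/(stepP k _ _ vn); case: v hv {vn} => // v _ [].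
Qed.

Lemma swapwK v f : swapw v (swapw v f) =1 f.
Proof.
move=> x; rewrite {1}/swapw; case: eqP => [->|/eqP h]; first by rewrite swapw_r.
case: eqP => [->|/eqP h']; first by rewrite swapw_l.
exact: swapw_o.
Qed.

Lemma step_pred v s : 0 < v < n -> ext s v.+1 < ext s v ->
  exists2 r, step v r = Some s & forall x, 0 < x -> ext r x = swapw v (ext s) x.
Proof.
move=> hv lt; pose r := mkw n (swapw v (ext s)).
have vn : v < n by lia.
have gr : good k n (swapw v (ext s)).
  split=> x; first by rewrite /swapw; case: ifP => _; [|case: ifP => _]; apply: (ext_good k s).1.
  by move=> hx; rewrite swapw_o ?(ext_good k s).2 //; lia.
have rE : ext r = swapw v (ext s) by apply: extK.
exists r; last by rewrite rE.
apply/(stepP k _ _ vn); rewrite rE; case: v hv lt {vn gr r rE} => // v hv lt /=.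
by rewrite swapw_l swapw_r; split=> // x x0; rewrite swapwK.
Qed.

Local Open Scope ring_scope.

Lemma agree_swap_r v s t r : (0 < v)%N -> (forall x, (0 < x)%N -> ext r x = swapw v (ext t) x) ->
  agree v.+2 s r = agree v.+2 s t.
Proof.
move=> v0 E; apply/agreeP/agreeP => H x hx; rewrite H //; rewrite E ?swapw_o //; lia.
Qed.

Lemma agree_sym m s t : agree m s t = agree m t s.
Proof. by apply/agreeP/agreeP => H x hx; rewrite H. Qed.

(** Peeling the outer factors [h m.+1] gives the four terms of [Wt]: use neither, the right one on
    [t], the left one ending at [s], or both. The base case comes from the square of 1 + X_0, which
    is 1 + 2 X_0. Taking t = 1 loses nothing, as the exponent of t is recovered by
    [entry_graded]. *)
Lemma entry_Cmx1 m s t : (m < n)%N ->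
  entry (Cmx X m 1) s t =
    if agree m.+2 s t then (Wt (ext t) (ext s) m (ext t m.+1) (ext s m.+1))%:R else 0.
Proof.
elim: m s t => [|m IH] s t mn.
  rewrite (_ : Cmx X 0 1 = 1 * hfac (X 0) (1 + 1)); last first.
    by rewrite mul1r -hfac_add //; apply: Xm_square.
  rewrite entry_hfac_r // !entry1.
  have E : (if step 0 t is Some r then entry (1 : 'M[R]_(#|{: word}|.-1.+1)) s r else 0)
     = (agree 2 s t && (ext t 1 == 2%N) && (ext s 1 == 0%N))%:R.
    case E: (step 0 t) => [r|].
      have [t2 r0 rE] := (stepP k _ _ mn).1 E.
      rewrite entry1 t2 eqxx andbT; congr (nat_of_bool _)%:R.
      apply/eqP/andP => [->|[/agreeP H /eqP s0]].
        by split; [apply/agreeP => x hx; apply: rE | exact/eqP].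
      apply: (@ext_inj k n); apply/funext => -[|[|x]] //; first by rewrite [LHS]s0 [RHS]r0.
      by rewrite H // rE.
    case: eqP => [t2|]; last by rewrite andbF.
    by move: E; rewrite /step /stepf /ascw t2.
  rewrite E [Wt _ _ _ _ _]/=.
  have -> : (s == t) = agree 2 s t && (ext t 1 == ext s 1).
    apply/eqP/andP => [->|[/agreeP H /eqP e]]; first by split; [apply/agreeP|].
    by apply: (@ext_inj k n); apply/funext => -[|[|x]] //; rewrite ?H // -e.
  case: agree => //=; last by rewrite mulr0 addr0.
  by rewrite natrD natrM.
have m1 : (0 < m.+1 < n)%N by [].
have mn' : (m < n)%N by lia.
rewrite [Cmx _ _ _]/= -mulrA entry_hfac_l // !entry_hfac_r // !mul1r.
set p := ext t m.+2; set q := ext s m.+2; set a := ext t m.+1; set b := ext s m.+1.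
rewrite IH // (agreeS m.+2) -/p -/q.
have wl u v : (forall x, (0 < x)%N -> ext u x = swapw m.+1 (ext v) x) ->
    [/\ ext u m.+1 = ext v m.+2, ext u m.+2 = ext v m.+1 &
     forall x, (0 < x <= m)%N -> ext u x = ext v x].
  by move=> E; rewrite !E // swapw_l swapw_r; split=> // x hx; rewrite E ?swapw_o //; lia.
have T1 : (if step m.+1 t is Some r then entry (Cmx X m 1) s r else 0) =
    ([&& agree m.+3 s t, (a < p)%N & a == q] * Wt (ext t) (ext s) m p b)%:R.
  case: (ltnP a p) => ap; last first.
    rewrite andbF mul0n; case E: (step m.+1 t) => [r|] //.
    by have [] := step_some m1 E; rewrite -/a -/p; lia.
  have [r -> rE] := step_swap m1 ap; have [r1 r2 r3] := wl _ _ rE.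
  rewrite IH // agreeS r1 r2 -/p -/a -/q (agree_swap_r s _ rE) //.
  rewrite (Wt_local (f := ext t) (g := ext s)) //= [q == a]eq_sym andbC.
  by case: andP => // _; rewrite ?mul1n.
have pick_swap r : (b > q)%N -> step m.+1 r = Some s ->
    (fun r' => step m.+1 r' == Some s) =1 pred1 r.
  move=> _ hr r'; apply/eqP/eqP => [h|->//]; exact: step_inj mn h hr.
have T2 u : (if [pick r | step m.+1 r == Some s] is Some r then entry (Cmx X m 1) r u else 0)
   = (if (q < b)%N then
       ([&& agree m.+3 s u & b == ext u m.+2] *
         Wt (ext u) (ext s) m (ext u m.+1) q)%:R else 0).
  case: pickP => [r /eqP hr|none].
    have [lt rE] := step_some m1 hr.
    have [s1 s2 s3] := wl s r rE.
    rewrite -s1 -s2 -/q -/b in lt; rewrite lt IH // agreeS -s1 -/b -s2 -/q.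
    rewrite agree_sym -(agree_swap_r u _ rE) // [agree _ u s]agree_sym.
    rewrite (Wt_local (f := ext u) (g := ext s)) //; last by move=> x hx; rewrite s3.
    by rewrite andbC; case: andP => // _; rewrite ?mul1n.
  case: ltnP => // qb; have [r hr _] := step_pred m1 qb.
  by have := none r; rewrite hr eqxx.
have split_if (o1 o2 : option word) (G : word -> word -> R) :
    (if o1 is Some r then G r t + (if o2 is Some u then G r u else 0) else 0) =
    (if o1 is Some r then G r t else 0) +
    (if o2 is Some u then if o1 is Some r then G r u else 0 else 0).
  by case: o1 => [r|]; case: o2 => [u|]; rewrite ?addr0.
have -> : (if [pick r | step m.+1 r == Some s] is Some r
     then entry (Cmx X m 1 * hfac (X m.+1) 1) r t else 0) =
   (if [pick r | step m.+1 r == Some s] is Some r then entry (Cmx X m 1) r t +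
     (if step m.+1 t is Some u then entry (Cmx X m 1) r u else 0) else 0).
  by case: pickP => // r _; rewrite entry_hfac_r // mul1r.
rewrite (split_if _ _ (entry (Cmx X m 1))) T1 T2.
have -> : (if step m.+1 t is Some u then
     (if [pick r | step m.+1 r == Some s] is Some r then entry (Cmx X m 1) r u else 0) else 0)
   = ([&& agree m.+3 s t, (a < p)%N, (q < b)%N & a == b] * Wt (ext t) (ext s) m p q)%:R.
  case: (ltnP a p) => ap; last first.
    rewrite andbF mul0n; case E: (step m.+1 t) => [r|] //.
    by have [] := step_some m1 E; rewrite -/a -/p; lia.
  have [r -> rE] := step_swap m1 ap; have [r1 r2 r3] := wl _ _ rE.
  rewrite T2 r1 r2 -/a -/p (agree_swap_r s _ rE) //.
  rewrite (Wt_local (f := ext t) (g := ext s)) // [b == a]eq_sym.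
  by case: (q < b)%N; rewrite ?andbF // ?andbT //; case: agree.
rewrite -/a -/p [Wt _ _ m.+1 _ _]/= -/a -/b [q == p]eq_sym.
by case: agree; case: (p == q); case: (a < p)%N; case: (a == q); case: (q < b)%N; case: (b == p);
   case: (a == b); rewrite /= ?mul0n ?mul1n ?addr0 ?add0r -?natrD ?addn0 ?add0n ?addnA.
Qed.

End CEntries.

Definition cut_ok (dn dp : int) : bool :=
  ((dn == 0) || (dn == 1))%R && ((dp == 0) || (dp == 1))%R.

(** The positions excluded by the last two conditions of [cut_strip], with [a] the letter of [mu],
    [b] that of [lam], and the flows through the cut to the right of the position. *)
Definition pos_bad (a b : nat) (dn dp : int) : bool :=
  [&& a == 2, b == 2, dn == 1%R & dp == 0%R] ||
  [&& a == 0, b == 0, dn == 0%R & dp == 1%R].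

Definition cut_nz (dn dp : int) : bool := ~~ ((dn == 0) && (dp == 0))%R.

(* [Wt] in terms of the net flow of letters 0 and 2 through the cuts. *)
Fixpoint Wc (f g : nat -> nat) m (dn dp : int) : nat :=
  cut_ok dn dp *
  (if m is m'.+1 then
    let dn' := (dn + (g m == 0%N)%:Z - (f m == 0%N)%:Z)%R in
    let dp' := (dp + (f m == 2%N)%:Z - (g m == 2%N)%:Z)%R in
    ~~ pos_bad (f m) (g m) dn dp *
    (2 ^ (cut_nz dn dp && ~~ cut_nz dn' dp') * Wc f g m' dn' dp')
  else (dn == dp) * 2 ^ cut_nz dn dp).

Lemma Wc_notok f g m dn dp : ~~ cut_ok dn dp -> Wc f g m dn dp = 0.
Proof. by case: m => [|m] /= /negPf ->. Qed.

(** All four continuations of [Wt] carry the same net flow through the next cut, so only the number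
    of allowed ones matters: at most one, or two at the lowest crossed cut of a run. This is checked
    on all letters p, q, a, b. *)
Lemma Wt_Wc f g m p q : (forall x, f x <= 2) -> (forall x, g x <= 2) ->
  p <= 2 -> q <= 2 ->
  Wt f g m p q = Wc f g m ((q == 0%N)%:Z - (p == 0%N)%:Z)%R ((p == 2%N)%:Z - (q == 2%N)%:Z)%R.
Proof.
move=> hf hg; elim: m p q => [|m IH] p q.
  by case: p => [|[|[|]]] //; case: q => [|[|[|]]].
rewrite [Wt _ _ _ _ _]/= [Wc _ _ _ _ _]/=.
have := hf m.+1; have := hg m.+1; move: (f m.+1) (g m.+1) => a b hb ha hp hq.
rewrite !IH //.
have no dn dp : ~~ cut_ok dn dp -> Wc f g m dn dp = 0 by apply: Wc_notok.
by case: p hp => [|[|[|]]] // _; case: q hq => [|[|[|]]] // _;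
  case: a ha => [|[|[|]]] // _; case: b hb => [|[|[|]]] // _;
  rewrite /= ?mul0n ?mul1n ?addn0 ?add0n //; try (by rewrite no);
  rewrite ?expn1 ?mul2n -?addnn.
Qed.

Section ClosedForm.

Variables (f g : nat -> nat) (DN DP : nat -> int).

Definition flow_ok m : bool :=
  all (fun v => cut_ok (DN v) (DP v)) (iota 0 m.+1) &&
  all (fun v => ~~ pos_bad (f v) (g v) (DN v) (DP v)) (iota 1 m).

Definition nz v := cut_nz (DN v) (DP v).

Definition tops m := count (fun v => nz v && ~~ nz v.+1) (iota 0 m).

(** [Wc] doubles at the lowest cut of each run, the cut 0 included, while [tops] counts the runs by
    their last cut; a run still open at [m] is the extra [nz m]. *)
Lemma Wc_closed m : DN 0 = DP 0 ->
  (forall v, v < m -> DN v = (DN v.+1 + (g v.+1 == 0%N)%:Z - (f v.+1 == 0%N)%:Z)%R) ->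
  (forall v, v < m -> DP v = (DP v.+1 + (f v.+1 == 2%N)%:Z - (g v.+1 == 2%N)%:Z)%R) ->
  Wc f g m (DN m) (DP m) = flow_ok m * 2 ^ (tops m + nz m).
Proof.
move=> D0; elim: m => [|m IH] EN EP.
  by rewrite /= /flow_ok /tops /nz /= !andbT D0 eqxx mul1n add0n.
have E m' : iota 0 m'.+1 = rcons (iota 0 m') m' by rewrite -cats1 -addn1 iotaD.
have E1 m' : iota 1 m'.+1 = rcons (iota 1 m') m'.+1 by rewrite -cats1 -[in LHS](addn1 m') iotaD add1n.
have -> : flow_ok m.+1 = [&& cut_ok (DN m.+1) (DP m.+1),
    ~~ pos_bad (f m.+1) (g m.+1) (DN m.+1) (DP m.+1) & flow_ok m].
  rewrite /flow_ok (E m.+1) all_rcons (E1 m) all_rcons.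
  by case: (all _ (iota 0 m.+1)); case: (cut_ok _ _); rewrite ?andbF ?andbT.
have -> : tops m.+1 = tops m + (nz m && ~~ nz m.+1).
  by rewrite /tops E -cats1 count_cat /= addn0.
rewrite [Wc _ _ _ _ _]/= -EN // -EP // IH; first last.
- by move=> v hv; apply: EP; lia.
- by move=> v hv; apply: EN; lia.
rewrite -/(nz m.+1) -/(nz m).
case: (cut_ok _ _); case: (pos_bad _ _ _ _); case: (flow_ok m) => //=;
  rewrite ?mul0n ?mul1n ?muln0 //.
by case: (nz m.+1); case: (nz m); rewrite /= ?addn0 ?addn1 ?mul1n ?expnS ?expn0 ?mul1n.
Qed.

End ClosedForm.

(** * Entries of C(1) between words of partitions *)

Section PartitionEntries.

Variables (k n : nat).

Lemma good_Nc lam v : kstrict k lam -> good k n (tw k lam) -> n <= v -> Nc k lam v = 0.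
Proof.
move=> kl [_ gl] nv; have [V hV] := eventually_tail kl.
suff H d : forall v, n <= v -> V <= v + d -> Nc k lam v = 0 by apply: (H V); lia.
elim: d => [|d IH] {nv}v nv hv; first by rewrite (hV v _).1; lia.
rewrite (Nc_tw v kl) (IH v.+1) ?gl; try lia.
by rewrite /dflt; case: ifP.
Qed.

Lemma good_Lc lam v : kstrict k lam -> good k n (tw k lam) -> n <= v ->
  Lc k lam v = minn k v.
Proof.
move=> kl [_ gl] nv.
have run d : Lc k lam (n + d) = Lc k lam n + (minn k (n + d) - minn k n).
  elim: d => [|d IH]; first by rewrite addn0 subnn addn0.
  rewrite addnS (Lc_tw _ kl) IH gl; last lia.
  by rewrite /dflt; case: leqP => ?; lia.
have [V hV] := eventually_tail kl.
have l1 := Lc_lev kl n; have l2 := Lc_lek k lam n.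
have := run (V + k); rewrite (hV _ _).2; last lia.
by have := run (v - n); rewrite subnKC //; lia.
Qed.

Lemma cc0_wordof lam v : kstrict k lam -> good k n (tw k lam) -> v <= n ->
  cc k 0 (wordof k n lam) v = Nc k lam v.
Proof.
move=> kl gl vn; rewrite -(subKn vn); elim: (n - v) (leq_subr v n) => [|d IH] hd.
  by rewrite subn0 /cc subnn good_Nc.
have e : (n - d.+1).+1 = n - d by lia.
rewrite (Nc_tw (n - d.+1) kl) cc_rec ?e ?IH; try lia.
by rewrite extK //; lia.
Qed.

Lemma cc1_wordof lam v : kstrict k lam -> good k n (tw k lam) -> v <= n ->
  cc k 1 (wordof k n lam) v + Lc k lam v = minn k n.
Proof.
move=> kl gl vn; rewrite -(subKn vn); elim: (n - v) (leq_subr v n) => [|d IH] hd.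
  by rewrite subn0 /cc subnn good_Lc.
have e : (n - d.+1).+1 = n - d by lia.
have := Lc_tw (n - d.+1) kl; have := IH ltac:(lia).
rewrite (@cc_rec _ _ _ _ (n - d.+1)) ?e; try lia.
by rewrite extK //; lia.
Qed.

Variables (lam mu : seq nat).
Hypotheses (kl : kstrict k lam) (km : kstrict k mu).
Hypotheses (gl : good k n (tw k lam)) (gm : good k n (tw k mu)).

Lemma zero_cut_tail v : n <= v -> zero_cut k lam mu v.
Proof.
by move=> nv; rewrite /zero_cut /dP /dN !good_Nc // !good_Lc //; lia.
Qed.

Lemma changed_wordof v : v < n ->
  changed k (wordof k n lam) (wordof k n mu) v = ~~ zero_cut k lam mu v.
Proof.
move=> vn; rewrite /changed !cc0_wordof ?(ltnW vn) //.
have := cc1_wordof kl gl (ltnW vn); have := cc1_wordof km gm (ltnW vn).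
by rewrite /zero_cut /dP /dN; lia.
Qed.

Lemma dN_rec v : dN k lam mu v =
  (dN k lam mu v.+1 + (tw k lam v.+1 == 0%N)%:Z - (tw k mu v.+1 == 0%N)%:Z)%R.
Proof. by rewrite /dN; have := Nc_tw v kl; have := Nc_tw v km; lia. Qed.

Lemma dP_rec v : dP k lam mu v =
  (dP k lam mu v.+1 + (tw k mu v.+1 == 2%N)%:Z - (tw k lam v.+1 == 2%N)%:Z)%R.
Proof.
rewrite /dP /dN; have := tw_le2 k lam v.+1; have := tw_le2 k mu v.+1.
have := Nc_tw v kl; have := Nc_tw v km; have := Lc_tw v kl; have := Lc_tw v km; lia.
Qed.

Lemma cut_strip_flow : 0 < n -> cut_strip k lam mu <->
  flow_ok (tw k mu) (tw k lam) (dN k lam mu) (dP k lam mu) n.-1.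
Proof.
move=> n0; have zt v : n <= v -> dN k lam mu v = 0%R /\ dP k lam mu v = 0%R.
  by move=> /zero_cut_tail /andP[/eqP-> /eqP->].
rewrite /flow_ok prednK //; split.
  move=> [h1 h2 h3 h4]; apply/andP; split; apply/allP => v; rewrite mem_iota => hv.
    by rewrite /cut_ok; case: (h1 v) => ->; case: (h2 v) => ->.
  case: v hv => // v _; apply/negP => /orP[] /and4P[/eqP e1 /eqP e2 /eqP e3 /eqP e4].
    exact: (h3 v).
  exact: (h4 v).
move=> /andP[/allP h /allP h'].
have ok v : cut_ok (dN k lam mu v) (dP k lam mu v).
  have [nv|vn] := leqP n v; first by have [-> ->] := zt v nv.
  by apply: h; rewrite mem_iota.
have bad v : ~~ pos_bad (tw k mu v.+1) (tw k lam v.+1) (dN k lam mu v.+1) (dP k lam mu v.+1).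
  have [nv|vn] := leqP n v.+1.
    by have [-> ->] := zt v.+1 nv; rewrite /pos_bad !andbF.
  by apply: h'; rewrite mem_iota; lia.
split=> v.
- by have /andP[/orP[] /eqP-> _] := ok v; [left|right].
- by have /andP[_ /orP[] /eqP->] := ok v; [left|right].
- by move=> e1 e2 [e3 e4]; have := bad v; rewrite /pos_bad e1 e2 e3 e4.
- by move=> e1 e2 [e3 e4]; have := bad v; rewrite /pos_bad e1 e2 e3 e4 orbT.
Qed.

Lemma entry_Cmx_strip (R : comNzRingType) : 0 < n ->
  entry (Cmx (Xm k n R) n.-1 1%R) (wordof k n lam) (wordof k n mu) =
    (if flow_ok (tw k mu) (tw k lam) (dN k lam mu) (dP k lam mu) n.-1
     then (2 ^ strip_tops k lam mu n)%:R else 0)%R.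
Proof.
move=> n0; have nn : n.-1 < n by lia.
rewrite entry_Cmx1 // prednK //.
have -> : agree k n.+1 (wordof k n lam) (wordof k n mu).
  by apply/agreeP => x hx; rewrite !(ext_good k _).2 //; lia.
rewrite !extK // Wt_Wc; try exact: tw_le2.
have [zn zp] : dN k lam mu n = 0%R /\ dP k lam mu n = 0%R.
  by have /andP[/eqP-> /eqP->] := zero_cut_tail (leqnn n).
have eN := dN_rec n.-1; have eP := dP_rec n.-1; rewrite prednK // in eN eP.
have -> : ((tw k lam n == 0%N)%:Z - (tw k mu n == 0%N)%:Z)%R = dN k lam mu n.-1.
  by rewrite eN zn; lia.
have -> : ((tw k mu n == 2%N)%:Z - (tw k lam n == 2%N)%:Z)%R = dP k lam mu n.-1.
  by rewrite eP zp; lia.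
rewrite (@Wc_closed _ _ (dN k lam mu) (dP k lam mu)); first last.
- by move=> v _; exact: dP_rec.
- by move=> v _; exact: dN_rec.
- by rewrite /dP !Lc0 //; lia.
case: flow_ok => //; rewrite mul1n; congr (2 ^ _)%N%:R%R.
have E : iota 0 n = rcons (iota 0 n.-1) n.-1.
  by rewrite -{1}(prednK n0) -cats1 -[n.-1.+1]addn1 iotaD.
rewrite /strip_tops E -cats1 count_cat /tops /= addn0; congr (_ + _).
  by apply: eq_count => v /=; rewrite /nz /cut_nz negbK.
by rewrite prednK // (zero_cut_tail (leqnn n)) andbT.
Qed.

End PartitionEntries.

Lemma gtn_trans : transitive gtn.
Proof. exact: rev_trans ltn_trans. Qed.

Lemma gtn_irr : irreflexive gtn.
Proof. exact: ltnn. Qed.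

(** * Monotone words, x-strips and y-strips *)

Section Steps.

Variables (k n : nat).

Local Notation wd := (wordof k n).
Local Notation kg lam := (kstrict k lam /\ good k n (tw k lam)).

Lemma step_wordof a rho nu : kg rho -> kg nu -> a < n ->
  (step k a (wd rho) = Some (wd nu) <-> stepw a (tw k rho) (tw k nu)).
Proof. by move=> [_ gr] [_ gn] an; rewrite (stepP k _ _ an) !extK. Qed.

Lemma step_back a s nu : kg nu -> a < n -> step k a s = Some (wd nu) ->
  exists rho, [/\ kg rho, s = wd rho & sumn nu = (sumn rho).+1].
Proof.
move=> [kn gn] an st; have sw := (stepP k _ _ an).1 st; rewrite extK // in sw.
have ds : desw a (tw k nu).
  case: a an sw {st} => [|a] an; first by case=> _ /= ->.
  by case=> lt e /=; rewrite !e // swapw_l swapw_r.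
have [rho [kr sw' [c0 c00 cE]]] := rembox kn ds.
have gr : good k n (tw k rho).
  by apply: (good_step k an sw').2 => // [v|]; [exact: tw_le2 | exact: tw0].
exists rho; split=> //; last exact: sumn_box c00 cE.
by apply: (step_inj an st); apply/step_wordof.
Qed.

Section Graded.

Variable R : comNzRingType.

Local Open Scope ring_scope.

Lemma entry_reach l (x : R) s t : all (fun v => v < n)%N l ->
  entry (Hprod k n l x) s t != 0 ->
  exists2 p, all (fun v => v < n)%N p & wactn k p t = Some s.
Proof.
elim: l s => [|v l IH] s /=.
  move=> _; rewrite /Hprod big_nil entry1; case: (s =P t) => [->|]; last by rewrite eqxx.
  by exists [::].
move=> /andP[vn ln]; rewrite /Hprod big_cons entry_hfac_l // -/(Hprod k n l x).
have [->|ne _] := eqVneq (entry (Hprod k n l x) s t) 0; last exact: IH ne.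
rewrite add0r; case: pickP => [r /eqP hr|_]; last by rewrite mulr0 eqxx.
have [->|ne _] := eqVneq (entry (Hprod k n l x) r t) 0; first by rewrite mulr0 eqxx.
by have [p pn ap] := IH r ln ne; exists (v :: p); rewrite /= ?vn // ap.
Qed.

(** Every step adds one box. The vanishing clause is carried along because the truncated difference
    of sizes would otherwise give a wrong exponent in the induction. *)
Lemma entry_graded l (x : R) nu rho : all (fun v => v < n)%N l -> kg nu -> kg rho ->
  entry (Hprod k n l x) (wd nu) (wd rho) =
    x ^+ (sumn nu - sumn rho) * entry (Hprod k n l 1) (wd nu) (wd rho) /\
  ((sumn nu < sumn rho)%N -> entry (Hprod k n l x) (wd nu) (wd rho) = 0).
Proof.
move=> + + kgr; elim: l nu => [|v l IH] nu /=.
  move=> _ [kn gn]; have [kr gr] := kgr; rewrite /Hprod !big_nil entry1; case: eqP.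
    by move=> /(wordof_inj kn kr gn gr)->; rewrite subnn mul1r ltnn.
  by rewrite mulr0.
move=> /andP[vn ln] kgn; rewrite /Hprod !big_cons !entry_hfac_l // -/(Hprod k n l x).
rewrite -/(Hprod k n l 1); have [IH1 IH2] := IH nu ln kgn.
case: pickP => [r /eqP hr|_]; last first.
  by rewrite !mulr0 !addr0; split.
have [nu1 [kg1 rE sE]] := step_back kgn vn hr.
have [IH3 IH4] := IH nu1 ln kg1; rewrite rE mul1r; split; last first.
  by move=> lt; rewrite IH2 // IH4 ?mulr0 ?addr0 //; lia.
rewrite IH1 mulrDr; congr (_ + _).
have [lt|le] := ltnP (sumn nu1) (sumn rho).
  have z0 := IH4 lt; have := z0; rewrite IH3.
  have -> : (sumn nu1 - sumn rho)%N = 0%N by lia.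
  by rewrite expr0 mul1r => ->; rewrite !mulr0.
by rewrite IH3 mulrA -exprS; congr (x ^+ _ * _); lia.
Qed.

End Graded.

(* [L] is the order in which the simple reflections occur in the word. *)
Definition rstrip (L : seq nat) nu rho : Prop :=
  wactn k [seq v <- L | changed k (wd nu) (wd rho) v] (wd rho) = Some (wd nu).

Section Ordered.

Variables (L : seq nat) (r : rel nat).
Hypotheses (Lperm : perm_eq L (iota 0 n)) (Lsort : sorted r L).
Hypotheses (rtr : transitive r) (rirr : irreflexive r).

Lemma L_mem v : (v \in L) = (v < n).
Proof. by rewrite (perm_mem Lperm) mem_iota. Qed.

Lemma L_all (P : pred nat) : all (fun v => v < n) [seq v <- L | P v].
Proof. by apply/allP => v; rewrite mem_filter L_mem => /andP[]. Qed.

Lemma L_uniq (P : pred nat) : uniq [seq v <- L | P v].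
Proof. by rewrite filter_uniq // (perm_uniq Lperm) iota_uniq. Qed.

(** The letters used are forced to be the crossed cuts, so restricting the list to [v >= i] amounts
    to requiring that no cut below [i] be crossed. *)
Lemma entry_flagged (R : comNzRingType) i (x : R) nu rho : kg nu -> kg rho ->
  entry (Hprod k n [seq v <- L | i <= v] x) (wd nu) (wd rho) =
  (x ^+ (sumn nu - sumn rho) *
    (`[< rstrip L nu rho /\ forall v, (v < i)%N -> zero_cut k nu rho v >])%:R)%R.
Proof.
move=> kgn kgr; have [kn gn] := kgn; have [kr gr] := kgr.
rewrite (entry_graded _ _ kgn kgr).1 ?L_all //; congr (_ * _)%R.
rewrite entry_Hprod ?L_all ?L_uniq //= GRing.expr1n GRing.mul1r.
congr (nat_of_bool _)%:R%R; apply/eqP/asboolP.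
  have fa := L_all (fun v => changed k (wd nu) (wd rho) v && (i <= v)).
  have fu := L_uniq (fun v => changed k (wd nu) (wd rho) v && (i <= v)).
  rewrite -filter_predI => E.
  have ch := wactn_changed fa fu E.
  have chi v : changed k (wd nu) (wd rho) v -> i <= v.
    by rewrite ch mem_filter => /andP[/andP[]].
  split.
    rewrite /rstrip -[RHS]E; congr wactn; apply: eq_filter => v /=.
    by case c: changed => //=; rewrite chi.
  move=> v vi; have [nv|vn] := leqP n v; first exact: (zero_cut_tail kn kr gn gr).
  by have := changed_wordof kn kr gn gr vn; case: zero_cut => //= /chi; lia.
move=> [rs zc]; rewrite -filter_predI -[RHS]rs; congr wactn.
apply: eq_in_filter => v; rewrite L_mem => vn /=.
case c: changed => //=; rewrite leqNgt; apply/negP => /zc.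
by have := changed_wordof kn kr gn gr vn; rewrite c => /esym/negbTE->.
Qed.

Lemma rstrip_sorted nu rho p : kg nu -> kg rho -> sorted r p -> all (fun v => v < n) p ->
  uniq p -> wactn k p (wd rho) = Some (wd nu) -> rstrip L nu rho.
Proof.
move=> kgn kgr sp pn up E; have ch := wactn_changed pn up E.
rewrite /rstrip -[RHS]E; congr wactn.
apply: (irr_sorted_eq rtr rirr) => //; first exact: sorted_filter.
move=> v; rewrite mem_filter L_mem ch; case vp: (v \in p) => //=.
by have := allP pn v vp.
Qed.

Lemma word_additive nu rho (p : seq nat) : kg nu -> kg rho -> all (fun v => v < n) p ->
    wactn k p (wd rho) = Some (wd nu) ->
  [/\ kgrass k nu = (word_prod p * kgrass k rho)%g,
      forall m, n <= m -> ninv m (kgrass k nu) = size p + ninv m (kgrass k rho)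
    & forall m, n <= m -> ninv m (word_prod p) = size p].
Proof.
move=> [kn gn] [kr gr] pn E.
have [q qE] : exists q : seq 'I_n, map val q = p.
  elim: p pn {E} => [|i p IH] /=; first by exists [::].
  by case/andP=> im /IH[q <-]; exists (Ordinal im :: q).
rewrite -qE -wactE in E; have [nu' [[kn' gn' nE ke _] [_ hl]]] := act_forward kr gr E.
have nn := wordof_inj kn kn' gn gn' nE; rewrite -nn /rw qE in ke hl.
have sz : size q = size p by rewrite -qE size_map.
split=> // m nm; first by rewrite hl // sz addnC.
have pm : all (fun v => v < m) p by apply: sub_all pn => v; lia.
apply/eqP; rewrite eqn_leq ninv_word //=.
have hw : W m (word_prod p) by apply: W_word.
have [b [b1 b2 b3]] := reduced_word_exists hw.
have := ninv_mul_word (kgrass k rho) b1; rewrite b2 -ke hl // b3 sz; lia.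
Qed.

(** C(1) over the integers is a product of two matrices with nonnegative entries. A monotone word
    contributes 1 through the half of its own direction while the other half acts trivially, so the
    entry is nonzero and the flow conditions hold. *)
Lemma rstrip_horizontal nu rho : kg nu -> kg rho -> 0 < n ->
  (exists2 p, all (fun v => v < n) p & (sorted gtn p \/ sorted ltn p) /\
     wactn k p (wd rho) = Some (wd nu)) ->
  k_horizontal_strip k (diag nu) (diag rho).
Proof.
move=> kgn kgr n0 [p pn [sp E]]; have [kn gn] := kgn; have [kr gr] := kgr.
apply/(horizontal_strip_cut kn kr)/(cut_strip_flow kn kr gn gr n0).
have := entry_Cmx_strip kn kr gn gr int n0; case: flow_ok => //.
have -> : Cmx (Xm k n int) n.-1 (1%R : int) =
    Hprod k n (rev (iota 0 n) ++ iota 0 n) (1%R : int).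
  by rewrite Cmx_Hprod (_ : iota 0 n.-1.+1 = iota 0 n) // prednK.
rewrite /Hprod big_cat /=.
rewrite -/(Hprod k n (rev (iota 0 n)) (1%R : int)) -/(Hprod k n (iota 0 n) (1%R : int)) entryM.
have ia : all (fun v => v < n) (iota 0 n) by apply/allP => v; rewrite mem_iota.
have ra : all (fun v => v < n) (rev (iota 0 n)) by rewrite all_rev.
have iu := iota_uniq 0 n; have ru : uniq (rev (iota 0 n)) by rewrite rev_uniq.
have up : uniq p.
  by case: sp => sp; [apply: (sorted_uniq gtn_trans gtn_irr) | apply: (sorted_uniq ltn_trans ltnn)].
have ch := wactn_changed pn up E.
have self l t : all (fun v => v < n) l -> uniq l ->
    entry (Hprod k n l (1%R : int)) t t = 1%R.
  move=> la lu; rewrite entry_Hprod //= (eq_filter (a2 := pred0)) ?filter_pred0 /= ?eqxx //.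
  by move=> v /=; rewrite /changed !eqxx.
(* The intermediate word: the increasing half acts first, so it does nothing when [p] is decreasing
   and everything otherwise. *)
pose t0 := if sorted gtn p then wd rho else wd nu.
have pos l s t : all (fun v => v < n) l -> uniq l ->
    (0 <= entry (Hprod k n l (1%R : int)) s t)%R.
  by move=> la lu; rewrite entry_Hprod //= GRing.expr1n GRing.mul1r; case: eqP.
have one l : all (fun v => v < n) l -> uniq l -> [seq v <- l | v \in p] = p ->
    entry (Hprod k n l (1%R : int)) (wd nu) (wd rho) = 1%R.
  move=> la lu lp; rewrite entry_Hprod //= (eq_filter ch) lp E eqxx.
  by rewrite GRing.expr1n GRing.mul1r.
rewrite (bigD1 t0) //=; set rest := (\sum_(_ | _) _)%R.
have hrest : (0 <= rest)%R by apply: sumr_ge0 => t _; apply: mulr_ge0; apply: pos.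
suff -> : (entry (Hprod k n (rev (iota 0 n)) (1%R : int)) (wd nu) t0 *
           entry (Hprod k n (iota 0 n) (1%R : int)) t0 (wd rho) = 1)%R.
  by move=> e; move: (ltr_pwDl ltr01 hrest); rewrite e ltxx.
have memp (l : seq nat) : l =i iota 0 n -> [seq v <- l | v \in p] =i p.
  move=> El v; rewrite mem_filter El mem_iota; case vp: (v \in p) => //=.
  exact: (allP pn v vp).
rewrite /t0; case: ifP => s1.
  rewrite self // one //; apply: (irr_sorted_eq gtn_trans gtn_irr) => //.
  - by apply: sorted_filter; [exact: gtn_trans | rewrite rev_sorted; exact: iota_ltn_sorted].
  - by apply: memp => v; rewrite mem_rev.
rewrite self // one //; apply: (irr_sorted_eq ltn_trans ltnn) => //.
- by apply: sorted_filter; [exact: ltn_trans | exact: iota_ltn_sorted].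
- by case: sp => //; rewrite s1.
- exact: memp.
Qed.

(** A horizontal strip has a nonzero entry of C(1), hence some word leads from [rho] to [nu] and
    lengths add up. The given monotone reduced word then acts as well, and its letters are the
    crossed cuts; that they are all at least 1 means that the cut 0 is not crossed. *)
Lemma strip_rstrip nu rho : kg nu -> kg rho -> 0 < n ->
    (r = gtn \/ r = ltn) ->
  (k_horizontal_strip k (diag nu) (diag rho) /\
    exists a : seq nat, [/\ reduced_word a (kgrass k nu * (kgrass k rho)^-1)%g, sorted r a
      & all (fun i => (1 <= i < n)%N) a]) <->
  rstrip L nu rho /\ zero_cut k nu rho 0.
Proof.
move=> kgn kgr n0 hr; have [kn gn] := kgn; have [kr gr] := kgr; split.
  move=> [hs [a [[aw ar] sa aa]]].
  have an : all (fun v => v < n) a by apply: sub_all aa => v /andP[].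
  have ua : uniq a by apply: sorted_uniq sa.
  have fl := (cut_strip_flow kn kr gn gr n0).1 ((horizontal_strip_cut kn kr).1 hs).
  have ne : (entry (Hprod k n (rev (iota 0 n) ++ iota 0 n) (1%R : int)) (wd nu) (wd rho) != 0)%R.
    have := entry_Cmx_strip kn kr gn gr int n0; rewrite fl Cmx_Hprod.
    have -> : iota 0 n.-1.+1 = iota 0 n by rewrite prednK.
    by move=> ->; rewrite pnatr_eq0 expn_eq0.
  have [|q qn Eq] := entry_reach _ ne.
    by rewrite all_cat all_rev andbb; apply/allP => v; rewrite mem_iota.
  have [E1 E2 E3] := word_additive kgn kgr qn Eq.
  have wq : (kgrass k nu * (kgrass k rho)^-1)%g = word_prod q by rewrite E1 mulgK.
  have Wq : W n (word_prod q) by apply: W_word.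
  have sz : size a = size q by rewrite ar wq (sp_lengthE Wq) E3.
  have [b bE] : exists b : seq 'I_n, map val b = a.
    elim: a an {aw ar sa aa ua sz} => [|i p IH] /=; first by exists [::].
    by case/andP=> im /IH[b <-]; exists (Ordinal im :: b).
  have Ea : wactn k a (wd rho) = Some (wd nu).
    have [||rho' [kr' gr' e ac]] := @act_backward k n n b (kgrass k rho) nu kn gn (leqnn n).
    - by rewrite /rw bE aw mulgVK.
    - by rewrite E2 // -sz -bE size_map.
    by rewrite -bE -wactE (kgrass_inj kr kr' e).
  split; first exact: rstrip_sorted Ea.
  have := changed_wordof kn kr gn gr n0; rewrite (wactn_changed an ua Ea).
  by case z: zero_cut => //= /(allP aa).
move=> [rs z0]; pose p := [seq v <- L | changed k (wd nu) (wd rho) v].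
have pn : all (fun v => v < n) p := L_all _.
have sp : sorted r p by apply: sorted_filter.
split.
  apply: rstrip_horizontal => //; exists p => //; split=> //.
  by case: hr sp => ->; [left|right].
have [E1 E2 E3] := word_additive kgn kgr pn rs.
have wq : (kgrass k nu * (kgrass k rho)^-1)%g = word_prod p by rewrite E1 mulgK.
have Wq : W n (word_prod p) by apply: W_word.
exists p; split=> //.
  by rewrite wq /reduced_word (sp_lengthE Wq) E3.
apply/allP => v vp; have vn := allP pn v vp; rewrite vn andbT lt0n.
apply/negP => /eqP v0; move: vp; rewrite mem_filter v0.
by rewrite (changed_wordof kn kr gn gr n0) z0.
Qed.

End Ordered.

Lemma x_strip_rstrip nu rho : kg nu -> kg rho -> 0 < n ->
  x_strip n k nu rho <-> rstrip (rev (iota 0 n)) nu rho /\ zero_cut k nu rho 0.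
Proof.
move=> kgn kgr n0; apply: (@strip_rstrip _ gtn) => //; last by left.
- by rewrite perm_rev.
- by rewrite rev_sorted iota_ltn_sorted.
- exact: gtn_trans.
- exact: gtn_irr.
Qed.

Lemma y_strip_rstrip nu rho : kg nu -> kg rho -> 0 < n ->
  y_strip n k nu rho <-> rstrip (iota 0 n) nu rho /\ zero_cut k nu rho 0.
Proof.
move=> kgn kgr n0; apply: (@strip_rstrip _ ltn) => //; last by right.
- exact: iota_ltn_sorted.
- by move=> a b c /=; lia.
Qed.

Lemma wactn_untouched p (t s : word n) x : all (fun v => v < n) p -> wactn k p t = Some s ->
  0 < x -> x \notin p -> x.-1 \notin p -> ext k s x = ext k t x.
Proof.
move=> + + x0; elim: p s => [|v p IH] s /=; first by move=> _ [->].
move=> /andP[vn pn]; case E: (wactn k p t) => [u|] //= st.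
rewrite !inE !negb_or => /andP[xv xp] /andP[xv' xp']; rewrite -(IH u) //.
have := (stepP k _ _ vn).1 st; case: v vn st xv xv' => [|v] vn st xv xv'.
  by case=> _ _; apply; clear - x0 xv'; lia.
case=> _ ->; rewrite ?swapw_o //; clear - x0 xv xv'; lia.
Qed.

(* In an increasing word each letter passes a nonzero cut at most once. *)
Lemma rstrip_inc nu rho v : kg nu -> kg rho -> rstrip (iota 0 n) nu rho ->
  0 < v < n -> ~~ zero_cut k nu rho v -> tw k nu v.+1 = tw k rho v.
Proof.
move=> [kn gn] [kr gr] rs hv nz; have vn : v < n by lia.
pose P := changed k (wd nu) (wd rho).
have Pv : P v by rewrite /P changed_wordof.
have EI : iota 0 n = iota 0 v ++ v :: iota v.+1 (n - v.+1).
  by rewrite -[RHS](iotaD 0 v (n - v.+1).+1); congr iota; clear - vn; lia.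
move: rs; rewrite /rstrip EI filter_cat /= -/(P v) Pv /wactn foldr_cat /=.
set p2 := [seq _ <- iota v.+1 _ | _]; set p1 := [seq _ <- iota 0 v | _].
rewrite -/(wactn k p2 (wd rho)); case E2: (wactn k p2 (wd rho)) => [u2|] /=; last first.
  by have : forall l, foldr (fun v0 : nat => obind (step k v0)) (None : option (word n)) l = None;
     [elim=> //= ? ? -> | move->].
case E1: (step k v u2) => [u1|] /=; last first.
  by have : forall l, foldr (fun v0 : nat => obind (step k v0)) (None : option (word n)) l = None;
     [elim=> //= ? ? -> | move->].
rewrite -/(wactn k p1 u1) => E0.
have h0 : ext k (wd nu) v.+1 = ext k u1 v.+1.
  apply: wactn_untouched E0 _ _ _ => //.
  - by apply/allP => y; rewrite mem_filter mem_iota; lia.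
  - by rewrite mem_filter mem_iota; lia.
  - by rewrite mem_filter mem_iota /=; lia.
have h1 : ext k u1 v.+1 = ext k u2 v.
  have := (stepP k _ _ vn).1 E1; case: v hv vn {EI Pv p1 p2 E0 E1 E2 h0 nz} => // v hv vn.
  by case=> _ ->; rewrite ?swapw_r.
have h2 : ext k u2 v = ext k (wd rho) v.
  apply: wactn_untouched E2 _ _ _ => //.
  - by apply/allP => y; rewrite mem_filter mem_iota; lia.
  - by lia.
  - by rewrite mem_filter mem_iota; lia.
  - by rewrite mem_filter mem_iota; lia.
by move: h0; rewrite h1 h2 !extK.
Qed.

End Steps.

(** * The matrix attached to a letter of the alphabet *)

Section Letters.

Variables (k n : nat).
Hypothesis n0 : 0 < n.

Local Notation wd := (wordof k n).
Local Notation kg lam := (kstrict k lam /\ good k n (tw k lam)).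

Definition letter_matrix (R : comNzRingType) (om : letter -> R) (a : letter) :=
  match a with
  | Primed i => Hprod k n (rev [seq v <- iota 0 n | i <= v]) (om a)
  | Plain i => Cmx (Xm k n R) n.-1 (om a)
  | DPrimed i => Hprod k n [seq v <- iota 0 n | i <= v] (om a)
  end.

Definition letter_step (a : letter) (nu rho : seq nat) : Prop :=
  match a with
  | Primed i => rstrip k n (rev (iota 0 n)) nu rho /\
                forall v, v < i -> zero_cut k nu rho v
  | Plain _ => cut_strip k nu rho
  | DPrimed i => rstrip k n (iota 0 n) nu rho /\
                 forall v, v < i -> zero_cut k nu rho v
  end.

Definition letter_pow (a : letter) (nu rho : seq nat) : nat :=
  if a is Plain _ then n_strip k (diag nu) (diag rho) else 0.

Lemma iota_lt : all (fun v => v < n) (iota 0 n).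
Proof. by apply/allP => v; rewrite mem_iota. Qed.

Section Weights.

Variables (R : comNzRingType) (om : letter -> R).

Lemma Cmx_word (x : R) :
  Cmx (Xm k n R) n.-1 x = Hprod k n (rev (iota 0 n) ++ iota 0 n) x.
Proof. by rewrite Cmx_Hprod (_ : iota 0 n.-1.+1 = iota 0 n) // prednK. Qed.

Lemma Cmx_word_lt : all (fun v => v < n) (rev (iota 0 n) ++ iota 0 n).
Proof. by rewrite all_cat all_rev iota_lt. Qed.

Lemma entry_letter a nu rho : kg nu -> kg rho ->
  (entry (letter_matrix om a) (wd nu) (wd rho) =
     (`[< letter_step a nu rho >])%:R *
     (2 ^+ letter_pow a nu rho * om a ^+ (sumn nu - sumn rho)))%R.
Proof.
move=> kgn kgr; case: a => i /=.
- rewrite -filter_rev (entry_flagged (r := gtn)) ?expr0 //; first by rewrite mul1r mulrC.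
  + by rewrite perm_rev.
  + by rewrite rev_sorted iota_ltn_sorted.
- have [kn gn] := kgn; have [kr gr] := kgr.
  rewrite Cmx_word (entry_graded _ _ kgn kgr).1 ?Cmx_word_lt // -Cmx_word.
  rewrite (entry_Cmx_strip kn kr gn gr) // mulrC.
  have E : `[< cut_strip k nu rho >] =
      flow_ok (tw k rho) (tw k nu) (dN k nu rho) (dP k nu rho) n.-1.
    by apply/asboolP/idP => /(cut_strip_flow kn kr gn gr n0).
  rewrite -E; case: asboolP => cs; last by rewrite !mul0r.
  rewrite mul1r -natrX (n_strip_tops kn kr cs (n := n)) //.
  exact: zero_cut_tail kn kr gn gr.
- rewrite (entry_flagged (r := ltn)) ?expr0 //; first by rewrite mul1r mulrC.
  exact: iota_ltn_sorted.
Qed.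

Lemma entry_letter_reach a rho s : kg rho ->
    entry (letter_matrix om a) s (wd rho) <> 0%R ->
  exists nu, [/\ kg nu, s = wd nu &
    forall c, 0 < c -> col_length rho c <= col_length nu c].
Proof.
move=> [kr gr] /eqP ne.
have [p pn] : exists2 p, all (fun v => v < n) p & wactn k p (wd rho) = Some s.
  case: a ne => i /=; rewrite ?Cmx_word; apply: entry_reach; rewrite ?Cmx_word_lt ?all_rev //.
  1,2: by apply/allP => v; rewrite mem_filter mem_iota => /andP[].
have [q <-] : exists q : seq 'I_n, map val q = p.
  elim: p pn => [|i p IH] /=; first by exists [::].
  by case/andP=> im /IH[q <-]; exists (Ordinal im :: q).
by rewrite -wactE => /(act_forward kr gr)[nu [[kn gn -> _ _] [cE _]]]; exists nu.
Qed.

End Weights.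

Definition alphabet N : seq letter :=
  [seq Primed i | i <- rev (iota 1 n.-1)] ++ [seq Plain i | i <- iota 1 N] ++
  [seq DPrimed i | i <- iota 1 n.-1].

Section Product.

Variables (R : comNzRingType) (x y z : nat -> R).

Let om (a : letter) : R :=
  match a with Primed i => x i | Plain i => z i | DPrimed i => (- y i)%R end.

Lemma Phi_product N :
  (Phi k ((\prod_(i <- rev (iota 1 n.-1)) Atilde_prod n i (y i)) *
         (\prod_(i <- iota 1 N) C_prod n (z i)) *
         (\prod_(i <- iota 1 n.-1) A_prod n i (x i))) =
   \prod_(a <- rev (alphabet N)) letter_matrix om a)%R.
Proof.
rewrite !PhiM !Phi_prod /alphabet !rev_cat !big_cat /= -!map_rev revK !big_map.
congr (_ * _ * _)%R.
- by apply: eq_bigr => i _; rewrite Phi_Atilde_prod.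
- transitivity (\prod_(i <- iota 1 N) letter_matrix om (Plain i))%R.
    by apply: eq_bigr => i _; rewrite Phi_C_prod.
  (* The C(z_i) commute, so their order can be reversed. *)
  elim: (iota 1 N) => [|i l IH]; first by rewrite !big_nil.
  rewrite rev_cons big_rcons -IH big_cons /=.
  elim: l {IH} => [|j l IH]; first by rewrite !big_nil mulr1 mul1r.
  by rewrite !big_cons mulrA /= Cmx_commX -mulrA IH mulrA.
by apply: eq_bigr => i _; rewrite Phi_A_prod.
Qed.

End Product.

Lemma schubert_entry lam mu N : kstrict k lam -> kstrict k mu ->
    W n (kgrass k lam) -> compatible_pair k lam mu ->
  schubert_C_trunc n (kgrass k lam * (kgrass k mu)^-1)%g N =
    entry (\prod_(a <- rev (alphabet N)) letter_matrix letter_weight a)%R (wd lam) (wd mu).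
Proof.
move=> kl km hl cp; rewrite /schubert_C_trunc (nilcox_coef_phi kl km hl cp) -entry_Phi.
by rewrite (Phi_product var_x var_y var_z).
Qed.

End Letters.

(** * Bounds on the entries of a tableau *)

Lemma kgrass_left k lam j : kstrict k lam -> 0 < j <= k -> exists x,
  [/\ kgrass k lam j = Posz x.+1, fc k lam x.+1 = gc k lam j,
      Nc k lam x = Nc k lam x.+1, Lc k lam x.+1 = j & Lc k lam x = j.-1].
Proof.
move=> kl hj; have [x [fx L1 L0 t1]] := Lpos kl hj; exists x; split=> //.
  have := kgrass_inv kl (ltn0Sn x); rewrite /uinv t1 L1 => <-.
  by rewrite sp_inv_funK.
by case: (tw_cases kl x) => -[]; rewrite t1.
Qed.

Lemma zero_cutP k nu rho v : zero_cut k nu rho v <->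
  Nc k nu v = Nc k rho v /\ Lc k nu v = Lc k rho v.
Proof.
rewrite /zero_cut /dP /dN; split; first by move=> /andP[/eqP h1 /eqP h2]; lia.
by move=> [-> ->]; apply/andP; split; apply/eqP; lia.
Qed.

Lemma zero_cut_trans k a b c v :
  zero_cut k a b v -> zero_cut k b c v -> zero_cut k a c v.
Proof. by move=> /zero_cutP[h1 h2] /zero_cutP[h3 h4]; apply/zero_cutP; split; congruence. Qed.

Lemma zero_cut_refl k a v : zero_cut k a a v.
Proof. exact/zero_cutP. Qed.

Section Bounds.

Variables (k i : nat) (alpha beta : seq nat).
Hypotheses (ka : kstrict k alpha) (kb : kstrict k beta).

Lemma skew_col r c : (diag alpha `\` diag beta)%classic (r, c) ->
  [/\ 0 < c, col_length beta c < r & r <= col_length alpha c].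
Proof. by move=> /(skewP ka kb) /= [h1 /andP[h2 h3]]. Qed.

(** If the cut [part beta r - k] is uncrossed, [alpha] and [beta] have equal columns just after the
    end of row [r] of [beta], so row [r] has gained no box. *)
Lemma primed_row_bound r c : (forall v, v < i -> zero_cut k alpha beta v) ->
    (diag alpha `\` diag beta)%classic (r, c) -> r <= num_large k beta ->
  i <= part beta r - k.
Proof.
move=> zc /skew_col[c0 hb ha] rl; rewrite leqNgt; apply/negP => lt.
have r0 : 0 < r by lia.
have pl : k < part beta r by rewrite (part_col (kstrict_part kb)) // -num_large_col.
have /zero_cutP[e _] := zc _ lt; move: e; rewrite /Nc subnKC ?(ltnW pl) // => e.
have h1 : col_length beta (part beta r).+1 < r.
  by rewrite ltnNge -(part_col (kstrict_part kb)) // ltnn.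
have h2 : part beta r < c.
  by rewrite ltnNge (part_col (kstrict_part kb)) // -ltnNge.
by have := col_anti alpha h2; lia.
Qed.

(** w_beta(j) is the position of the [j]-th letter 1. If the cut right after it is uncrossed,
    [alpha] has the same counts there and [gc j] has not increased. *)
Lemma primed_column_bound r j : 0 < j <= k ->
    (forall v, v < i -> zero_cut k alpha beta v) ->
    (diag alpha `\` diag beta)%classic (r, k + 1 - j) ->
  i <= `|kgrass k beta j|.
Proof.
move=> hj zc /skew_col[_ hb ha]; have [x [-> fx _ L1 _]] := kgrass_left kb hj.
rewrite absz_nat leqNgt; apply/negP => /zc /zero_cutP[e1 e2].
have : gc k alpha j <= fc k alpha x.+1 by rewrite -Lc_geq // e2 L1.
by rewrite /fc e1 -/(fc k beta x.+1) fx /gc; lia.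
Qed.

(** Here the relevant cut is the one just before the letter 0 at [part alpha r - k], whence the
    extra 1 in the bound; the same shift occurs for columns below. *)
Lemma dprimed_row_bound r c : (forall v, v < i -> zero_cut k alpha beta v) ->
    (diag alpha `\` diag beta)%classic (r, c) -> r <= num_large k alpha ->
  i <= part alpha r - k - 1.
Proof.
move=> zc /skew_col[c0 hb ha] rl; rewrite leqNgt; apply/negP => lt.
have r0 : 0 < r by lia.
have pl : k < part alpha r by rewrite (part_col (kstrict_part ka)) // -num_large_col.
have /zero_cutP[e _] := zc _ lt; move: e; rewrite /Nc.
have -> : (k + (part alpha r - k - 1)).+1 = part alpha r by clear - pl; lia.
have h1 : r <= col_length alpha (part alpha r).
  by rewrite -(part_col (kstrict_part ka)) //; lia.
have h2 : c <= part alpha r by rewrite (part_col (kstrict_part ka)).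
by have := col_anti beta h2; lia.
Qed.

Lemma dprimed_column_bound r j : 0 < j <= k ->
    (forall v, v < i -> zero_cut k alpha beta v) ->
    (diag alpha `\` diag beta)%classic (r, k + 1 - j) ->
  i <= `|kgrass k alpha j| - 1.
Proof.
move=> hj zc /skew_col[_ hb ha]; have [x [-> fx nx L1 L0]] := kgrass_left ka hj.
rewrite absz_nat subn1 leqNgt; apply/negP => /zc /zero_cutP[e1 e2].
have : fc k beta x < gc k beta j by rewrite ltnNge -Lc_geq // -e2 /= L0; lia.
by rewrite /fc -e1 /= nx; move: fx; rewrite /fc /gc; lia.
Qed.

End Bounds.

Lemma gc_col k nu rho j : gc k rho j < gc k nu j ->
  col_length rho (k + 1 - j) < col_length nu (k + 1 - j).
Proof. by rewrite /gc; lia. Qed.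

(* A crossed cut [v < i] yields a box that violates one of the two bounds. *)
Lemma primed_bounds_zero k i nu rho mu : kstrict k nu -> kstrict k rho -> kstrict k mu ->
    cut_strip k nu rho -> (forall v, v < i -> zero_cut k rho mu v) ->
    zero_cut k nu mu 0 ->
    (forall r c, (diag nu `\` diag rho)%classic (r, c) -> r <= num_large k mu ->
       i <= part mu r - k) ->
    (forall r j, 0 < j <= k -> (diag nu `\` diag rho)%classic (r, k + 1 - j) ->
       i <= `|kgrass k mu j|) ->
  forall v, v < i -> zero_cut k nu rho v.
Proof.
move=> kn kr km [h1 h2 _ _] zc z0 rb cb v vi.
have /zero_cutP[eN eL] := zc _ vi; have /zero_cutP[eN0 _] := z0.
case: (h1 v) => [d0|d1]; last first.
  have hr : Nc k nu v = (Nc k mu v).+1 by move: d1; rewrite /dN; lia.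
  have := rb (Nc k nu v) (k + v).+1.
  rewrite (skewP kn kr) /= -/(Nc k nu v) -/(Nc k rho v).
  have r0 : 0 < Nc k nu v by lia.
  have rl : Nc k nu v <= num_large k mu.
    have := Nc_anti kn (leq0n v); rewrite eN0 num_large_col.
    by rewrite /Nc addn0.
  move=> /(_ _ rl) h; have {}h : i <= part mu (Nc k nu v) - k by apply: h; lia.
  have : (k + v).+1 <= part mu (Nc k nu v) by lia.
  by rewrite (part_col (kstrict_part km)) // -/(Nc k mu v); lia.
case: (h2 v) => [p0|p1].
  by apply/zero_cutP; move: p0; rewrite /dP d0; move: d0; rewrite /dN; lia.
have hL : Lc k rho v = (Lc k nu v).+1 by move: p1; rewrite /dP d0; lia.
have hj : 0 < Lc k rho v <= k by rewrite Lc_lek hL.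
have g1 : gc k rho (Lc k rho v) <= fc k rho v by rewrite -Lc_geq.
have g2 : fc k nu v < gc k nu (Lc k rho v) by rewrite ltnNge -Lc_geq // hL ltnn.
have cc : col_length rho (k + 1 - Lc k rho v) < col_length nu (k + 1 - Lc k rho v).
  by apply: gc_col; move: d0 g1 g2; rewrite /dN /fc; lia.
have := cb (col_length nu (k + 1 - Lc k rho v)) _ hj.
rewrite (skewP kn kr) /= cc leqnn => h.
have {}h : i <= `|kgrass k mu (Lc k rho v)| by apply: h; split=> //; lia.
have [x [kx fx nx L1 L0]] := kgrass_left km hj.
have : x < v.
  rewrite ltnNge; apply/negP => vx; have := Lc_mono km vx.
  by rewrite L0 -eL; lia.
by move: h; rewrite kx absz_nat; lia.
Qed.

Section Increasing.

Variables (k n : nat) (nu rho : seq nat).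
Hypotheses (gn : kstrict k nu /\ good k n (tw k nu)).
Hypotheses (gr : kstrict k rho /\ good k n (tw k rho)).
Hypotheses (rs : rstrip k n (iota 0 n) nu rho) (cs : cut_strip k nu rho).

(** In an increasing word the larger reflections act first, so the letter crossing the cut [v] to
    the right is not moved again and sits at [v + 1] in [nu]. The induction goes down from the cut
    [n], and [rstrip_inc] together with the excluded positions rules out every other letter. *)
Lemma inc_letter v : 0 < v ->
  (dN k nu rho v = 1%R -> tw k nu v.+1 = 0) /\
  (dN k nu rho v = 0%R -> dP k nu rho v = 1%R -> tw k nu v.+1 = 1).
Proof.
have [kn g1] := gn; have [kr g2] := gr; have [h1 h2 h3 h4] := cs.
have [d] := ubnP (n - v); elim: d v => // d IH v dv v0.
have rN := dN_rec kn kr v; have rP := dP_rec kn kr v.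
have hn := tw_le2 k nu v.+1; have hr := tw_le2 k rho v.+1.
have next : ~~ zero_cut k nu rho v.+1 ->
  [/\ tw k nu v.+2 = tw k rho v.+1, dN k nu rho v.+1 = 1%R -> tw k nu v.+2 = 0
    & dN k nu rho v.+1 = 0%R -> dP k nu rho v.+1 = 1%R -> tw k nu v.+2 = 1].
  move=> nz; have vn : v.+1 < n.
    by rewrite ltnNge; apply: contraNN nz => nv; apply: (zero_cut_tail kn kr g1 g2).
  have [||i1 i2] := IH v.+1 => //; first by clear - dv vn; lia.
  by split=> //; apply: rstrip_inc rs _ nz.
rewrite /zero_cut in next.
have := h3 v; have := h4 v; have := h1 v.+1; have := h2 v.+1.
move: next rN rP; move: (dN k nu rho v.+1) (dP k nu rho v.+1) => N P.
clear - hn hr; move=> next rN rP H2 H1 H4 H3; split=> [e|e1 e2].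
  case: (eqVneq (tw k nu v.+1) 0) => // ne.
  have N1 : N = 1%R by case: H1; lia.
  have [|n1 n2 _] := next; first by rewrite N1.
  by have := n2 N1; rewrite n1 => e'; lia.
have n0 : tw k nu v.+1 <> 0.
  move=> e; case: H1 => e'; last by case: H2; lia.
  by apply: (H4 e); [lia | split=> //; case: H2; lia].
case: (eqVneq (tw k nu v.+1) 2) => [e|]; last by lia.
have P1 : P = 1%R by case: H2; lia.
have N0 : N = 0%R by case: H1; lia.
have [|n1 _ n2] := next; first by rewrite P1 andbF.
by have := n2 N0 P1; rewrite n1; lia.
Qed.

(** A crossed cut [v < i] has a letter 0 or 1 of [nu] just after it by [inc_letter]; the row or
    column of that letter gained a box, and its bound puts the corresponding letter of [lam] too far
    right. *)
Lemma dprimed_bounds_zero i lam : kstrict k lam ->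
    (forall v, v <= i -> zero_cut k lam nu v) -> zero_cut k nu rho 0 ->
    (forall r c, (diag nu `\` diag rho)%classic (r, c) -> r <= num_large k lam ->
       i <= part lam r - k - 1) ->
    (forall r j, 0 < j <= k -> (diag nu `\` diag rho)%classic (r, k + 1 - j) ->
       i <= `|kgrass k lam j| - 1) ->
  forall v, v < i -> zero_cut k nu rho v.
Proof.
move=> kl zc z0 rb cb v vi; have [kn _] := gn; have [kr _] := gr.
have [->//|v0] := posnP v.
have [i1 i2] := inc_letter v0; have [h1 h2 _ _] := cs.
(* Read as [v.+1 <= i], the inequality [vi] gives the cut [v + 1], on the far side of the letter
   that crossed [v]. *)
have /zero_cutP[eN eL] := zc _ vi; have /zero_cutP[eN0 _] := zc 0 (leq0n i).
case: (h1 v) => [d0|d1]; last first.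
  have t := i1 d1; case: (tw_cases kn v) => -[]; rewrite t // => _ hN hL.
  have hr : Nc k nu v = (Nc k rho v).+1 by move: d1; rewrite /dN; lia.
  have := rb (Nc k nu v) (k + v).+1.
  rewrite (skewP kn kr) /= -/(Nc k nu v) -/(Nc k rho v).
  have r0 : 0 < Nc k nu v by lia.
  have rl : Nc k nu v <= num_large k lam.
    have := Nc_anti kn (leq0n v); rewrite -eN0 num_large_col.
    by rewrite /Nc addn0.
  move=> /(_ _ rl) h; have {}h : i <= part lam (Nc k nu v) - k - 1 by apply: h; lia.
  have : (k + v.+1).+1 <= part lam (Nc k nu v) by lia.
  by rewrite (part_col (kstrict_part kl)) // -/(Nc k lam v.+1); lia.
case: (h2 v) => [p0|p1].
  by apply/zero_cutP; move: p0; rewrite /dP d0; move: d0; rewrite /dN; lia.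
have t := i2 d0 p1; case: (tw_cases kn v) => -[]; rewrite t // => _ hN hL'.
have hL : Lc k rho v = (Lc k nu v).+1 by move: p1; rewrite /dP d0; lia.
have hj : 0 < Lc k rho v <= k by rewrite Lc_lek hL.
have g1 : gc k rho (Lc k rho v) <= fc k rho v by rewrite -Lc_geq.
have g2 : fc k nu v < gc k nu (Lc k rho v) by rewrite ltnNge -Lc_geq // hL ltnn.
have cc : col_length rho (k + 1 - Lc k rho v) < col_length nu (k + 1 - Lc k rho v).
  by apply: gc_col; move: d0 g1 g2; rewrite /dN /fc; lia.
have := cb (col_length nu (k + 1 - Lc k rho v)) _ hj.
rewrite (skewP kn kr) /= cc leqnn => h.
have {}h : i <= `|kgrass k lam (Lc k rho v)| - 1 by apply: h; split=> //; lia.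
have [x [kx fx nx L1 L0]] := kgrass_left kl hj.
have : x <= v.
  rewrite leqNgt; apply/negP => vx; have := Lc_mono kl vx.
  by rewrite L0 eL; lia.
by move: h; rewrite kx absz_nat; lia.
Qed.

End Increasing.

(** * Tableaux and chains of partitions *)

Lemma letter_le_refl : reflexive letter_le.
Proof. by case=> i /=. Qed.

Lemma letter_le_trans : transitive letter_le.
Proof. by case=> i [] j [] l //=; lia. Qed.

Lemma letter_le_anti a b : letter_le a b -> letter_le b a -> a = b.
Proof. by case: a b => i [] j //= h1 h2; congr (_ _); lia. Qed.

Lemma letter_lt_trans : transitive letter_lt.
Proof.
move=> b a c /andP[n1 l1] /andP[n2 l2]; rewrite /letter_lt (letter_le_trans l1 l2) andbT.
apply: contraNN n1 => /eqP e; apply/eqP; apply: letter_le_anti => //; by rewrite e.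
Qed.

Lemma letter_leNgt a b : letter_le a b = ~~ letter_lt b a.
Proof.
apply/idP/idP => [le|].
  by apply/negP => /andP[/eqP ne le']; apply: ne; apply: letter_le_anti.
rewrite /letter_lt negb_and negbK => /orP[/eqP->|]; first exact: letter_le_refl.
by case: a b => i [] j //=; lia.
Qed.

(** Beyond [n], [lam] has no letter 0 and the maximal number of letters 1. Nonnegative flows force
    the same counts on [nu], hence the default letters. *)
Lemma good_below k n lam nu : kstrict k lam -> kstrict k nu -> good k n (tw k lam) ->
  cut_strip k lam nu -> good k n (tw k nu).
Proof.
move=> kl kn gl [h1 h2 _ _].
have tail v : n <= v -> Nc k nu v = 0 /\ Lc k nu v = minn k v.
  move=> nv; have := good_Nc kl gl nv; have := good_Lc kl gl nv.
  have := Lc_lek k nu v; have := Lc_lev kn v.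
  by have := h1 v; have := h2 v; rewrite /dP /dN; lia.
split=> v; first exact: tw_le2.
case: v => [|v] hv; first exact: tw0.
have nv : n <= v by rewrite -ltnS ltnNge.
have [n1 l1] := tail v nv; have [n2 l2] := tail v.+1 (leqW nv).
rewrite /tw [v.+1.-1]/= n1 n2 l1 l2 eqxx /dflt /=.
by case: (leqP v.+1 k) => h; case: eqP => //=; lia.
Qed.

Lemma cut_strip_refl k nu : cut_strip k nu nu.
Proof.
have N v : dN k nu nu v = 0%R by rewrite /dN; lia.
have P v : dP k nu nu v = 0%R by rewrite /dP N; lia.
by split=> v; rewrite ?N ?P; auto; move=> _ _ [].
Qed.

Lemma diag_inj k nu rho : kstrict k nu -> kstrict k rho -> diag nu = diag rho -> nu = rho.
Proof.
move=> kn kr E; apply: (partition_col_inj (kstrict_part kn) (kstrict_part kr)) => c c0.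
have H r : r <= col_length nu c <-> r <= col_length rho c.
  have := diagE (r, c) kn; have := diagE (r, c) kr; rewrite E => /= -> e.
  have {}e : (0 < c /\ r <= col_length rho c) <-> (0 < c /\ r <= col_length nu c) by rewrite e.
  by split=> h; [have [] := e.2 (conj c0 h) | have [] := e.1 (conj c0 h)].
by have := (H (col_length nu c)).1; have := (H (col_length rho c)).2; lia.
Qed.

Definition letter_flags k (a : letter) (nu rho : seq nat) : Prop :=
  match a with
  | Primed i | DPrimed i => forall v, v < i -> zero_cut k nu rho v
  | Plain _ => True
  end.

Lemma rstrip_refl k n L nu : kstrict k nu -> good k n (tw k nu) -> rstrip k n L nu nu.
Proof.
by move=> kn gn; rewrite /rstrip (eq_filter (a2 := pred0)) ?filter_pred0 // => v;
  rewrite /changed !eqxx.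
Qed.

(** A marked letter of the alphabet has index at least 1, so its flag condition already contains the
    uncrossed cut 0 required of x-strips and y-strips. *)
Lemma letter_stepE k n a nu rho : 0 < n -> in_alphabet n a ->
    kstrict k nu /\ good k n (tw k nu) -> kstrict k rho /\ good k n (tw k rho) ->
  letter_step k n a nu rho <->
  [/\ k_horizontal_strip k (diag nu) (diag rho),
      if a is Primed _ then x_strip n k nu rho else True,
      if a is DPrimed _ then y_strip n k nu rho else True
    & letter_flags k a nu rho].
Proof.
move=> n0 aa kgn kgr; have hs := horizontal_strip_cut kgn.1 kgr.1.
have xs := x_strip_rstrip kgn kgr n0; have ys := y_strip_rstrip kgn kgr n0.
case: a aa => i /= ia.
- split=> [[h1 h2]|[_ /xs[h1 _] _ h2]] //.
  have x : x_strip n k nu rho by apply/xs; split=> //; apply: h2; lia.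
  by split=> //; case: x.
- by split=> [/hs h|[/hs h _ _ _]].
- split=> [[h1 h2]|[_ _ /ys[h1 _] h2]] //.
  have x : y_strip n k nu rho by apply/ys; split=> //; apply: h2; lia.
  by split=> //; case: x.
Qed.

Section Chains.

Variables (k n : nat) (lam mu : seq nat) (al : seq letter).
Variables (U : filling lam mu) (nu : nat -> seq nat).

Local Notation M := (size al).
Local Notation a s := (nth (Plain 0) al s).

(** The dictionary between fillings and chains: [nu s] consists of [mu] and the boxes whose entry is
    among the first [s] letters of the finite list [al]. *)
Definition fits : Prop :=
  [/\ nu 0 = mu, nu M = lam,
      forall s, s <= M -> kstrict k (nu s) /\ good k n (tw k (nu s)),
      forall c, U c \in al
    & forall s b, s <= M -> diag (nu s) b <->
        diag mu b \/ exists2 c, val c = b & index (U c) al < s].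

Hypotheses (n0 : 0 < n) (alS : sorted letter_lt al) (alA : all (in_alphabet n) al).
Hypothesis ft : fits.

Lemma al_uniq : uniq al.
Proof.
apply: sorted_uniq alS => [|x]; first exact: letter_lt_trans.
by rewrite /letter_lt eqxx.
Qed.

Lemma al_lt s t : s < t -> t < M -> letter_lt (a s) (a t).
Proof.
move=> st tM; apply: (sorted_ltn_nth letter_lt_trans _ alS) => //.
by rewrite inE (ltn_trans st).
Qed.

Lemma al_index x y : x \in al -> y \in al -> (index x al < index y al) = letter_lt x y.
Proof.
move=> xa ya; rewrite -{2}(nth_index (Plain 0) xa) -{2}(nth_index (Plain 0) ya).
have hx : index x al < M by rewrite index_mem.
have hy : index y al < M by rewrite index_mem.
case: (ltngtP (index x al) (index y al)) => [lt|lt|->].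
- by rewrite al_lt.
- by have := al_lt lt hx; move=> /andP[_]; rewrite letter_leNgt => /negPf->.
- by rewrite /letter_lt eqxx.
Qed.

Lemma a_mem s : s < M -> a s \in al.
Proof. exact: mem_nth. Qed.

Lemma a_alphabet s : s < M -> in_alphabet n (a s).
Proof. by move=> sM; apply: (allP alA); exact: a_mem. Qed.

Lemma skew_notin (c : Defs.skew lam mu) : ~ diag mu (val c).
Proof.
have := ssvalP c; rewrite mem_filter => /andP[/andP[_ /negP h] _]; exact: h.
Qed.

Lemma skew_in (c : Defs.skew lam mu) : diag lam (val c).
Proof. by have := ssvalP c; rewrite mem_filter => /andP[/andP[]]. Qed.

Lemma diag_mono s t : s <= t -> t <= M -> (diag (nu s) `<=` diag (nu t))%classic.
Proof.
have [_ _ _ _ fb] := ft; move=> st tM b /(fb _ _ (leq_trans st tM)) h.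
apply/(fb _ _ tM); case: h => [|[c cb cs]]; [by left|right].
by exists c => //; apply: leq_trans cs st.
Qed.

Lemma box_step s b : s < M -> (diag (nu s.+1) `\` diag (nu s))%classic b <->
  exists2 c : Defs.skew lam mu, val c = b & U c = a s.
Proof.
have [_ _ _ Ua fb] := ft; move=> sM; split=> [[/(fb _ _ sM) h nh]|[c <- Uc]].
  case: h => [h|[c cb cs]]; first by case: nh; apply/(fb _ _ (ltnW sM)); left.
  exists c => //; suff <- : index (U c) al = s by rewrite nth_index.
  apply/eqP; rewrite eqn_leq -ltnS cs leqNgt; apply/negP => lt.
  by apply: nh; apply/(fb _ _ (ltnW sM)); right; exists c.
have ix : index (U c) al = s by rewrite Uc index_uniq // al_uniq.
split; first by apply/(fb _ _ sM); right; exists c; rewrite ?ix.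
move=> /(fb _ _ (ltnW sM)) [/skew_notin//|[d /val_inj->]].
by rewrite ix ltnn.
Qed.

Lemma diag_U s (P : pred letter) : s <= M ->
    (forall x, x \in al -> (index x al < s) = P x) ->
  diag (nu s) = (diag mu `|` [set b | exists2 c : Defs.skew lam mu, val c = b & P (U c)])%classic.
Proof.
have [_ _ _ Ua fb] := ft; move=> sM E; apply/funext => b; apply/propext.
apply: (iff_trans (fb s b sM)); rewrite /setU /=.
by split=> -[h|[c cb h]]; [left|right|left|right] => //; exists c => //; move: h; rewrite E.
Qed.

Lemma zero_cut_chain v p q : p <= q ->
    (forall s, p <= s < q -> zero_cut k (nu s.+1) (nu s) v) ->
  zero_cut k (nu q) (nu p) v.
Proof.
move=> pq; rewrite -(subnK pq); elim: (q - p) => [|d IH] H; first exact: zero_cut_refl.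
rewrite addSn; apply: zero_cut_trans (H (d + p) _) _; first by lia.
by apply: IH => s hs; apply: H; lia.
Qed.

(** Letters before i' are primed with larger index, so the cuts below [i] stay uncrossed all the way
    from [mu]; after i'' they stay uncrossed up to [lam]. This is why the bounds involve only [mu]
    and [lam]. *)
Lemma flags_bounds : (forall s, s < M -> letter_flags k (a s) (nu s.+1) (nu s)) ->
  forall c, row_bounds k U c /\ column_bounds k U c.
Proof.
have [nu0 nuM kgn Ua _] := ft; move=> fl c.
pose s := index (U c) al; have sM : s < M by rewrite index_mem.
have as_ : a s = U c by rewrite nth_index.
have km := (kgn 0 (leq0n _)).1; rewrite nu0 in km.
have kl := (kgn M (leqnn _)).1; rewrite nuM in kl.
have kn t : t <= M -> kstrict k (nu t) by move=> /kgn[].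
have [in1 nin0] : (diag (nu s.+1) `\` diag (nu s))%classic (val c).
  by apply/box_step => //; exists c.
have inP : (diag (nu s.+1) `\` diag mu)%classic ((val c).1, (val c).2).
  by rewrite -surjective_pairing; split=> //; exact: skew_notin.
have inD : (diag lam `\` diag (nu s))%classic ((val c).1, (val c).2).
  by rewrite -surjective_pairing; split=> //; exact: skew_in.
have zP i : U c = Primed i -> forall v, v < i -> zero_cut k (nu s.+1) mu v.
  move=> Uc v vi; rewrite -nu0; apply: zero_cut_chain => // t /andP[_ ts].
  have tM : t < M by apply: leq_trans sM.
  have := fl t tM; have : letter_le (a t) (Primed i).
    rewrite -Uc -as_; move: ts; rewrite ltnS leq_eqVlt => /predU1P[->|ts].
      exact: letter_le_refl.
    by case/andP: (al_lt ts sM).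
  by case: (a t) => //= j ij H; apply: H; apply: leq_trans vi ij.
have zD i : U c = DPrimed i -> forall v, v < i -> zero_cut k lam (nu s) v.
  move=> Uc v vi; rewrite -nuM; apply: zero_cut_chain => [|t /andP[st tM]].
    exact: ltnW.
  have := fl t tM; have : letter_le (DPrimed i) (a t).
    rewrite -Uc -as_; move: st; rewrite leq_eqVlt => /predU1P[<-|st].
      exact: letter_le_refl.
    by case/andP: (al_lt st tM).
  by case: (a t) => //= j ij H; apply: H; apply: leq_trans vi ij.
have kn1 := kn _ sM; have kn0 := kn _ (ltnW sM).
move: zP zD; rewrite /row_bounds /column_bounds; case: (U c) => i zP zD; split=> //=.
- by split=> // h; apply: primed_row_bound (zP _ erefl) inP h.
- move=> j hj e; split=> //; rewrite e in inP.
  exact: primed_column_bound (zP _ erefl) inP.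
- by split=> // h; apply: dprimed_row_bound (zD _ erefl) inD h.
- move=> j hj e; split=> //; rewrite e in inD.
  exact: dprimed_column_bound (zD _ erefl) inD.
Qed.

(** The induction starts from the ends of the alphabet: upwards from [mu] for primed letters,
    downwards from [lam] for double-primed ones. The letters already treated have larger index, so
    they leave uncrossed all the cuts needed at the current letter. *)
Lemma bounds_flags :
    (forall s, s < M -> k_horizontal_strip k (diag (nu s.+1)) (diag (nu s))) ->
    (forall s, s < M -> if a s is Primed _ then x_strip n k (nu s.+1) (nu s) else True) ->
    (forall s, s < M -> if a s is DPrimed _ then y_strip n k (nu s.+1) (nu s) else True) ->
    (forall c, row_bounds k U c /\ column_bounds k U c) ->
  forall s, s < M -> letter_flags k (a s) (nu s.+1) (nu s).
Proof.
have [nu0 nuM kgn Ua _] := ft; move=> hs xs ys bd.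
have km := (kgn 0 (leq0n _)).1; rewrite nu0 in km.
have kl := (kgn M (leqnn _)).1; rewrite nuM in kl.
have cs s (sM : s < M) : cut_strip k (nu s.+1) (nu s).
  by apply/(horizontal_strip_cut (kgn _ sM).1 (kgn _ (ltnW sM)).1); apply: hs.
have zx s i : s < M -> a s = Primed i -> zero_cut k (nu s.+1) (nu s) 0.
  move=> sM e; have := xs s sM; rewrite e.
  by move=> /(x_strip_rstrip (kgn _ sM) (kgn _ (ltnW sM)) n0) [].
have zy s i : s < M -> a s = DPrimed i ->
    rstrip k n (iota 0 n) (nu s.+1) (nu s) /\ zero_cut k (nu s.+1) (nu s) 0.
  move=> sM e; have := ys s sM; rewrite e.
  by move=> /(y_strip_rstrip (kgn _ sM) (kgn _ (ltnW sM)) n0).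
have xflag s i : s < M -> a s = Primed i ->
    forall v, v < i -> zero_cut k (nu s.+1) (nu s) v.
  have [d] := ubnP s; elim: d s i => // d IH s i sd sM e.
  have before t : t < s -> exists2 j, a t = Primed j & i < j.
    move=> ts; have /andP[ne] := al_lt ts sM; rewrite e in ne *.
    case: (a t) ne => // j ne /= ij; exists j => //.
    by rewrite ltn_neqAle ij andbT; apply: contraNN ne => /eqP->.
  apply: (primed_bounds_zero (mu := mu)) => //.
  - exact: (kgn _ sM).1.
  - exact: (kgn _ (ltnW sM)).1.
  - exact: cs.
  - move=> v vi; rewrite -nu0; apply: zero_cut_chain => // t /andP[_ ts].
    have [j et ij] := before t ts; apply: (IH t j) => //; last exact: ltn_trans ij.
      by apply: leq_trans ts _; rewrite -ltnS.
    exact: ltn_trans sM.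
  - rewrite -nu0; apply: zero_cut_chain => // t /andP[_ ts].
    move: ts; rewrite ltnS leq_eqVlt => /predU1P[->|ts]; first exact: zx e.
    by have [j et _] := before t ts; apply: zx et; apply: ltn_trans sM.
  - move=> r c /(box_step _ sM)[b eb Ub] rl.
    by have [[+ _] _] := bd b; rewrite eb Ub e; apply.
  - move=> r j hj /(box_step _ sM)[b eb Ub].
    by have [_ /(_ j hj)] := bd b; rewrite eb Ub e => -[].
have yflag s i : s < M -> a s = DPrimed i ->
    forall v, v < i -> zero_cut k (nu s.+1) (nu s) v.
  have [d] := ubnP (M - s); elim: d s i => // d IH s i sd sM e.
  have after t : s < t -> t < M -> exists2 j, a t = DPrimed j & i < j.
    move=> st tM; have /andP[ne] := al_lt st tM; rewrite e in ne *.
    case: (a t) ne => // j ne /= ij; exists j => //.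
    by rewrite ltn_neqAle ij andbT; apply: contraNN ne => /eqP->.
  have [rs z0] := zy s i sM e.
  apply: (dprimed_bounds_zero (kgn _ sM) (kgn _ (ltnW sM)) rs (cs s sM) kl) => //.
  - move=> v vi; rewrite -nuM; apply: zero_cut_chain => // t /andP[st tM].
    have [j et ij] := after t st tM; apply: (IH t j) => //; last exact: leq_ltn_trans ij.
    by clear - sd st tM; lia.
  - move=> r c /(box_step _ sM)[b eb Ub] rl.
    by have [[_ +] _] := bd b; rewrite eb Ub e; apply.
  - move=> r j hj /(box_step _ sM)[b eb Ub].
    by have [_ /(_ j hj)] := bd b; rewrite eb Ub e => -[].
move=> s sM; rewrite /letter_flags; case e: (a s) => [i|i|i] //.
  exact: xflag e.
exact: yflag e.
Qed.

End Chains.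

Section Tableau.

Variables (k n : nat) (lam mu : seq nat) (al : seq letter).
Variables (U : filling lam mu) (nu : nat -> seq nat).

Local Notation M := (size al).
Local Notation a s := (nth (Plain 0) al s).

Hypotheses (n0 : 0 < n) (alS : sorted letter_lt al) (alA : all (in_alphabet n) al).
Hypothesis ft : fits k n al U nu.

Lemma mem_step c t : t <= M -> diag (nu t) (val c) <-> index (U c) al < t.
Proof.
have [_ _ _ Ua fb] := ft; move=> tM; split=> [/(fb _ _ tM)[/skew_notin//|]|h].
  by case=> d /val_inj->.
by apply/(fb _ _ tM); right; exists c.
Qed.

Lemma U_lt_step s : s < M -> U_lt U (a s) = diag (nu s).
Proof.
move=> sM; rewrite (diag_U (P := fun x => letter_lt x (a s)) ft (ltnW sM)) // => x xa.
rewrite -(al_index alS xa (mem_nth _ sM)) index_uniq //; exact: al_uniq alS.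
Qed.

Lemma U_le_step s : s < M -> U_le U (a s) = diag (nu s.+1).
Proof.
move=> sM; rewrite (diag_U (P := fun x => letter_le x (a s)) ft sM) // => x xa.
rewrite letter_leNgt -(al_index alS (mem_nth _ sM) xa) index_uniq //; last exact: al_uniq alS.
by rewrite ltnS leqNgt.
Qed.

Lemma U_lt_gap x : exists2 s, s <= M & U_lt U x = diag (nu s).
Proof.
pose s := find (fun b => ~~ letter_lt b x) al.
have sM : s <= M := find_size _ _.
exists s => //; rewrite (diag_U (P := fun b => letter_lt b x) ft sM) // => b ba.
apply/idP/idP => [lt|bx].
  by have := before_find (Plain 0) lt; rewrite nth_index // => /negbFE.
rewrite ltnNge; apply/negP => le.
have hs : has (fun b => ~~ letter_lt b x) al.
  by rewrite has_find; apply: leq_ltn_trans le _; rewrite index_mem.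
have := nth_find (Plain 0) hs; rewrite -/s => /negP; apply.
have [e|ne] := eqVneq s (index b al); first by rewrite e nth_index.
apply: letter_lt_trans bx; rewrite -(nth_index (Plain 0) ba).
by apply: (al_lt alS); rewrite ?index_mem // ltn_neqAle ne.
Qed.

Lemma U_gap x : x \notin al -> U_le U x = U_lt U x.
Proof.
have [_ _ _ Ua _] := ft; move=> xa; congr (_ `|` _)%classic.
apply/funext => b; apply/propext; split=> -[c cb h]; exists c => //; last by case/andP: h.
by rewrite /letter_lt h andbT; apply: contraNN xa => /eqP<-.
Qed.

(** For letters of [al] the strip conditions and the bounds turn into steps. The tableau definition
    quantifies over the infinite alphabet; a letter outside [al] gives an empty strip, a trivial
    step. *)
Lemma tableau_fits : ktritableau n k U <->
  forall s, s < M -> letter_step k n (a s) (nu s.+1) (nu s).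
Proof.
have [nu0 nuM kgn Ua fb] := ft; split.
  move=> [_ _ _ sc bd].
  have st s (sM : s < M) : [/\ k_horizontal_strip k (diag (nu s.+1)) (diag (nu s)),
      if a s is Primed _ then x_strip n k (nu s.+1) (nu s) else True
    & if a s is DPrimed _ then y_strip n k (nu s.+1) (nu s) else True].
    have [alp [bet [[ka kb] [da db] h1 h2 h3]]] := sc _ (a_alphabet alA sM).
    rewrite U_le_step // in da; rewrite U_lt_step // in db.
    have [[k1 _] [k2 _]] := (kgn _ sM, kgn _ (ltnW sM)).
    by rewrite -(diag_inj ka k1 da) -(diag_inj kb k2 db).
  move=> s sM; apply/letter_stepE => //; [exact: a_alphabet sM|exact: kgn|exact/kgn/ltnW|].
  have [h1 h2 h3] := st s sM; split=> //.
  by apply: (bounds_flags n0 alS alA ft) => // t tM; have [] := st t tM.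
move=> ls.
have st s (sM : s < M) := (letter_stepE n0 (a_alphabet alA sM) (kgn _ sM) (kgn _ (ltnW sM))).1 (ls s sM).
have mono c d : (forall t, t <= M -> diag (nu t) (val d) -> diag (nu t) (val c)) ->
    letter_le (U c) (U d).
  move=> H; rewrite letter_leNgt; apply/negP; rewrite -(al_index alS) // => lt.
  have tM : index (U c) al <= M by apply: index_size.
  by have := H _ tM ((mem_step d tM).2 lt); rewrite mem_step // ltnn.
split.
- by move=> c; apply: (allP alA); apply: Ua.
- move=> c d rr cc; apply: mono => t tM; have [kt _] := kgn t tM.
  move=> /(diagP kt)[h1 h2]; apply/(diagP kt); split.
    by have /(diagP (kgn M (leqnn _)).1)[] : diag (nu M) (val c) by apply/mem_step; rewrite // index_mem.
  by rewrite rr; apply: leq_trans h2 _; apply: col_anti.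
- move=> c d cc rr; apply: mono => t tM; have [kt _] := kgn t tM.
  move=> /(diagP kt)[h1 h2]; apply/(diagP kt); rewrite cc; split=> //.
  exact: leq_trans h2.
- move=> x xA; have [xa|xa] := boolP (x \in al).
    pose s := index x al; have sM : s < M by rewrite index_mem.
    have e : a s = x by rewrite nth_index.
    exists (nu s.+1), (nu s); rewrite -e U_le_step // U_lt_step //.
    have [h1 h2 h3 _] := st s sM; split=> //.
    by have [[k1 _] [k2 _]] := (kgn _ sM, kgn _ (ltnW sM)).
  have [s sM e] := U_lt_gap x; exists (nu s), (nu s); rewrite U_gap // e.
  have kg := kgn s sM.
  have /(letter_stepE n0 xA kg kg)[h1 h2 h3 _] : letter_step k n x (nu s) (nu s).
    have [ks gs] := kg; case: (x) => i /=; try exact: cut_strip_refl.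
      by split=> [|v _]; [exact: rstrip_refl|exact: zero_cut_refl].
    by split=> [|v _]; [exact: rstrip_refl|exact: zero_cut_refl].
  by split=> //; have [] := kg.
- by apply: (flags_bounds n0 alS alA ft) => s sM; have [] := st s sM.
Qed.

End Tableau.

(** * Counting boxes, and paths in a matrix product *)

Lemma card_seq_sub_pred (T : choiceType) (s : seq T) (P : pred T) : uniq s ->
  #|[pred c : seq_sub s | P (val c)]| = count P s.
Proof.
move=> us; rewrite cardE /enum_mem size_filter -(count_map val P).
apply/seq.permP; apply: uniq_perm => //.
  by rewrite map_inj_uniq -?enumT ?enum_uniq //; exact: val_inj.
move=> x; apply/mapP/idP => [[c _ ->]|xs]; first exact: ssvalP.
by exists (SeqSub xs) => //; rewrite -enumT mem_enum.
Qed.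

Lemma skew_boxes_uniq lam mu : uniq (skew_boxes lam mu).
Proof.
rewrite filter_uniq // allpairs_uniq ?iota_uniq // => -[a b] [c d] _ _ /=.
by case=> -> ->.
Qed.

Lemma iota_last C : iota 1 C.+1 = iota 1 C ++ [:: C.+1].
Proof. by rewrite -[C in RHS]addn0 -(addn1 C) iotaD add1n addn0. Qed.

Lemma count_between a b C : a <= b -> b <= C ->
  \sum_(r <- iota 1 C) (a < r <= b : nat) = b - a.
Proof.
move=> ab; elim: C => [|C IH] bC; first by rewrite big_nil; lia.
rewrite iota_last big_cat /= big_seq1.
have [le|lt] := leqP b C; first by rewrite IH //; lia.
have -> : b = C.+1 by lia.
suff -> : \sum_(r <- iota 1 C) (a < r <= C.+1 : nat) = C - minn a C by lia.
clear; elim: C => [|C IH]; first by rewrite big_nil; lia.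
rewrite iota_last big_cat /= big_seq1.
rewrite (eq_big_seq (fun r => (a < r <= C.+1 : nat))) ?IH; first by lia.
by move=> r; rewrite mem_iota => hr; congr nat_of_bool; lia.
Qed.

Section Card.

Variables (k : nat) (lam mu nu : seq nat).
Hypotheses (kl : kstrict k lam) (km : kstrict k mu) (kn : kstrict k nu).
Hypotheses (mn : forall c, 0 < c -> col_length mu c <= col_length nu c).
Hypotheses (nl : forall c, 0 < c -> col_length nu c <= col_length lam c).

Lemma card_skew :
  #|[pred c : Defs.skew lam mu | in_diag nu (val c)]| = sumn nu - sumn mu.
Proof.
rewrite (card_seq_sub_pred _ (skew_boxes_uniq lam mu)) /skew_boxes count_filter.
have bd (al : seq nat) : kstrict k al ->
    (forall c, 0 < c -> col_length al c <= col_length lam c) ->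
    sumn al = \sum_(c <- iota 1 (part lam 1)) col_length al c.
  move=> ka H; rewrite (@sumn_cols al (part lam 1)) => [|p pa].
    by rewrite /index_iota subn1.
  have [->//|p0] := posnP p.
  rewrite (part_col (kstrict_part kl)) //; apply: leq_trans (H p p0).
  by rewrite /col_length -has_count; apply/hasP; exists p => //=.
rewrite (bd _ kn nl) (bd mu km) => [|c c0]; last exact: leq_trans (mn c0) (nl c0).
rewrite -sum1_count big_mkcond big_allpairs exchange_big /=.
transitivity (\sum_(c <- iota 1 (part lam 1)) (col_length nu c - col_length mu c)).
  apply: eq_big_seq => c; rewrite mem_iota => /andP[c0 _].
  rewrite -(count_between (mn c0) (leq_trans (nl c0) (count_size _ _))).
  apply: eq_big_seq => r _; congr nat_of_bool.
  apply/idP/idP.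
    move=> /andP[h1 /andP[_ h2]].
    have /(diagP kn)[_ h3] : diag nu (r, c) by [].
    rewrite h3 andbT ltnNge; apply: contraNN h2 => h4.
    by have : diag mu (r, c) by apply/(diagP km).
  move=> /andP[h1 h2].
  have d1 : diag nu (r, c) by apply/(diagP kn).
  have d2 : diag lam (r, c) by apply/(diagP kl); split=> //; apply: leq_trans h2 (nl c0).
  have d3 : ~ diag mu (r, c) by move=> /(diagP km) [_ /=]; lia.
  by apply/andP; split=> //; apply/andP; split=> //; apply/negP.
have H (f g : nat -> nat) s : (forall c, c \in s -> g c <= f c) ->
   \sum_(c <- s) (f c - g c) = \sum_(c <- s) f c - \sum_(c <- s) g c /\
   \sum_(c <- s) g c <= \sum_(c <- s) f c.
  elim: s => [|c s IH] h; first by rewrite !big_nil.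
  rewrite !big_cons; have [|h1 h2] := IH; first by move=> d ds; apply: h; rewrite inE ds orbT.
  by have := h c (mem_head _ _); lia.
by apply: (H _ _ _ _).1 => c; rewrite mem_iota => /andP[c0 _]; exact: mn.
Qed.

End Card.

(** The product is reversed because the first letter acts first, on the right; the tuple lists the
    words reached after each letter, starting from [t]. *)
Lemma entry_path (R : comNzRingType) (n : nat) (T : letter -> 'M[R]_(#|{: word n}|.-1.+1))
    (l : seq letter) (s t : word n) :
  (entry (\prod_(a <- rev l) T a) s t =
   \sum_(c : (size l).-tuple (word n) | last t c == s)
     \prod_(i < size l) entry (T (nth (Plain 0) l i)) (nth t c i) (nth t (t :: c) i))%R.
Proof.
elim: l t => [|a l IH] t /=.
  rewrite big_nil entry1 big_mkcond (big_pred1 [tuple]) /=.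
    by rewrite big_ord0 eq_sym; case: eqP.
  by move=> c; rewrite (tuple0 c); symmetry; exact: eqxx.
rewrite rev_cons big_rcons entryM.
pose F (u : word n) (c : (size l).-tuple (word n)) : R :=
  (entry (T a) u t * \prod_(i < size l)
     entry (T (nth (Plain 0) l i)) (nth u c i) (nth u (u :: c) i))%R.
transitivity (\sum_u \sum_(c : (size l).-tuple (word n) | last u c == s) F u c)%R.
  by apply: eq_bigr => u _; rewrite IH mulrC big_distrr.
rewrite pair_big_dep /= (reindex (fun p : word n * (size l).-tuple (word n) =>
  cons_tuple p.1 p.2)) /=; last first.
  exists (fun c : (size l).+1.-tuple (word n) => (thead c, behead_tuple c)) => [[u c]|c] _ /=.
    by congr (_, _); apply/val_inj.
  by rewrite [RHS]tuple_eta; apply/val_inj.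
apply: eq_bigr => -[u c] _; rewrite big_ord_recl /=; congr (_ * _)%R.
apply: eq_bigr => i _ /=.
congr entry; apply: set_nth_default; rewrite /= size_tuple //.
exact: leqW (ltn_ord i).
Qed.

Lemma skew_mem k lam mu b : kstrict k lam -> diag lam b -> ~ diag mu b ->
  exists c : Defs.skew lam mu, val c = b.
Proof.
case: b => r c kl h1 h2; have /(diagP kl)[/= c0 hr] := h1.
have r0 : 0 < r by case: r h1 h2 hr => // h1 []; rewrite /diag /= /in_diag /= c0.
suff m : (r, c) \in skew_boxes lam mu by exists (SeqSub m).
rewrite mem_filter; apply/andP; split; first by apply/andP; split=> //; apply/negP.
apply/allpairsP; exists (r, c); rewrite /= !mem_iota; split=> //.
  by have := count_size (fun p => c <= p) lam; rewrite -/(col_length lam c); lia.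
have : c <= part lam 1 by rewrite (part_col (kstrict_part kl)) //; lia.
by lia.
Qed.

(** * The sum over paths as a sum over tableaux *)

Section ChainSum.

Variables (k n : nat) (lam mu : seq nat) (al : seq letter).
Hypotheses (n0 : 0 < n) (alS : sorted letter_lt al) (alA : all (in_alphabet n) al).
Hypotheses (kl : kstrict k lam) (gl : good k n (tw k lam)).
Hypotheses (km : kstrict k mu) (gm : good k n (tw k mu)).
Hypotheses (ml : forall c, 0 < c -> col_length mu c <= col_length lam c).

Local Notation wd := (wordof k n).
Local Notation M := (size al).
Local Notation a s := (nth (Plain 0) al s).

Definition shape (U : filling lam mu) (x : letter) : seq nat :=
  xget [::] [set nu | kstrict k nu /\ diag nu = U_le U x].

Definition shapes U s : seq nat := nth mu (mu :: [seq shape U x | x <- al]) s.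

Definition chain U : M.-tuple (word n) := [tuple of [seq wd (shape U x) | x <- in_tuple al]].

Lemma shapesS U s : s < M -> shapes U s.+1 = shape U (a s).
Proof. by move=> sM; rewrite /shapes /= (nth_map (Plain 0)). Qed.

Lemma nth_chain U t s : s < M -> nth t (chain U) s = wd (shapes U s.+1).
Proof. by move=> sM; rewrite shapesS //= (nth_map (Plain 0)). Qed.

Lemma nth_chain0 U s : s < M -> nth (wd mu) (wd mu :: chain U) s = wd (shapes U s).
Proof.
by case: s => // s sM; rewrite [LHS]/= (nth_map (Plain 0)) ?shapesS // ltnW.
Qed.

Lemma last_chain U : last (wd mu) (chain U) = wd (shapes U M).
Proof.
rewrite /shapes -[X in nth _ _ X](size_map (shape U)) -last_nth.
by rewrite -(last_map (wordof k n)) -map_comp.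
Qed.

Lemma index_step x s : x \in al -> s < M -> (index x al < s.+1) = letter_le x (a s).
Proof.
move=> xa sM; rewrite letter_leNgt -(al_index alS (mem_nth _ sM) xa).
by rewrite index_uniq ?(al_uniq alS) // -leqNgt ltnS.
Qed.

Lemma index_step0 x s : x \in al -> s < M -> (index x al < s) = letter_lt x (a s).
Proof.
move=> xa sM; rewrite -(al_index alS xa (mem_nth _ sM)) index_uniq //.
exact: al_uniq alS.
Qed.

Lemma lam_skew (b : box) : diag lam b <->
  diag mu b \/ exists c : Defs.skew lam mu, val c = b.
Proof.
split=> [lb|].
  have [mb|nb] := pselect (diag mu b); [by left|right].
  exact: skew_mem kl lb nb.
case=> [/(diagP km)[b0 h]|[c <-]]; last exact: skew_in.
by apply/(diagP kl); split=> //; apply: leq_trans h (ml b0).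
Qed.

Lemma tableau_shapes U : ktritableau n k U -> (forall c, U c \in al) ->
  fits k n al U (shapes U).
Proof.
move=> [_ _ _ sc _] Ua.
have sh s : s < M -> kstrict k (shapes U s.+1) /\ diag (shapes U s.+1) = U_le U (a s).
  move=> sM; have [nu [rho [[kn _] [dn _] _ _ _]]] := sc _ (a_alphabet alA sM).
  by rewrite shapesS // /shape; case: xgetP => [nu' _ []|/(_ nu)[]].
have fb s b : s <= M -> diag (shapes U s) b <->
    diag mu b \/ exists2 c, val c = b & index (U c) al < s.
  case: s => [|s] sM; first by split=> [|[|[]]] //; left.
  rewrite (sh s sM).2 /U_le /setU /=.
  by split=> -[h|[c cb h]]; [left|right|left|right] => //; exists c => //;
    move: h; rewrite index_step.
have ks s : s <= M -> kstrict k (shapes U s) by case: s => // s /sh[].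
have eM : shapes U M = lam.
  apply: (diag_inj (ks _ (leqnn _)) kl); apply/funext => b; apply/propext.
  apply: (iff_trans (fb _ _ (leqnn _))); apply: iff_trans (iff_sym (lam_skew b)).
  split=> -[h|]; [by left|by case=> c cb _; right; exists c|by left|].
  by case=> c cb; right; exists c => //; rewrite index_mem.
split=> //.
(* The tableau conditions give strips but not words of length [n]; goodness descends from [lam]
   along the strips. *)
suff gd d s : s <= M -> M <= s + d -> kstrict k (shapes U s) /\ good k n (tw k (shapes U s)).
  by move=> s sM; apply: (gd M); lia.
elim: d s => [|d IH] s sM h.
  have -> : s = M by apply/eqP; rewrite eqn_leq sM -(addn0 s).
  by rewrite eM; split.
have [->|ne] := eqVneq s M; first by rewrite eM; split.
have lt : s < M by rewrite ltn_neqAle ne.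
have [k1 g1] := IH s.+1 lt ltac:(lia).
have [nu [rho [[kn kr] [dn dr] st _ _]]] := sc _ (a_alphabet alA lt).
have e1 : shapes U s.+1 = nu by apply: (diag_inj k1 kn); rewrite dn (sh _ lt).2.
have e2 : shapes U s = rho.
  apply: (diag_inj (ks _ sM) kr); rewrite dr; apply/funext => b; apply/propext.
  apply: (iff_trans (fb s b sM)); rewrite /U_lt /setU /=.
  by split=> -[h'|[c cb h']]; [left|right|left|right] => //; exists c => //;
    move: h'; rewrite index_step0.
split; first exact: ks.
apply: (good_below k1 (ks _ sM) g1).
by apply/(horizontal_strip_cut k1 (ks _ sM)); rewrite e1 e2.
Qed.

Lemma chain_inj U V : ktritableau n k U -> (forall c, U c \in al) ->
  ktritableau n k V -> (forall c, V c \in al) -> chain U = chain V -> U = V.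
Proof.
move=> tU Ua tV Va E; have fU := tableau_shapes tU Ua; have fV := tableau_shapes tV Va.
have e s : s <= M -> shapes U s = shapes V s.
  case: s => // s sM; have [_ _ gU _ _] := fU; have [_ _ gV _ _] := fV.
  have [[k1 g1] [k2 g2]] := (gU _ sM, gV _ sM).
  by apply: (wordof_inj k1 k2 g1 g2); rewrite -!(nth_chain _ (wd mu)) // E.
apply/ffunP => c; rewrite -(nth_index (Plain 0) (Ua c)) -(nth_index (Plain 0) (Va c)).
congr (a _); have hU := mem_step fU c; have hV := mem_step fV c.
have iU : index (U c) al < M by rewrite index_mem.
have iV : index (V c) al < M by rewrite index_mem.
have h t : t <= M -> index (U c) al < t <-> index (V c) al < t.
  by move=> tM; rewrite -hU // -hV // e.
by have := (h _ iU).1; have := (h _ iV).2; lia.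
Qed.

Section Weighted.

Variables (R : comNzRingType) (om : letter -> R).

Definition path_weight (c : M.-tuple (word n)) : R :=
  (\prod_(i < M) entry (letter_matrix k n om (a i)) (nth (wd mu) c i)
                       (nth (wd mu) (wd mu :: c) i))%R.

Definition step_weight (U : filling lam mu) (s : nat) : R :=
  (2 ^+ letter_pow k (a s) (shapes U s.+1) (shapes U s) *
   om (a s) ^+ (sumn (shapes U s.+1) - sumn (shapes U s)))%R.

Lemma path_weight_chain U : ktritableau n k U -> (forall c, U c \in al) ->
  path_weight (chain U) = (\prod_(i < M) step_weight U i)%R.
Proof.
move=> tU Ua; have fU := tableau_shapes tU Ua; have [_ _ gU _ _] := fU.
have ls := (tableau_fits n0 alS alA fU).1 tU.
apply: eq_bigr => -[s sM] _ /=; rewrite nth_chain // nth_chain0 //.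
rewrite (entry_letter n0 om _ (gU _ sM) (gU _ (ltnW sM))).
by case: asboolP => [_|[]]; [rewrite mul1r | apply: ls].
Qed.

Lemma path_weight_neq0 c : path_weight c <> 0%R -> last (wd mu) c = wd lam ->
  exists U, [/\ ktritableau n k U, forall b, U b \in al & chain U = c].
Proof.
move=> ne cl; pose w s := nth (wd mu) (wd mu :: c) s.
have wne s : s < M -> entry (letter_matrix k n om (a s)) (w s.+1) (w s) <> 0%R.
  move=> sM e; apply: ne; rewrite /path_weight (bigD1 (Ordinal sM)) //=.
  by rewrite -/(w s) -/(w s.+1) e mul0r.
have ex s : s <= M -> exists nu, (kstrict k nu /\ good k n (tw k nu)) /\ w s = wd nu.
  elim: s => [_|s IH sM]; first by exists mu.
  have [nu [kgn e]] := IH (ltnW sM).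
  have := wne s sM; rewrite e => /(entry_letter_reach n0 kgn) [nu' [kgn' e' _]].
  by exists nu'.
pose nu s := xget [::] [set nu | (kstrict k nu /\ good k n (tw k nu)) /\ w s = wd nu].
have nuP s : s <= M -> (kstrict k (nu s) /\ good k n (tw k (nu s))) /\ w s = wd (nu s).
  by move=> sM; have [x hx] := ex s sM; rewrite /nu; case: xgetP => [y _ //|/(_ x)].
have nuE s x : s <= M -> kstrict k x -> good k n (tw k x) -> w s = wd x -> nu s = x.
  move=> sM kx gx e; have [[k1 g1] e1] := nuP s sM.
  by apply: (wordof_inj k1 kx g1 gx); rewrite -e1.
have nu0 : nu 0 = mu by apply: nuE.
have nuM : nu M = lam.
  by apply: nuE => //; rewrite /w -cl (last_nth (wd mu)) size_tuple.
have mono s t : s <= t -> t <= M -> (diag (nu s) `<=` diag (nu t))%classic.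
  move=> st; rewrite -(subnK st); elim: (t - s) => [|d IH] dM //.
  rewrite addSn in dM *; apply: subset_trans (IH (ltnW dM)) _.
  have [[k1 g1] e1] := nuP _ (ltnW dM); have [[k2 g2] e2] := nuP _ dM.
  have := wne _ dM; rewrite e1 => /(entry_letter_reach n0 (conj k1 g1)) [x [[kx gx] ex' cx]].
  have <- : x = nu (d + s).+1 by rewrite (nuE _ x).
  by move=> b /(diagP k1)[b0 h]; apply/(diagP kx); split=> //; apply: leq_trans h (cx _ b0).
have ls s : s < M -> letter_step k n (a s) (nu s.+1) (nu s).
  move=> sM; have [kg1 e1] := nuP _ (ltnW sM); have [kg2 e2] := nuP _ sM.
  have := wne s sM; rewrite e1 e2 (entry_letter n0 om _ kg2 kg1).
  by case: asboolP => // _; rewrite mul0r.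
(* The entry of a box is the letter at which the increasing chain first contains it. *)
pose idx (b : Defs.skew lam mu) := find (fun s => in_diag (nu s.+1) (val b)) (iota 0 M).
have idxM b : idx b < M.
  rewrite /idx -[X in _ < X](size_iota 0) -has_find; apply/hasP.
  have M0 : 0 < M.
    have d : diag (nu M) (val b) by rewrite nuM; exact: skew_in.
    rewrite lt0n; apply/negP => /eqP e; move: d.
    by rewrite e nu0; exact: skew_notin.
  exists M.-1; first by rewrite mem_iota add0n /= prednK.
  by rewrite /= prednK // nuM; exact: skew_in.
have idxP b s : s <= M -> idx b < s <-> diag (nu s) (val b).
  move=> sM; split=> [lt|].
    have h : has (fun s => in_diag (nu s.+1) (val b)) (iota 0 M).
      by rewrite has_find size_iota; exact: idxM.
    have := nth_find 0 h; rewrite -/(idx b) nth_iota // add0n => d.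
    exact: (mono _ _ lt sM).
  case: s sM => [|s] sM; first by rewrite nu0 => /skew_notin.
  move=> d; rewrite ltnS leqNgt; apply/negP => lt.
  by have := before_find 0 lt; rewrite nth_iota // add0n => /negP; apply.
pose U : filling lam mu := [ffun b => a (idx b)].
have iU b : index (U b) al = idx b by rewrite ffunE index_uniq ?(al_uniq alS).
have ft : fits k n al U nu.
  split=> //.
  - by move=> s /nuP[].
  - by move=> b; rewrite ffunE mem_nth.
  move=> s b sM; split=> [db|[mb|[x <-]]].
  - have [mb|nb] := pselect (diag mu b); [by left|right].
    have [|x xb] := skew_mem kl _ nb; first by rewrite -nuM; apply: mono db.
    by exists x => //; rewrite iU; apply/idxP => //; rewrite xb.
  - by apply: (mono 0 s) => //; rewrite nu0.
  - by rewrite iU => /idxP; apply.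
have tU := (tableau_fits n0 alS alA ft).2 ls.
exists U; split=> //; first by case: ft.
apply: (@eq_from_tnth _ _ (chain U) c) => -[s sM].
rewrite !(tnth_nth (wd mu)) nth_chain // shapesS // -[RHS]/(w s.+1).
have [[k1 g1] ->] := nuP _ sM; congr (wordof k n _).
have := U_le_step alS ft sM => e.
rewrite /shape; case: xgetP => [x _ [kx dx]|/(_ (nu s.+1))[]]; last by [].
by apply: (diag_inj kx k1); rewrite dx e.
Qed.

(** A path of nonzero weight from [mu] to [lam] passes through words of partitions only and is the
    chain of a tableau; chains of distinct tableaux are distinct. *)
Lemma path_sum (E : seq (filling lam mu)) : uniq E ->
    (forall U, U \in E <-> ktritableau n k U /\ forall c, U c \in al) ->
  (entry (\prod_(x <- rev al) letter_matrix k n om x) (wd lam) (wd mu) =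
   \sum_(U <- E) \prod_(i < M) step_weight U i)%R.
Proof.
move=> uE memE; rewrite entry_path.
transitivity (\sum_(c <- map chain E) path_weight c)%R; last first.
  rewrite big_map; apply: eq_big_seq => U /memE[tU Ua].
  exact: path_weight_chain.
have um : uniq (map chain E).
  rewrite map_inj_in_uniq // => U V /memE[tU Ua] /memE[tV Va].
  exact: chain_inj.
rewrite (big_uniq _ um) /= [LHS]big_mkcond [RHS]big_mkcond; apply: eq_bigr => c _.
have [/mapP[U /memE[tU Ua] ->]|nc] := boolP (c \in map chain E).
  have [_ eM _ _ _] := tableau_shapes tU Ua.
  by rewrite last_chain eM eqxx.
case: eqP => // cl; apply/eqP; rewrite -[X in X == _]/(path_weight c).
apply: contraNT nc => /eqP /path_weight_neq0 /(_ cl)[U [tU Ua <-]].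
by apply: map_f; apply/memE.
Qed.

End Weighted.

End ChainSum.

Lemma sumn_col_le mu nu : (forall c, 0 < c -> col_length mu c <= col_length nu c) ->
  sumn mu <= sumn nu.
Proof.
move=> H; have le_sumn (l : seq nat) p : p \in l -> p <= sumn l.
  by elim: l => //= x l IH; rewrite inE => /predU1P[->|/IH]; lia.
have [C hm hn] : exists2 C, sumn mu <= C & sumn nu <= C.
  by exists (sumn mu + sumn nu); lia.
rewrite (@sumn_cols mu C) => [|p /le_sumn]; last by lia.
rewrite (@sumn_cols nu C) => [|p /le_sumn]; last by lia.
rewrite big_nat_cond [X in _ <= X]big_nat_cond.
by apply: leq_sum => c /andP[/andP[c0 _] _]; apply: H.
Qed.

Lemma diag_cols k nu rho : kstrict k nu -> kstrict k rho ->
  (diag nu `<=` diag rho)%classic -> forall c, 0 < c -> col_length nu c <= col_length rho c.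
Proof.
move=> kn kr sub c c0.
by have /sub /(diagP kr)[] : diag nu (col_length nu c, c) by apply/(diagP kn).
Qed.

Section Weight.

Variables (k n : nat) (lam mu : seq nat) (al : seq letter).
Hypotheses (n0 : 0 < n) (alS : sorted letter_lt al) (alA : all (in_alphabet n) al).
Variables (U : filling lam mu) (nu : nat -> seq nat).
Hypothesis ft : fits k n al U nu.

Local Notation M := (size al).
Local Notation a s := (nth (Plain 0) al s).

Lemma card_step s : s < M ->
  #|[pred c | U c == a s]| = sumn (nu s.+1) - sumn (nu s).
Proof.
have [nu0 nuM kg Ua fb] := ft; move=> sM.
have mono p q : p <= q -> q <= M -> forall c, 0 < c ->
    col_length (nu p) c <= col_length (nu q) c.
  move=> pq qM; apply: diag_cols (kg _ (leq_trans pq qM)).1 (kg _ qM).1 _.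
  exact: (diag_mono ft).
have kl := (kg _ (leqnn M)).1; rewrite nuM in kl.
have km := (kg 0 (leq0n M)).1; rewrite nu0 in km.
have cnt t : t <= M -> #|[pred c | index (U c) al < t]| = sumn (nu t) - sumn mu.
  move=> tM; rewrite -(card_skew kl km (kg _ tM).1) => [|c c0|c c0].
  - by apply: eq_card => c; rewrite !inE; apply/idP/idP => /(mem_step ft c tM).
  - by rewrite -nu0; apply: mono.
  - by rewrite -[in X in _ <= X]nuM; apply: mono.
have h0 : sumn mu <= sumn (nu s) by rewrite -nu0; apply: sumn_col_le; apply: mono; rewrite // ltnW.
have h1 : #|[pred c | index (U c) al < s.+1]| =
    #|[pred c | index (U c) al < s]| + #|[pred c | U c == a s]|.
  rewrite -cardUI [X in _ = _ + X](_ : _ = 0) ?addn0.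
    apply: eq_card => c; rewrite !inE ltnS leq_eqVlt orbC; congr (_ || _).
    apply/eqP/eqP => [<-|->]; first by rewrite nth_index.
    by rewrite index_uniq // (al_uniq alS).
  apply: eq_card0 => c; rewrite !inE; apply/negP => /andP[lt /eqP e].
  by move: lt; rewrite e index_uniq ?(al_uniq alS) // ltnn.
by move: h1; rewrite !cnt ?(ltnW sM) //; lia.
Qed.

Lemma prod_step (R : comNzRingType) (om : letter -> R) :
  (\prod_(i < M) om (a i) ^+ (sumn (nu i.+1) - sumn (nu i)) =
   \prod_(c : Defs.skew lam mu) om (U c))%R.
Proof.
have [_ _ _ Ua _] := ft.
pose ix (c : Defs.skew lam mu) : 'I_M := Ordinal (etrans (index_mem (U c) al) (Ua c)).
rewrite [RHS](partition_big ix xpredT) //=; apply: eq_bigr => i _.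
rewrite -card_step // (eq_bigr (fun => om (a i))) => [|c /eqP <-]; last by rewrite /= nth_index.
rewrite prodr_const; congr (_ ^+ _)%R; apply: eq_card => c.
rewrite !inE; apply/eqP/eqP => [e|<-]; last by rewrite /= nth_index.
by rewrite /= e index_uniq // (al_uniq alS).
Qed.

Lemma n_strip_refl x : kstrict k x -> good k n (tw k x) -> n_strip k (diag x) (diag x) = 0.
Proof.
move=> kx gx; rewrite (n_strip_tops kx kx (cut_strip_refl k x) (n := n)) => [|v nv].
  rewrite /strip_tops; apply/eqP; rewrite -leqn0 leqNgt -has_count.
  by apply/hasPn => v _; rewrite zero_cut_refl.
exact: zero_cut_refl.
Qed.

(** The sum in [n_tableau] runs over all unmarked letters; those outside [al] contribute an empty
    strip, whose cuts are all uncrossed and which counts 0. *)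
Lemma n_tableau_steps :
  n_tableau k U = \sum_(i < M) letter_pow k (a i) (nu i.+1) (nu i).
Proof.
have [nu0 nuM kg Ua fb] := ft.
pose F i := n_strip k (U_le U (Plain i)) (U_lt U (Plain i)).
pose r := pmap (fun x => if x is Plain i then Some i else None) al.
have memr i : (i \in r) = (Plain i \in al).
  rewrite mem_pmap; apply/mapP/idP => [[[j|j|j] xa //= [->]] //|h].
  by exists (Plain i).
have ur : uniq r.
  apply: (@pmap_uniq _ _ _ Plain) (al_uniq alS).
  by case=> //= j.
transitivity (\sum_(i <- r) F i).
  rewrite (fsbig_seq _ _ ur); apply/esym/fsbig_widen.
    move=> i /=; rewrite memr => /(allP alA) //.
  move=> i [_ /= /negP]; rewrite memr => h.
  have [s sM e] := U_lt_gap alS ft (Plain i).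
  by rewrite /F /preimage /= (U_gap ft h) e; have [k1 g1] := kg _ sM; exact: n_strip_refl.
transitivity (\sum_(x <- al) (if x is Plain i then F i else 0)).
  rewrite /r; elim: (al) => [|[i|i|i] l IH]; rewrite /= ?big_nil // !big_cons //= IH //.
rewrite (big_nth (Plain 0)) big_mkord; apply: eq_bigr => -[s sM] _ /=.
rewrite /letter_pow -(U_le_step alS ft sM) -(U_lt_step alS ft sM).
by case: (a s).
Qed.

Lemma tableau_weight (R : comNzRingType) (om : letter -> R) :
  (\prod_(i < M) (2 ^+ letter_pow k (a i) (nu i.+1) (nu i) *
      om (a i) ^+ (sumn (nu i.+1) - sumn (nu i))) =
   2 ^+ n_tableau k U * \prod_(c : Defs.skew lam mu) om (U c))%R.
Proof. by rewrite big_split /= prod_step n_tableau_steps expr_sum. Qed.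

End Weight.

(** * Coefficients of the power series *)

Lemma alphabet_sorted n N : sorted letter_lt (alphabet n N).
Proof.
rewrite (sorted_pairwise letter_lt_trans) /alphabet !pairwise_cat !pairwise_map.
have Pm (r : rel nat) s : (forall i j, i < j -> r i j) -> sorted ltn s -> pairwise r s.
  by move=> H; rewrite (sorted_pairwise ltn_trans); apply: sub_pairwise.
apply/and3P; split; last apply/and3P; last split.
- by apply/allrelP => x y /mapP[i _ ->]; rewrite mem_cat => /orP[] /mapP[j _ ->].
- have gt : pairwise gtn (rev (iota 1 n.-1)).
    by rewrite -(sorted_pairwise (rev_trans ltn_trans)) rev_sorted iota_ltn_sorted.
  apply: sub_pairwise gt => i j /= ij.
  by rewrite /= /letter_lt /= (ltnW ij) andbT; apply/eqP => -[]; lia.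
- by apply/allrelP => x y /mapP[i _ ->] /mapP[j _ ->].
- apply: Pm (iota_ltn_sorted _ _) => i j ij.
  by rewrite /= /letter_lt /= (ltnW ij) andbT; apply/eqP => -[]; lia.
- apply: Pm (iota_ltn_sorted _ _) => i j ij.
  by rewrite /= /letter_lt /= (ltnW ij) andbT; apply/eqP => -[]; lia.
Qed.

Lemma mem_alphabet n N x : x \in alphabet n N =
  in_alphabet n x && (if x is Plain i then i <= N else true).
Proof.
rewrite /alphabet !mem_cat; apply/idP/idP.
  case/or3P => /mapP[i]; rewrite ?mem_rev mem_iota => hi -> /=; lia.
case: x => i /= hi; apply/or3P.
- by constructor 1; apply: map_f; rewrite mem_rev mem_iota; lia.
- by constructor 2; apply: map_f; rewrite mem_iota; lia.
- by constructor 3; apply: map_f; rewrite mem_iota; lia.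
Qed.

Section Fillings.

Variables (lam mu : seq nat) (al : seq letter).

Definition fillings_in : seq (filling lam mu) :=
  undup [seq [ffun c => nth (Plain 0) al (f c)] | f : {ffun Defs.skew lam mu -> 'I_(size al)}].

Lemma mem_fillings_in U : U \in fillings_in <-> forall c, U c \in al.
Proof.
rewrite mem_undup; split=> [/mapP[f _ ->] c|Ua]; first by rewrite ffunE mem_nth.
apply/mapP; exists [ffun c => Ordinal (etrans (index_mem (U c) al) (Ua c))].
  by rewrite mem_enum.
by apply/ffunP => c; rewrite !ffunE /= nth_index.
Qed.

End Fillings.

Lemma letter_weight_supp a : msupp (letter_weight a) = [fset ucm a]%fset.
Proof. by case: a => i; rewrite /= ?msuppN msuppU1. Qed.

(** Each weight is a variable up to sign, so every letter of the filling divides the only monomial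
    that can occur. *)
Lemma prod_weight_supp (r : seq letter) (m : monomial) :
  ((\prod_(a <- r) letter_weight a)@_m != 0)%R -> forall a, a \in r -> m a != 0.
Proof.
elim: r m => [|a r IH] m //; rewrite big_cons mcoeff_neq0.
move=> /msuppM_le[m1 [m2 [h1 h2 ->]]] b.
have -> : m1 = ucm a by apply/fset1P; rewrite -letter_weight_supp.
have {}h2 : ((\prod_(x <- r) letter_weight x)@_m2 != 0)%R by rewrite mcoeff_neq0.
rewrite cmM cmU inE.
case/predU1P => [->|br]; first by rewrite eqxx.
by have := IH m2 h2 b br; lia.
Qed.

Section Final.

Variables (k : nat) (lam mu : seq nat) (n : nat).
Hypotheses (kl : kstrict k lam) (km : kstrict k mu) (cp : compatible_pair k lam mu).
Hypotheses (n0 : 0 < n) (hl : W n (kgrass k lam)).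

Let tableau_poly (U : filling lam mu) : polyZ := (2%:R ^+ n_tableau k U * xyz U)%R.

Definition tableaux_in N : seq (filling lam mu) :=
  [seq U <- fillings_in lam mu (alphabet n N) | `[< ktritableau n k U >] ].

Lemma mem_tableaux_in N U : U \in tableaux_in N <->
  ktritableau n k U /\ forall c, U c \in alphabet n N.
Proof.
rewrite mem_filter; split=> [/andP[/asboolP h1 /mem_fillings_in h2]|[h1 h2]] //.
by apply/andP; split; [exact/asboolP|apply/mem_fillings_in].
Qed.

Lemma tableaux_in_uniq N : uniq (tableaux_in N).
Proof. by rewrite filter_uniq // undup_uniq. Qed.

Lemma schubert_trunc_tableaux N :
  schubert_C_trunc n (kgrass k lam * (kgrass k mu)^-1)%g N =
  (\sum_(U <- tableaux_in N) tableau_poly U)%R.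
Proof.
have gl := good_tw kl hl; have [_ gm ml _] := compatible_good kl km hl cp.
have alS := alphabet_sorted n N.
have alA : all (in_alphabet n) (alphabet n N).
  by apply/allP => x; rewrite mem_alphabet => /andP[].
rewrite (schubert_entry n0 N kl km hl cp).
rewrite (path_sum n0 alS alA kl gl km gm ml _ (tableaux_in_uniq N)); last first.
  exact: mem_tableaux_in.
apply: eq_big_seq => U /mem_tableaux_in[tU Ua].
have ft := tableau_shapes n0 alS alA kl gl km ml tU Ua.
exact: (tableau_weight n0 alS alA ft letter_weight).
Qed.

Lemma tableau_poly_supp U m : ((tableau_poly U)@_m != 0)%R -> forall c, m (U c) != 0.
Proof.
rewrite /tableau_poly -natrX mulr_natl mcoeffMn => h c.
have {}h : ((xyz U)@_m != 0)%R by apply: contraNN h => /eqP->; rewrite mul0rn.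
rewrite /xyz -(big_map U xpredT letter_weight) in h.
apply: (prod_weight_supp h); apply: map_f.
exact: mem_index_enum.
Qed.

(** A tableau contributing to [m] uses only letters that occur in [m], hence is among the finitely
    many over [alphabet n N]. The coefficient is therefore the same for all large [N], which is the
    limit defining [schubert_C]. *)
Lemma coefficient_sum N (m : monomial) : (forall i, m (Plain i) != 0 -> i <= N) ->
  finite_set (@ktritableau n k lam mu `&` [set U | (tableau_poly U)@_m != 0])%R%classic /\
  (\sum_(U \in @ktritableau n k lam mu) (tableau_poly U)@_m =
   (schubert_C_trunc n (kgrass k lam * (kgrass k mu)^-1)%g N)@_m)%R.
Proof.
move=> hN.
have cap U : ktritableau n k U -> ((tableau_poly U)@_m != 0)%R -> U \in tableaux_in N.
  move=> tU nz; apply/mem_tableaux_in; split=> // c; rewrite mem_alphabet.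
  have [ab _ _ _ _] := tU; rewrite ab /=.
  by have := tableau_poly_supp nz c; case: (U c) => // i /hN.
split.
  apply: (@sub_finite_set _ _ [set` tableaux_in N]) (finite_seq _).
  by move=> U [tU nz]; exact: cap.
rewrite schubert_trunc_tableaux raddf_sum (fsbig_seq _ _ (tableaux_in_uniq N)).
apply/esym/fsbig_widen; first by move=> U /= /mem_tableaux_in[].
move=> U [tU /= nU]; apply/eqP; apply: contra_notT nU; exact: cap.
Qed.

Lemma tableaux_sum : fps_has_sum (@ktritableau n k lam mu) tableau_poly
  (schubert_C n (kgrass k lam * (kgrass k mu)^-1)%g).
Proof.
move=> m; have [N0 hN0] : exists N0, forall i, m (Plain i) != 0 -> i <= N0.
  exists (\max_(x <- finsupp m) (if x is Plain i then i else 0)) => i.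
  rewrite cmE_neq0 => im.
  exact: (@leq_bigmax_seq _ _ xpredT (fun x => if x is Plain i then i else 0) (Plain i)).
have hN N : N0 <= N -> forall i, m (Plain i) != 0 -> i <= N.
  by move=> le i /hN0 /leq_trans; apply.
split; first exact: (coefficient_sum hN0).1.
rewrite /schubert_C /fps_lim.
set S := [set c | _]%classic; set w := (_ * _)%g in S *.
set c0 := (\sum_(U \in _) _)%R.
have Sc0 : S c0.
  by exists N0 => N le; rewrite /c0 (coefficient_sum (hN N le)).2.
apply/esym; case: xgetP => [c _ [N1 h1]|/(_ c0)//].
have [N2 h2] := Sc0.
by rewrite -(h1 (maxn N1 N2)) ?leq_maxl // h2 // leq_maxr.
Qed.

End Final.

Local Open Scope ring_scope.

Theorem theorem3p5 (k : nat) (lam mu : seq nat) (n : nat)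
    (lam_strict : kstrict k lam) (mu_strict : kstrict k mu)
    (lam_mu_compatible : compatible_pair k lam mu)
    (n_pos : (1 <= n)%N) (lam_in_Wn : W n (kgrass k lam)) :
  fps_has_sum (@ktritableau n k lam mu)
    (fun U : filling lam mu => 2%:R ^+ n_tableau k U * xyz U)
    (schubert_C n (kgrass k lam * (kgrass k mu)^-1)%g).
Proof. exact: tableaux_sum. Qed.
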